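(* Let $M^n$ be a complete, connected, oriented $n$-dimensional self-shrinker hypersurface properly immersed in $\mathbb{R}^{n+1}$, with Gauss map $\gamma:M\to S^n$. If $\gamma(M)\subset S^n\setminus\overline{S}_+^{\,n-1}$, then $M$ is a hyperplane.
   Context: A self-shrinker is an immersed submanifold $X:M\to\mathbb{R}^{n+1}$ satisfying $H=-\frac12 X^N$, where $X$ is the position vector, $X^N$ its orthogonal projection onto the normal bundle, and the mean curvature vector $H$ is the trace of the second fundamental form $B_{VW}=(\overline\nabla_VW)^N$ with respect to the induced metric (no factor $1/n$; $\overline\nabla$ is the flat connection of $\mathbb{R}^{n+1}$). $M$ carries the induced metric, which is assumed complete. The Gauss map $\gamma$ sends $p\in M$ to the oriented $n$-plane parallel to $T_pM$ through the origin; the Grassmannian of oriented $n$-planes in $\mathbb{R}^{n+1}$ is identified with the unit sphere $S^n\subset\mathbb{R}^{n+1}$, so $\gamma(p)$ is the oriented unit normal at $p$. $\overline{S}_+^{\,n-1}$ denotes a closed hemisphere of codimension one in $S^n$: in suitable orthonormal coordinates $(x_1,\dots,x_{n+1})$ of $\mathbb{R}^{n+1}$, $\overline{S}_+^{\,n-1}=\{x\in S^n: x_2=0,\ x_1\le 0\}$. *)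

(* Defs.v *)
From HB Require Import structures.
From mathcomp Require Import all_boot all_order all_algebra.
From mathcomp Require Import all_classical all_reals all_analysis.

Set Implicit Arguments.
Unset Strict Implicit.
Unset Printing Implicit Defensive.

Import Order.TTheory GRing.Theory Num.Theory.
Import numFieldNormedType.Exports.

Local Open Scope classical_set_scope.
Local Open Scope ring_scope.

(** ** Euclidean geometry of row vectors

The norm [`|x|] of the library on ['rV[R]_n] is the sup norm: it induces the
right topology and notion of derivative, but lengths and angles have to be
measured with [dotp] and [enorm]. *)

Definition dotp (R : realType) (n : nat) (x y : 'rV[R]_n) : R :=
  (x *m y^T) 0 0.

Definition enorm (R : realType) (n : nat) (x : 'rV[R]_n) : R :=
  Num.sqrt (dotp x x).

Definition unit_sphere (R : realType) (n : nat) : set 'rV[R]_n.+1 :=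
  [set x | enorm x = 1].

(** [x *m Q] is the row of coordinates of [x] in the orthonormal basis formed
by the columns of [Q]; the coordinates x_1 and x_2 have indices [0] and [1]
([inord 1] has value 1 as soon as [0 < n]). *)
Definition closed_hemisphere_codim1 (R : realType) (n : nat)
    (S : set 'rV[R]_n.+1) : Prop :=
  exists Q : 'M[R]_n.+1, Q^T *m Q = 1%:M /\
    S = [set x | unit_sphere x /\
                 (x *m Q) 0 (inord 1) = 0 /\ (x *m Q) 0 ord0 <= 0].

Definition is_hyperplane (R : realType) (n : nat) (P : set 'rV[R]_n.+1) : Prop :=
  exists (a : 'rV[R]_n.+1) (b : R), a != 0 /\ P = [set x | dotp x a = b].

(** ** Smooth maps

For [U] open, all iterated directional derivatives of [f] are differentiable
at every point of [U] iff [f] is C^oo on [U]; values of [f] outside [U] play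
no role. *)
Definition smooth_on (R : realType) (V W : normedModType R) (U : set V)
    (f : V -> W) : Prop :=
  forall (vs : seq V) (x : V), U x ->
    differentiable (foldr (fun v (g : V -> W) => 'D_v g) f vs) x.

(** ** Smooth manifolds

[cmap] and [cinv] are total functions, meaningful on [cdom] and [cimg] only,
where they are inverse homeomorphisms between open sets. *)
Record chart (R : realType) (n : nat) (M : topologicalType) := Chart {
  cdom : set M ;
  cimg : set 'rV[R]_n ;
  cmap : M -> 'rV[R]_n ;
  cinv : 'rV[R]_n -> M ;
  open_cdom : open cdom ;
  open_cimg : open cimg ;
  cmap_img : forall p, cdom p -> cimg (cmap p) ;
  cinv_dom : forall u, cimg u -> cdom (cinv u) ;
  cmapK : forall p, cdom p -> cinv (cmap p) = p ;
  cinvK : forall u, cimg u -> cmap (cinv u) = u ;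
  cmap_continuous : forall p, cdom p -> {for p, continuous cmap} ;
  cinv_continuous : forall u, cimg u -> {for u, continuous cinv}
}.

Definition transition (R : realType) (n : nat) (M : topologicalType)
    (k l : chart R n M) : 'rV[R]_n -> 'rV[R]_n := cmap l \o cinv k.

Definition overlap (R : realType) (n : nat) (M : topologicalType)
    (k l : chart R n M) : set 'rV[R]_n :=
  cimg k `&` cinv k @^-1` cdom l.

Record smooth_manifold (R : realType) (n : nat) := SmoothManifold {
  carrier :> topologicalType ;
  manifold_hausdorff : hausdorff_space carrier ;
  manifold_countable : @second_countable carrier ;
  atlas : set (chart R n carrier) ;
  atlas_cover : forall p : carrier, exists2 k, atlas k & cdom k p ;
  atlas_smooth : forall k l, atlas k -> atlas l ->
    smooth_on (overlap k l) (transition k l)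
}.

Arguments atlas {R n} s _.

(** The orientation of an oriented manifold is the one carried by its atlas
(which is not required to be maximal). *)
Definition oriented (R : realType) (n : nat) (M : smooth_manifold R n) : Prop :=
  forall k l, atlas M k -> atlas M l ->
    forall u, overlap k l u -> 0 < \det ('J (transition k l) u).

(** ** Immersed hypersurfaces *)

Section Hypersurface.
Context (R : realType) (n : nat) (M : smooth_manifold R n).
Implicit Types (X : M -> 'rV[R]_n.+1) (Y : 'rV[R]_n -> 'rV[R]_n.+1).
Implicit Types (k : chart R n M) (u v w : 'rV[R]_n).

(** Row [i] of ['J Y u] is the partial derivative of [Y] along the [i]-th
coordinate. *)
Definition immersion X : Prop :=
  forall k, atlas M k -> smooth_on (cimg k) (X \o cinv k) /\
    forall u, cimg k u -> row_free ('J (X \o cinv k) u).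

Definition proper_map X : Prop :=
  forall K : set 'rV[R]_n.+1, compact K -> compact (X @^-1` K).

Definition induced_metric Y u : 'M[R]_n := 'J Y u *m ('J Y u)^T.

(** With [J := 'J Y u] and [g := J *m J^T], the orthogonal projection of [x]
onto the tangent space, i.e. onto the row space of [J], is
[x *m J^T *m g^-1 *m J]. *)
Definition normal_part Y u (x : 'rV[R]_n.+1) : 'rV[R]_n.+1 :=
  x - x *m ('J Y u)^T *m invmx (induced_metric Y u) *m 'J Y u.

(** The second fundamental form on the tangent vectors represented by [v] and
[w], the latter being extended to the tangent vector field ['D_w Y]. *)
Definition second_fundamental_form Y u v w : 'rV[R]_n.+1 :=
  normal_part Y u ('D_v ('D_w Y) u).

(** Trace with respect to the induced metric: the sum of the
g^{ij} B(e_i, e_j) over the coordinate frame. *)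
Definition mean_curvature Y u : 'rV[R]_n.+1 :=
  \sum_(i < n) \sum_(j < n) invmx (induced_metric Y u) i j *:
    second_fundamental_form Y u (delta_mx 0 i) (delta_mx 0 j).

Definition self_shrinker X : Prop :=
  forall k, atlas M k -> forall u, cimg k u ->
    mean_curvature (X \o cinv k) u
      = - (1 / 2) *: normal_part (X \o cinv k) u (X (cinv k u)).

(** [gamma p] is the unit normal [nu] at [p] such that
(nu, d_1 X, ..., d_n X) is a direct basis in every chart of the atlas. *)
Definition gauss_map X (gamma : M -> 'rV[R]_n.+1) : Prop :=
  forall p, unit_sphere (gamma p) /\
    forall k, atlas M k -> cdom k p ->
      let J := 'J (X \o cinv k) (cmap k p) in
      gamma p *m J^T = 0 /\ 0 < \det (col_mx (gamma p) J : 'M[R]_(1 + n)).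

(** ** Completeness of the induced metric *)

Definition smooth_curve (c : R -> M) : Prop :=
  exists I : set R, open I /\ `[0, 1]%classic `<=` I /\
    (forall t, I t -> {for t, continuous c}) /\
    (forall k, atlas M k -> smooth_on (I `&` c @^-1` cdom k) (cmap k \o c)).

Definition curve_length X (c : R -> M) : R :=
  \int[lebesgue_measure]_(t in `[0, 1]) enorm (derive1 (X \o c) t).

(** [joined X p q L]: there is a piecewise smooth curve of length [L] from [p]
to [q]. *)
Inductive joined X (p : M) : M -> R -> Prop :=
| joined_refl : joined X p p 0
| joined_step (c : R -> M) (L : R) : joined X p (c 0) L -> smooth_curve c ->
    joined X p (c 1) (L + curve_length X c).

Definition riemannian_distance X (p q : M) : R := inf [set L | joined X p q L].

(** The infimum above is a genuine distance on connected manifolds only: the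
library sets [inf set0 = 0]. *)
Definition complete_metric X : Prop :=
  forall s : nat -> M,
    (forall e : R, 0 < e -> exists N : nat, forall i j : nat,
      (N <= i)%N -> (N <= j)%N -> riemannian_distance X (s i) (s j) < e) ->
    exists p : M, riemannian_distance X (s i) p @[i --> \oo] --> (0 : R).

(** [M], immersed by [X], is a hyperplane: [X] is one-to-one onto it. *)
Definition immersed_as_hyperplane X : Prop :=
  injective X /\ is_hyperplane (range X).

End Hypersurface.

(* Main.v *)
(* A half-space argument with the Gaussian weight [w = exp (- |X|^2 / 4)].  On a self-shrinker every
   coordinate [f = <gamma, b>] of the Gauss map satisfies [Delta f - <X, grad f> / 2 = - |A|^2 f].
   The image of [gamma] avoids a closed half of a great sphere of codimension one, so that the polar
   angle [theta] of two coordinates [u, v] of [gamma] is a well-defined bounded function; the field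
   [u grad v - v grad u = (u^2 + v^2) grad theta] is divergence free for the weight [w].  Since a
   proper self-shrinker has finite weighted area, testing with [theta] times a cut-off shows that
   [theta] is constant, that is, some [f = <gamma, b>] is positive.  Testing with [1 / f] then gives
   [A = 0].  Hence [gamma] is constant, the equation of self-shrinkers gives [<X, gamma> = 0], and
   [X], a proper local homeomorphism into the hyperplane orthogonal to [gamma], is bijective.

   The integration over the hypersurface is that of flat space over a collar of width [eps], divided
   by [eps]; the integral of flat space is a generalized limit of Riemann sums on dyadic lattices.
   Tangential divergences become ordinary ones in Fermi coordinates, i.e. for functions extended to
   be constant along the normals. *)
From HB Require Import structures.
Require Import Defs.
From mathcomp Require Import all_boot all_order all_algebra.
From mathcomp Require Import all_classical all_reals all_analysis.
From mathcomp Require Import ring lra zify.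
Set Implicit Arguments.
Unset Strict Implicit.
Unset Printing Implicit Defensive.
Import Order.TTheory GRing.Theory Num.Theory.
Import numFieldNormedType.Exports.
Local Open Scope classical_set_scope.
Local Open Scope ring_scope.

(** * Smooth functions *)

(** Both tests go through one inequality, [caccioppoli]. A tangent field Z and a function g are
    multiplied by the weight and by the square of a cut-off in |X|^2 / t; the gradient of this
    cut-off is a multiple of the tangential part of X, so distances on M are never estimated, and
    properness makes its support compact. If the weighted divergence A of g Z dominates an energy E
    >= 0 and (g <X, Z>)^2 <= C |X|^2 (A - E), the error is O(1 / t) times the weighted area, hence E
    = 0. The pairs are g = theta / 2, Z = u grad v - v grad u, where C comes from the bound on
    theta, and g = - 1 / f, Z = grad f, where C = 1 by Cauchy-Schwarz. What has to be built is a
    strictly positive linear functional on compactly supported continuous functions of M that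
    satisfies the divergence theorem. Sheets may cross in the ambient space, so collars are indexed
    by points of M, not by their image. No limit is proved to exist: ultrafilter limits are linear
    on bounded sequences, and it suffices to bound collar quotients above and away from 0, and to
    show that those of a divergence tend to 0. *)

Section DiffEps.
Context {R : realType} {V W : normedModType R}.

(** Epsilon form of the little-o definition, the shape in which the estimate for a local inverse is
    obtained. *)
Lemma is_diff_eps (f : V -> W) (df : {linear V -> W}) x : continuous df ->
  (forall e : R, 0 < e ->
     \forall h \near (0 : V), `|f (h + x) - f x - df h| <= e * `|h|) ->
  is_diff x f df.
Proof.
move=> dfc fe.
have fo : f \o shift x = cst (f x) + df +o_ (nbhs (0 : V)) id.
  apply/eqaddoP => e e0; have := fe e e0; apply: filterS => h.
  by rewrite -[(_ - _ : _ -> _) h]/(f (h + x) - (f x + df h)) opprD addrA.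
have dE := diff_unique dfc fo.
by split=> //; apply/diff_locallyP; rewrite dE.
Qed.

Lemma diff_eps (f : V -> W) x : differentiable f x -> forall e : R, 0 < e ->
  \forall h \near (0 : V), `|f (h + x) - f x - 'd f x h| <= e * `|h|.
Proof.
move=> /diff_locallyP[_ /eqaddoP fe] e e0; have := fe e e0; apply: filterS => h.
by rewrite -[(_ - _ : _ -> _) h]/(f (h + x) - (f x + 'd f x h)) opprD addrA.
Qed.

End DiffEps.

Lemma near_eq_is_diff {R : realType} {V W : normedModType R} (f g : V -> W) x :
  {near x, f =1 g} -> differentiable f x -> is_diff x g ('d f x).
Proof.
move=> fg df; apply: is_diff_eps; first exact: diff_continuous.
move=> e e0; have := diff_eps df e0.
have fg0 : \forall h \near (0 : V), f (h + x) = g (h + x).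
  have := fg; rewrite (near_shift 0 x) subr0; apply: filterS => h /=.
  by [].
rewrite (nbhs_singleton fg); apply: filterS2 fg0 => h ->.
by [].
Qed.

Lemma near_eq_differentiable {R : realType} {V W : normedModType R}
    (f g : V -> W) x :
  {near x, f =1 g} -> differentiable f x -> differentiable g x.
Proof. by move=> fg df; case: (near_eq_is_diff fg df). Qed.

Section Smooth.
Context {R : realType} {V : normedModType R}.
Implicit Types (U : set V) (f g : V -> R) (v : V).

(** [smooth_on] puts each new direction outermost, whereas [Ck] strips the innermost derivative: the
    regularity of f reduces to that of ['D_v f], and product, quotient and chain rules follow by
    induction on k with f varying. In [smooth_onE], [rcons] passes between the two orders. *)
Fixpoint Ck (k : nat) U f : Prop :=
  (forall x, U x -> differentiable f x) /\
  (if k is k'.+1 then forall v, Ck k' U ('D_v f) else True).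

Lemma Ck_diff k U f x : Ck k U f -> U x -> differentiable f x.
Proof. by case: k => [|k] [fU _]; exact: fU. Qed.

Lemma CkS k U f : Ck k.+1 U f -> Ck k U f.
Proof.
elim: k f => [|k IH] f; first by move=> -[].
by move=> [fU fk]; split=> // v; apply: IH; apply: fk.
Qed.

Lemma smooth_onE U f : smooth_on U f <-> forall k, Ck k U f.
Proof.
split=> [fU k|fC vs].
- have {fU} : forall vs x, U x -> differentiable (foldr (fun v (g : V -> R) => 'D_v g) f vs) x.
    exact: fU.
  elim: k f => [|k IH] f fU; first by split=> //; exact: (fU [::]).
  split; first exact: (fU [::]).
  by move=> v; apply: IH => vs x Ux; have := fU (rcons vs v) x Ux; rewrite foldr_rcons.
- have {fC} := fC (size vs); elim/last_ind: vs f => [|vs v IH] f fC x Ux.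
    by apply: Ck_diff fC Ux.
  rewrite foldr_rcons; apply: IH => //.
  by move: fC; rewrite size_rcons => -[_]; exact.
Qed.

Lemma eq_on_near U f g x : open U -> (forall y, U y -> f y = g y) -> U x ->
  {near x, f =1 g}.
Proof.
by move=> oU fg Ux; apply: filterS (open_nbhs_nbhs (conj oU Ux)) => y; exact: fg.
Qed.

Lemma eq_on_derive U f g x v : open U -> (forall y, U y -> f y = g y) -> U x ->
  'D_v f x = 'D_v g x.
Proof.
by move=> oU fg Ux; apply: near_eq_derive; apply: eq_on_near fg Ux.
Qed.

Lemma Ck_ext k U f g : open U -> (forall y, U y -> f y = g y) ->
  Ck k U f -> Ck k U g.
Proof.
move=> oU; elim: k f g => [|k IH] f g fg [fU fk].
  by split=> // x Ux; exact: (near_eq_differentiable (eq_on_near oU fg Ux) (fU x Ux)).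
split=> [x Ux|v]; first exact: (near_eq_differentiable (eq_on_near oU fg Ux) (fU x Ux)).
apply: IH (fk v) => y Uy; exact: (eq_on_derive v oU fg Uy).
Qed.

Lemma Ck_cst k U (c : R) : Ck k U (cst c).
Proof.
elim: k c => [|k IH] c; split=> // [v]; rewrite (_ : 'D_v (cst c) = cst 0) //.
by apply/funext => x; exact: derive_cst.
Qed.

Lemma CkD k U f g : open U -> Ck k U f -> Ck k U g -> Ck k U (fun x => f x + g x).
Proof.
move=> oU; elim: k f g => [|k IH] f g [fU fk] [gU gk].
  by split=> // x Ux; apply: differentiableD; [exact: fU|exact: gU].
split=> [x Ux|v]; first by apply: differentiableD; [exact: fU|exact: gU].
apply: (Ck_ext oU _ (IH _ _ (fk v) (gk v))) => x Ux.
by rewrite -(deriveD (diff_derivable (fU _ Ux)) (diff_derivable (gU _ Ux))).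
Qed.

Lemma CkM k U f g : open U -> Ck k U f -> Ck k U g -> Ck k U (fun x => f x * g x).
Proof.
move=> oU; elim: k f g => [|k IH] f g fC gC.
  by case: fC gC => fU _ [gU _]; split=> // x Ux; apply: differentiableM; [exact: fU|exact: gU].
have [fU fk] := fC; have [gU gk] := gC.
split=> [x Ux|v]; first by apply: differentiableM; [exact: fU|exact: gU].
apply: (Ck_ext oU _ (CkD oU (IH _ _ (CkS fC) (gk v)) (IH _ _ (CkS gC) (fk v)))) => x Ux.
have -> : 'D_v (fun x => f x * g x) x = 'D_v (f * g) x by [].
rewrite (deriveM (diff_derivable (fU _ Ux)) (diff_derivable (gU _ Ux))) /GRing.scale /=.
by rewrite addrC [g x * _]mulrC.
Qed.

Lemma CkZ k U (c : R) f : open U -> Ck k U f -> Ck k U (fun x => c * f x).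
Proof. by move=> oU; apply: CkM => //; exact: Ck_cst. Qed.

Lemma CkN k U f : open U -> Ck k U f -> Ck k U (fun x => - f x).
Proof.
move=> oU fC; apply: (Ck_ext oU _ (CkZ (-1) oU fC)) => y _.
by rewrite mulN1r.
Qed.

Lemma CkB k U f g : open U -> Ck k U f -> Ck k U g -> Ck k U (fun x => f x - g x).
Proof. by move=> oU fC gC; apply: CkD => //; exact: CkN. Qed.

Lemma Ck_sum k U (I : Type) (r : seq I) (P : pred I) (F : I -> V -> R) : open U ->
  (forall i, P i -> Ck k U (F i)) -> Ck k U (fun x => \sum_(i <- r | P i) F i x).
Proof.
move=> oU FC; elim: r => [|i r IH].
  by apply: (Ck_ext oU _ (Ck_cst k U 0)) => y _; rewrite big_nil.
have [Pi|nPi] := boolP (P i).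
  by apply: (Ck_ext oU _ (CkD oU (FC i Pi) IH)) => y _; rewrite big_cons Pi.
by apply: (Ck_ext oU _ IH) => y _; rewrite big_cons (negbTE nPi).
Qed.

Lemma Ck_prod k U (I : Type) (r : seq I) (P : pred I) (F : I -> V -> R) : open U ->
  (forall i, P i -> Ck k U (F i)) -> Ck k U (fun x => \prod_(i <- r | P i) F i x).
Proof.
move=> oU FC; elim: r => [|i r IH].
  by apply: (Ck_ext oU _ (Ck_cst k U 1)) => y _; rewrite big_nil.
have [Pi|nPi] := boolP (P i).
  by apply: (Ck_ext oU _ (CkM oU (FC i Pi) IH)) => y _; rewrite big_cons Pi.
by apply: (Ck_ext oU _ IH) => y _; rewrite big_cons (negbTE nPi).
Qed.

(** The derivative of 1 / f contains 1 / f itself, but is needed one order lower only: the induction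
    hypothesis for 1 / f feeds the product rule. The square root is treated in the same way. *)
Lemma CkV k U f : open U -> (forall x, U x -> f x != 0) -> Ck k U f ->
  Ck k U (fun x => (f x)^-1).
Proof.
move=> oU f0; elim: k => [|k IH] fC.
  by case: fC => fU _; split=> // x Ux; apply: differentiableV; [exact: fU|exact: f0].
have [fU fk] := fC; split=> [x Ux|v].
  by apply: differentiableV; [exact: fU|exact: f0].
have fVC := IH (CkS fC).
apply: (Ck_ext oU _ (CkN oU (CkM oU (CkM oU fVC fVC) (fk v)))) => x Ux.
rewrite (deriveV (f0 _ Ux) (diff_derivable (fU _ Ux))) -mulNr /GRing.scale /=.
by rewrite -exprVn expr2.
Qed.

Lemma is_derive_comp1 (g : R -> R) (dg : R) f x v :
  is_derive (f x) 1 g dg -> differentiable f x ->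
  differentiable (g \o f) x /\ 'D_v (g \o f) x = dg * 'D_v f x.
Proof.
move=> [/derivable1_diffP dg1 gE] df.
have dgf : differentiable (g \o f) x by exact: differentiable_comp.
split=> //; rewrite !deriveE // diff_comp //=.
by rewrite -[X in 'd g _ X]mulr1 [LHS]linearZ -[in RHS]gE deriveE // mulrC.
Qed.

Lemma Ck_sqrt k U f : open U -> (forall x, U x -> 0 < f x) -> Ck k U f ->
  Ck k U (fun x => Num.sqrt (f x)).
Proof.
move=> oU f0; elim: k => [|k IH] fC.
  case: fC => fU _; split=> // x Ux.
  by have [] := is_derive_comp1 0 (is_derive1_sqrt (f0 _ Ux)) (fU _ Ux).
have [fU fk] := fC; split=> [x Ux|v].
  by have [] := is_derive_comp1 0 (is_derive1_sqrt (f0 _ Ux)) (fU _ Ux).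
have sC := IH (CkS fC).
have s0 : forall x, U x -> 2 * Num.sqrt (f x) != 0.
  by move=> x Ux; rewrite mulf_neq0 // gt_eqF // sqrtr_gt0 f0.
apply: (Ck_ext oU _ (CkM oU (CkV oU s0 (CkZ 2 oU sC)) (fk v))) => x Ux.
by have [_ <-] := is_derive_comp1 v (is_derive1_sqrt (f0 _ Ux)) (fU _ Ux).
Qed.

End Smooth.

(** * Mean values along lines and symmetry of second derivatives *)

Section Lines.
Context {R : realType} {V : normedModType R}.
Implicit Types (f : V -> R) (x v w : V).

Lemma is_derive_line f c v (s : R) : differentiable f (c + s *: v) ->
  is_derive s 1 (fun s => f (c + s *: v)) ('D_v f (c + s *: v)).
Proof.
move=> df; pose l := fun s : R => c + s *: v.
have dl : is_diff s l (fun t => t *: v).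
  rewrite (_ : (fun t => t *: v) = 0 + ( *:%R^~ v)); last first.
    by apply/funext => t; rewrite -[RHS]/(0 + t *: v) add0r.
  rewrite (_ : l = cst c + ( *:%R^~ v)); last by apply/funext.
  exact: is_diffD.
have dlf : differentiable (f \o l) s by apply: differentiable_comp.
apply: DeriveDef; first exact: diff_derivable.
by rewrite deriveE // diff_comp //= diff_val scale1r deriveE.
Qed.

Lemma mvt_line f x v : (forall s : R, 0 <= s <= 1 -> differentiable f (x + s *: v)) ->
  exists2 s : R, 0 <= s <= 1 & f (x + v) - f x = 'D_v f (x + s *: v).
Proof.
move=> df; have [|||s s01] := @MVT_segment R (fun s => f (x + s *: v))
  (fun s => 'D_v f (x + s *: v)) 0 1.
- exact: ler01.
- by move=> s; rewrite in_itv /= => /andP[s0 s1]; apply: is_derive_line; apply: df; rewrite !ltW.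
- apply: derivable_within_continuous => s; rewrite in_itv /= => s01.
  by have [] := is_derive_line (df s s01).
by rewrite scale1r scale0r addr0 subr0 mulr1 => ->; exists s.
Qed.

(** The mean value theorem in direction v for y |-> f(y + h w) - f(y) turns the second difference
    into h times a difference of ['D_v f] at two points within O(h) of x; its first-order expansion
    at x is applied to both. *)
Lemma second_difference f x v w : (\forall y \near x, differentiable f y) ->
  differentiable ('D_v f) x -> forall e : R, 0 < e -> \forall h \near 0^'+,
  `|f (x + h *: v + h *: w) - f (x + h *: v) - f (x + h *: w) + f x
    - h ^+ 2 * 'D_w ('D_v f) x| <= e * h ^+ 2.
Proof.
move=> ndf dDf e e0.
(* All displacements a h v + b h w with a, b in [0, 1] have norm at most h C. Each of the two
   expansions costs e / (2 C) times h C, and the outer factor h yields e h^2. *)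
pose C := `|v| + `|w| + 1.
have C0 : 0 < C by rewrite /C ltr_wpDl // addr_ge0.
have e'0 : 0 < e / (2 * C) by rewrite divr_gt0 // mulr_gt0.
have /nbhs_ballP[d1 /= d10 hd1] := diff_eps dDf e'0.
have /nbhs_ballP[d2 /= d20 hd2] := ndf.
have dC0 : 0 < Num.min d1 d2 / C by rewrite divr_gt0 // lt_min d10.
near=> h.
have h0 : 0 < h by [].
have hd : h * C < Num.min d1 d2.
  by rewrite -ltr_pdivlMr //; near: h; exact: nbhs_right_lt.
have small (a b : R) : 0 <= a <= 1 -> 0 <= b <= 1 ->
    `|(a * h) *: v + (b * h) *: w| <= h * C.
  move=> /andP[a0 a1] /andP[b0 b1].
  apply: (le_trans (ler_normD _ _)); rewrite !normrZ !(ger0_norm a0) !(ger0_norm b0) !(gtr0_norm h0).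
  rewrite /C !mulrDr mulr1 -[leLHS]addr0; apply: lerD; last exact: ltW.
  by apply: lerD; rewrite ler_wpM2r // ler_piMl // ltW.
have smalld (a b : R) : 0 <= a <= 1 -> 0 <= b <= 1 ->
    `|(a * h) *: v + (b * h) *: w| < d1 /\ `|(a * h) *: v + (b * h) *: w| < d2.
  move=> a01 b01; have := le_lt_trans (small a b a01 b01) hd.
  by rewrite lt_min => /andP[].
have dfx (a b : R) : 0 <= a <= 1 -> 0 <= b <= 1 ->
    differentiable f (x + ((a * h) *: v + (b * h) *: w)).
  move=> a01 b01; apply: hd2; rewrite -ball_normE /= opprD addrA subrr sub0r normrN.
  by have [] := smalld a b a01 b01.
have d01 : 0 <= (0 : R) <= 1 by rewrite lexx ler01.
have d11 : 0 <= (1 : R) <= 1 by rewrite lexx ler01.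
pose F := fun y => f (y + h *: w) - f y.
have dF (s : R) : 0 <= s <= 1 -> is_derive s 1 (fun s => F (x + s *: (h *: v)))
   (h * ('D_v f (x + (s * h) *: v + h *: w) - 'D_v f (x + (s * h) *: v))).
  move=> s01.
  have D1 : is_derive s 1 (fun s => f ((x + h *: w) + s *: (h *: v)))
     ('D_(h *: v) f ((x + h *: w) + s *: (h *: v))).
    apply: is_derive_line.
    by have := dfx s 1 s01 d11; rewrite mul1r addrAC -addrA scalerA addrC -addrA.
  have D2 : is_derive s 1 (fun s => f (x + s *: (h *: v)))
     ('D_(h *: v) f (x + s *: (h *: v))).
    apply: is_derive_line.
    by have := dfx s 0 s01 d01; rewrite mul0r scale0r addr0 scalerA.
  have := is_deriveB D1 D2.
  rewrite (_ : _ - _ = (fun s => F (x + s *: (h *: v)))); last first.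
    by apply/funext => t; rewrite /F -[LHS]/(f _ - f _) addrAC.
  move=> H; suff E : 'D_(h *: v) f (x + h *: w + s *: (h *: v)) -
       'D_(h *: v) f (x + s *: (h *: v)) =
    h * ('D_v f (x + (s * h) *: v + h *: w) - 'D_v f (x + (s * h) *: v)) by rewrite -E.
  have e1 : differentiable f (x + (s * h) *: v).
    by have := dfx s 0 s01 d01; rewrite mul0r scale0r addr0.
  have e2 : differentiable f (x + (s * h) *: v + h *: w).
    by have := dfx s 1 s01 d11; rewrite mul1r addrA.
  rewrite !scalerA [x + h *: w + _]addrAC !deriveE //.
  by rewrite !linearZ /= mulrBr scalerN.
have [|||s s01] := @MVT_segment R (fun s => F (x + s *: (h *: v)))
  (fun s => h * ('D_v f (x + (s * h) *: v + h *: w) - 'D_v f (x + (s * h) *: v))) 0 1.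
- exact: ler01.
- by move=> s; rewrite in_itv /= => /andP[s0 s1]; apply: dF; rewrite !ltW.
- apply: derivable_within_continuous => s; rewrite in_itv /= => s01.
  by have [] := dF s s01.
rewrite scale1r scale0r addr0 subr0 mulr1 /F => E.
rewrite in_itv /= in s01.
have -> : f (x + h *: v + h *: w) - f (x + h *: v) - f (x + h *: w) + f x =
   h * ('D_v f (x + (s * h) *: v + h *: w) - 'D_v f (x + (s * h) *: v)).
  by rewrite -E; ring.
have H1 : `|'D_v f (x + (s * h) *: v + h *: w) - 'D_v f x -
    'd ('D_v f) x ((s * h) *: v + h *: w)| <= e / 2 * h.
  have [k1 _] := smalld s 1 s01 d11; have k2 := small s 1 s01 d11.
  rewrite mul1r in k1 k2.
  have -> : x + (s * h) *: v + h *: w = ((s * h) *: v + h *: w) + x by rewrite [RHS]addrC ?addrA.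
  have /hd1 K : ball 0 d1 (((s * h) *: v + h *: w)) by rewrite -ball_normE /= sub0r normrN.
  apply: (le_trans K); apply: (le_trans (ler_wpM2l (ltW e'0) k2)).
  by rewrite le_eqVlt; apply/orP; left; apply/eqP; field; rewrite gt_eqF.
have H2 : `|'D_v f (x + (s * h) *: v) - 'D_v f x -
    'd ('D_v f) x ((s * h) *: v)| <= e / 2 * h.
  have [k1 _] := smalld s 0 s01 d01; have k2 := small s 0 s01 d01.
  rewrite mul0r scale0r addr0 in k1 k2.
  have -> : x + (s * h) *: v = ((s * h) *: v) + x by rewrite [RHS]addrC ?addrA.
  have /hd1 K : ball 0 d1 (((s * h) *: v)) by rewrite -ball_normE /= sub0r normrN.
  apply: (le_trans K); apply: (le_trans (ler_wpM2l (ltW e'0) k2)).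
  by rewrite le_eqVlt; apply/orP; left; apply/eqP; field; rewrite gt_eqF.
rewrite [in X in _ - X]deriveE // expr2 -mulrA -mulrBr normrM gtr0_norm //.
rewrite mulrCA ler_pM2l // [e in leRHS]splitr mulrDl.
set A := 'D_v f (x + _ + _) in H1 *; set B := 'D_v f (x + _) in H2 *.
have -> : A - B - h * 'd ('D_v f) x w = (A - 'D_v f x - 'd ('D_v f) x ((s * h) *: v + h *: w))
  - (B - 'D_v f x - 'd ('D_v f) x ((s * h) *: v)).
  have l1 : 'd ('D_v f) x ((s * h) *: v + h *: w) =
      s * h * 'd ('D_v f) x v + h * 'd ('D_v f) x w by rewrite linearD !linearZ.
  have l2 : 'd ('D_v f) x ((s * h) *: v) = s * h * 'd ('D_v f) x v by rewrite linearZ.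
  by rewrite l1 l2; ring.
by rewrite (le_trans (ler_normB _ _)) // lerD.
Unshelve. all: by end_near. Qed.

(** The second difference is symmetric in v and w, so both iterated derivatives are its limit after
    division by h^2. *)
Lemma derive_comm f x v w : (\forall y \near x, differentiable f y) ->
  differentiable ('D_v f) x -> differentiable ('D_w f) x ->
  'D_w ('D_v f) x = 'D_v ('D_w f) x.
Proof.
move=> df dv dw; apply/eqP; rewrite -subr_eq0 -normr_le0; apply/ler_addgt0Pl => e e0.
rewrite addr0; have e20 : 0 < e / 2 by rewrite divr_gt0.
have /filter_ex[h [[H1 H2] h0]] : \forall h \near (0 : R)^'+,
    ((`|f (x + h *: v + h *: w) - f (x + h *: v) - f (x + h *: w) + f x
      - h ^+ 2 * 'D_w ('D_v f) x| <= e / 2 * h ^+ 2) /\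
    (`|f (x + h *: w + h *: v) - f (x + h *: w) - f (x + h *: v) + f x
      - h ^+ 2 * 'D_v ('D_w f) x| <= e / 2 * h ^+ 2)) /\ 0 < h.
  apply: filterI; last exact: nbhs_right_gt.
  by apply: filterI; [exact: (second_difference w df dv e20)|exact: (second_difference v df dw e20)].
rewrite -(ler_pM2l (exprn_gt0 2 h0)).
have -> : h ^+ 2 * `|'D_w ('D_v f) x - 'D_v ('D_w f) x| =
    `|h ^+ 2 * 'D_w ('D_v f) x - h ^+ 2 * 'D_v ('D_w f) x|.
  by rewrite -mulrBr normrM (gtr0_norm (exprn_gt0 2 h0)).
have -> : h ^+ 2 * e = e / 2 * h ^+ 2 + e / 2 * h ^+ 2 by field.
have E : x + h *: w + h *: v = x + h *: v + h *: w by rewrite addrAC.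
rewrite E in H2.
have K (a b c d p q r s : R) : `|a - c - b + d - p| <= r ->
    `|a - b - c + d - q| <= s -> `|p - q| <= r + s.
  move=> rp sq; have -> : p - q = (a - b - c + d - q) - (a - c - b + d - p) by ring.
  by rewrite (le_trans (ler_normB _ _)) // addrC lerD.
exact: (K _ _ _ _ _ _ _ _ H1 H2).
Qed.

End Lines.

Section RowNorm.
Context {R : realType} {n : nat}.
Implicit Types x y : 'rV[R]_n.

Lemma coord_le_norm x j : `|x 0 j| <= `|x|.
Proof.
rewrite -[`|x|]/(mx_norm x) mx_normrE.
exact: (le_bigmax _ (fun ij : 'I_1 * 'I_n => `|x ij.1 ij.2|) (0, j)).
Qed.

Lemma norm_le_coord x (c : R) : 0 <= c -> (forall j, `|x 0 j| <= c) -> `|x| <= c.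
Proof.
move=> c0 xc; rewrite -[`|x|]/(mx_norm x) mx_normrE; apply/bigmax_leP; split=> //.
by move=> [i j] _ /=; rewrite (ord1 i).
Qed.

End RowNorm.

Section RowCalculus.
Context {R : realType}.

Lemma derive_coordE n (W : normedModType R) (f : 'rV[R]_n -> W) x v :
  differentiable f x -> 'D_v f x = \sum_i v 0 i *: 'D_(delta_mx 0 i) f x.
Proof.
move=> df; rewrite {1}[v]row_sum_delta !deriveE // linear_sum.
by apply: eq_bigr => i _; rewrite linearZ deriveE.
Qed.

Lemma differentiable_row (V : normedModType R) m (f : V -> 'rV[R]_m) x :
  (forall j, differentiable (fun y => f y 0 j) x) -> differentiable f x.
Proof.
move=> df.
rewrite (_ : f = \sum_(j < m) (fun y => f y 0 j *: delta_mx 0 j)); last first.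
  apply/funext => y; rewrite fct_sumE {1}[f y]row_sum_delta.
  by apply: eq_bigr.
by apply: differentiable_sum => j; apply: differentiableZl.
Qed.

Lemma differentiable_coordinate (V : normedModType R) m (f : V -> 'rV[R]_m) x j :
  differentiable f x -> differentiable (fun y => f y 0 j) x.
Proof.
move=> df; apply: (@differentiable_comp _ _ _ _ f (fun r : 'rV[R]_m => r 0 j)) => //.
exact: differentiable_coord.
Qed.

Lemma derive_row (V : normedModType R) m (f : V -> 'rV[R]_m) x v j :
  differentiable f x -> ('D_v f x) 0 j = 'D_v (fun y => f y 0 j) x.
Proof. by move=> /diff_derivable df; rewrite derive_mx // mxE. Qed.

Lemma smooth_on_coordinate (V : normedModType R) m (U : set V) (f : V -> 'rV[R]_m) j :
  open U -> smooth_on U f -> smooth_on U (fun y => f y 0 j).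
Proof.
move=> oU sf.
have E (vs : seq V) x : U x ->
    foldr (fun v (g : V -> 'rV[R]_m) => 'D_v g) f vs x 0 j =
    foldr (fun v (g : V -> R) => 'D_v g) (fun y => f y 0 j) vs x.
  elim: vs x => [//|v vs IH] x Ux /=; rewrite derive_row; last exact: sf.
  exact: (eq_on_derive v oU IH Ux).
move=> vs x Ux; apply: (near_eq_differentiable (eq_on_near oU (E vs) Ux)).
by apply: differentiable_coordinate; exact: sf.
Qed.

Lemma differentiable_mulmxr n m (A : 'M[R]_(n, m)) (x : 'rV[R]_n) :
  differentiable (fun v : 'rV[R]_n => v *m A) x.
Proof.
rewrite (_ : (fun _ => _) = \sum_(i < n) (fun v : 'rV[R]_n => v 0 i *: row i A)).
  by apply: differentiable_sum => j; apply: differentiableZl; exact: differentiable_coord.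
by apply/funext => v; rewrite fct_sumE mulmx_sum_row.
Qed.

Lemma continuous_mulmxr n m (A : 'M[R]_(n, m)) :
  continuous (fun v : 'rV[R]_n => v *m A).
Proof. by move=> x; apply: differentiable_continuous; exact: differentiable_mulmxr. Qed.

Lemma mulmxr_lipschitz n m (A : 'M[R]_(n, m)) :
  exists2 C : R, 0 < C & forall v : 'rV[R]_n, `|v *m A| <= C * `|v|.
Proof. by apply: (@linear_lipschitz _ _ _ (mulmxr A)); exact: continuous_mulmxr. Qed.

Lemma Ck_det (V : normedModType R) k n (U : set V) (A : V -> 'M[R]_n) : open U ->
  (forall i j, Ck k U (fun x => A x i j)) -> Ck k U (fun x => \det (A x)).
Proof.
move=> oU AC; rewrite /determinant; apply: Ck_sum => // s _; apply: CkZ => //.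
by apply: Ck_prod.
Qed.

(** Cramer's rule: an entry of the inverse is a polynomial in the entries divided by the
    determinant. *)
Lemma Ck_invmx (V : normedModType R) k n (U : set V) (A : V -> 'M[R]_n) i j :
  open U -> (forall i j, Ck k U (fun x => A x i j)) ->
  (forall x, U x -> A x \in unitmx) -> Ck k U (fun x => invmx (A x) i j).
Proof.
move=> oU AC Au.
have C1 : Ck k U (fun x => (\det (A x))^-1 * cofactor (A x) j i).
  apply: CkM => //.
    apply: CkV => //; last exact: Ck_det.
    by move=> x /Au; rewrite unitmxE unitfE.
  rewrite /cofactor; apply: CkZ => //; apply: Ck_det => // a b.
  apply: (Ck_ext oU _ (AC (lift j a) (lift i b))) => y _.
  by rewrite !mxE.
apply: (Ck_ext oU _ C1) => x Ux.
by rewrite /invmx Au // !mxE.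
Qed.

Lemma jacobian_coord n m (F : 'rV[R]_n -> 'rV[R]_m) x i j : differentiable F x ->
  'J F x i j = 'D_(delta_mx 0 i) (fun y => F y 0 j) x.
Proof.
move=> dF; rewrite -derive_row // derivemxE // -rowE.
by rewrite [RHS]mxE.
Qed.

End RowCalculus.

(* Typing directional derivatives of scalar functions in [R], and sealing them,
   keeps the unifier from comparing the algebraic structures of [R] through the
   definition of the derivative. *)
HB.lock Definition pd {R : realType} {V : normedModType R} (v : V) (f : V -> R) (x : V) : R :=
  'D_v f x.

Lemma pdE {R : realType} {V : normedModType R} (v : V) (f : V -> R) :
  pd v f = 'D_v f.
Proof. by apply/funext => x; rewrite pd.unlock. Qed.

Lemma jacobian_pd {R : realType} n m (F : 'rV[R]_n -> 'rV[R]_m) x i j : differentiable F x ->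
  'J F x i j = pd (delta_mx 0 i) (fun y => F y 0 j) x.
Proof. by move=> dF; rewrite pdE jacobian_coord. Qed.

Lemma mulmx_jacobian {R : realType} n m (F : 'rV[R]_n -> 'rV[R]_m) x v j :
  differentiable F x -> (v *m 'J F x) 0 j = pd v (fun y => F y 0 j) x.
Proof. by move=> dF; rewrite pdE -derive_row // derivemxE. Qed.

Lemma pdxE {R : realType} {V : normedModType R} (v : V) (f : V -> R) x :
  pd v f x = 'D_v f x.
Proof. by rewrite pdE. Qed.

(** * Inverse function theorem *)

Lemma Ck_derive {R : realType} {V : normedModType R} k (U : set V) (f : V -> R) v :
  Ck k.+1 U f -> Ck k U ('D_v f).
Proof. by case=> _; exact. Qed.

Lemma Ck_continuous {R : realType} {V : normedModType R} k (U : set V) (f : V -> R) x :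
  Ck k U f -> U x -> {for x, continuous f}.
Proof. by move=> fC Ux; exact: (differentiable_continuous (Ck_diff fC Ux)). Qed.

Lemma Ck_subset {R : realType} {V : normedModType R} k (U U' : set V) (f : V -> R) :
  U' `<=` U -> Ck k U f -> Ck k U' f.
Proof.
move=> UU'; elim: k f => [|k IH] f [fU fk]; first by split=> // x /UU'; exact: fU.
by split=> [x /UU'|v]; [exact: fU|exact: (IH _ (fk v))].
Qed.

Lemma le_half_add {R : realType} (a b : R) : a <= 2^-1 * a + b -> a <= 2 * b.
Proof. lra. Qed.

(** Completeness of row vectors, required by [banach_fixed_point]. *)
HB.instance Definition _ (R : realType) (n : nat) :=
  Uniform_isComplete.Build 'rV[R]_n cauchy_cvg.

Section InverseFunction.
Context {R : realType} {n : nat}.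
Variables (U : set 'rV[R]_n) (F : 'rV[R]_n -> 'rV[R]_n) (x0 : 'rV[R]_n).
Hypotheses (oU : open U) (FC : forall k j, Ck k U (fun x => F x 0 j)).
Hypotheses (Ux0 : U x0) (J0 : 'J F x0 \in unitmx).

Lemma F_diff x : U x -> differentiable F x.
Proof. by move=> Ux; apply: differentiable_row => j; exact: (Ck_diff (FC 0%N j)). Qed.

Lemma F_jacobian_near (e : R) : 0 < e -> exists2 r : R, 0 < r &
  forall x, ball x0 r x -> U x /\
    forall v : 'rV[R]_n, `|v *m 'J F x - v *m 'J F x0| <= e * `|v|.
Proof.
(* In the sup norm each coordinate of the difference is a sum of n products, each at most d |v|;
   [n.+1] keeps the quotient meaningful for n = 0. *)
move=> e0; pose d := e / n.+1%:R.
have d0 : 0 < d by rewrite divr_gt0 // ltr0n.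
have near1 (i j : 'I_n) : \forall x \near x0,
    `|pd (delta_mx 0 i) (fun y => F y 0 j) x - pd (delta_mx 0 i) (fun y => F y 0 j) x0| < d.
  have c : {for x0, continuous (pd (delta_mx 0 i) (fun y => F y 0 j))}.
    rewrite pdE; exact: (Ck_continuous (Ck_derive (delta_mx 0 i) (FC 1 j)) Ux0).
  have /cvgrPdist_lt/(_ d d0) := c; apply: filterS => x.
  by rewrite distrC.
have nearall : \forall x \near x0, forall i j : 'I_n,
    `|pd (delta_mx 0 i) (fun y => F y 0 j) x - pd (delta_mx 0 i) (fun y => F y 0 j) x0| < d.
  exact: (filter_forall _ (fun i => filter_forall _ (near1 i))).
have nearU : \forall x \near x0, U x by exact: open_nbhs_nbhs.
have /nbhs_ballP[r /= r0 hr] : nbhs x0 (U `&` [set x | forall i j : 'I_n,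
  `|pd (delta_mx 0 i) (fun y => F y 0 j) x - pd (delta_mx 0 i) (fun y => F y 0 j) x0| < d]).
  exact: filterI.
exists r => // x /hr[Ux dx]; split=> // v.
apply: norm_le_coord => [|j]; first by rewrite mulr_ge0 // ltW.
rewrite !mxE -sumrB (le_trans (ler_norm_sum _ _ _)) //.
have -> : e * `|v| = d * `|v| * n.+1%:R.
  by rewrite mulrAC /d divfK // pnatr_eq0.
apply: (@le_trans _ _ (\sum_(i < n) d * `|v|)).
  apply: ler_sum => i _; rewrite -mulrBr normrM mulrC.
  apply: ler_pM => //; last exact: coord_le_norm.
  have dxi := ltW (dx i j).
  have e1 := jacobian_pd i j (F_diff Ux).
  have e2 := jacobian_pd i j (F_diff Ux0).
  by rewrite -e1 -e2 in dxi.
rewrite sumr_const card_ord -[leLHS]mulr_natr ler_wpM2l ?mulr_ge0 ?ler_nat // ltW //.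
Qed.

Lemma F_linear_approx (e : R) : 0 < e -> exists2 r : R, 0 < r &
  forall x, ball x0 r x -> U x /\
    (forall v : 'rV[R]_n, `|v *m 'J F x - v *m 'J F x0| <= e * `|v|) /\
    forall y, ball x0 r y -> `|F y - F x - (y - x) *m 'J F x0| <= e * `|y - x|.
Proof.
move=> e0; have [r r0 hr] := F_jacobian_near e0; exists r => // x bx.
have [Ux hx] := hr x bx; split=> //; split=> // y b_y.
apply: norm_le_coord => [|j]; first by rewrite mulr_ge0 // ltW.
have seg (s : R) : 0 <= s <= 1 -> ball x0 r (x + s *: (y - x)).
  move=> /andP[s0 s1]; move: bx b_y; rewrite -!ball_normE /= => bx b_y.
  have -> : x0 - (x + s *: (y - x)) = (1 - s) *: (x0 - x) + s *: (x0 - y).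
    rewrite !scalerBr !scalerBl !scale1r.
    by apply/rowP => i; rewrite !mxE; ring.
  rewrite (le_lt_trans (ler_normD _ _)) // !normrZ (ger0_norm s0) ger0_norm ?subr_ge0 //.
  have [->|sn0] := eqVneq s 0; first by rewrite subr0 mul1r mul0r addr0.
  have -> : r = (1 - s) * r + s * r by rewrite -mulrDl subrK mul1r.
  apply: ler_ltD; first by rewrite ler_wpM2l ?subr_ge0 // ltW.
  by rewrite ltr_pM2l // lt_neqAle eq_sym sn0.
have xy : x + (y - x) = y by rewrite addrC subrK.
(* The intermediate point depends on the coordinate j, which does no harm: the bound on the Jacobian
   is uniform over the ball and the sup norm is estimated coordinatewise. *)
have [s s01 E] := @mvt_line _ _ (fun y => F y 0 j) x (y - x) (fun s s01 =>
  Ck_diff (FC 0%N j) (hr _ (seg s s01)).1).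
have [Uz hz] := hr _ (seg s s01).
rewrite -pdxE -mulmx_jacobian in E; last exact: F_diff.
rewrite xy in E.
have -> : (F y - F x - (y - x) *m 'J F x0) 0 j =
    ((y - x) *m 'J F (x + s *: (y - x)) - (y - x) *m 'J F x0) 0 j.
  rewrite mxE [(F y - F x) 0 j]mxE [(- F x) 0 j]mxE E.
  by rewrite [RHS]mxE.
exact: (le_trans (coord_le_norm _ _) (hz _)).
Qed.

(** Simplified Newton iteration: with A the inverse of the Jacobian at x0, the map T x = x - (F x -
    z) A is a contraction whose fixed points solve F x = z. *)
Theorem inverse_function : exists (r rho K : R) (G : 'rV[R]_n -> 'rV[R]_n),
  [/\ [/\ 0 < r, 0 < rho & 0 < K],
    forall x, ball x0 r x -> U x /\ 'J F x \in unitmx,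
    (forall z, ball (F x0) rho z -> ball x0 r (G z) /\ F (G z) = z),
    (forall x, ball x0 r x -> ball (F x0) rho (F x) -> G (F x) = x) &
    (forall z z', ball (F x0) rho z -> ball (F x0) rho z' ->
      `|G z - G z'| <= K * `|z - z'|)].
Proof.
pose L := 'J F x0; pose A := invmx L.
have [C C0 hC] := mulmxr_lipschitz A.
(* With C a Lipschitz bound for A, an error e = 1 / (2 C) in the linear approximation makes T a
   contraction of ratio 1/2. *)
pose e := (2 * C)^-1; have e0 : 0 < e by rewrite invr_gt0 mulr_gt0.
have eC : e * C = 2^-1 by rewrite /e; field; rewrite gt_eqF.
have LA (v : 'rV[R]_n) : v *m L *m A = v by rewrite mulmxK.
have [r r0 hr] := F_linear_approx e0.
have lower (v : 'rV[R]_n) : `|v| <= C * `|v *m L| by rewrite -{1}[v]LA.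
have inj x y : ball x0 r x -> ball x0 r y -> `|y - x| <= 2 * C * `|F y - F x|.
  move=> bx b_y; have [_ [_ /(_ y b_y) H]] := hr x bx.
  have := lower (y - x); rewrite -/L in H.
  have H2 : `|(y - x) *m L| <= e * `|y - x| + `|F y - F x|.
    apply: le_trans (lerD H (lexx _)).
    by rewrite distrC -[X in `|X| <= _](subrK (F y - F x)) ler_normD.
  move=> /le_trans/(_ (ler_wpM2l (ltW C0) H2)).
  rewrite mulrDr mulrA [C * e]mulrC eC.
  by rewrite -mulrA; exact: le_half_add.
pose s := r / 2; have s0 : 0 < s by rewrite divr_gt0.
have sr x : `|x0 - x| <= s -> ball x0 r x.
  rewrite -ball_normE /= => h; apply: le_lt_trans h _.
  by rewrite ltr_pdivrMr // ltr_pMr // ltr1n.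
(* For |z - F x0| < rho, T moves the centre by at most C rho = s / 2, so the contraction maps the
   closed ball of radius s = r / 2 to itself. *)
pose rho := r / (4 * C); have rho0 : 0 < rho by rewrite divr_gt0 // mulr_gt0.
have surj z : ball (F x0) rho z -> exists x, `|x0 - x| <= s /\ F x = z.
  rewrite -ball_normE /= => bz.
  pose T x := x - (F x - z) *m A.
  have TT x y : `|x0 - x| <= s -> `|x0 - y| <= s -> `|T x - T y| <= 2^-1 * `|x - y|.
    move=> /sr bx /sr b_y; have [_ [_ /(_ x bx) H]] := hr y b_y.
    have -> : T x - T y = - ((F x - F y - (x - y) *m L) *m A).
      rewrite mulmxBl LA /T !mulmxBl.
      by apply/rowP => i; rewrite !mxE; ring.
    by rewrite normrN (le_trans (hC _)) // -eC [e * C]mulrC -mulrA ler_wpM2l // ltW.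
  pose B := [set x : 'rV[R]_n | `|x0 - x| <= s].
  have Tx0 : `|x0 - T x0| <= 2^-1 * s.
    rewrite /T opprB addrC subrK (le_trans (hC _)) //.
    rewrite (le_trans (ler_wpM2l (ltW C0) (ltW bz))) // /rho /s.
    by rewrite le_eqVlt; apply/orP; left; apply/eqP; field; rewrite gt_eqF.
  have TB : set_fun B B T.
    move=> x Bx; rewrite /B /=.
    rewrite -[x0 - T x](subrKA (T x0)) (le_trans (ler_normD _ _)) //.
    have B0 : `|x0 - x0| <= s by rewrite subrr normr0 ltW.
    apply: le_trans (lerD Tx0 (TT _ _ B0 Bx)) _.
    have : 2^-1 * `|x0 - x| <= 2^-1 * s by rewrite ler_wpM2l.
    lra.
  pose T' : {fun B >-> B} := HB.pack T (isFun.Build _ _ B B T TB).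
  have [||| x Bx xE] := @banach_fixed_point R _ B T'.
  - exists (2^-1 : R)%:nng; split; first by rewrite /= invf_lt1 // ltr1n.
    by move=> [x y] [/= Bx By]; exact: TT.
  - rewrite (_ : B = closed_ball x0 s); first exact: closed_ball_closed.
    by rewrite closed_ballE.
  - by exists x0; rewrite /B /= subrr normr0 ltW.
  exists x; split=> //.
  have : (F x - z) *m A = 0.
    by have /eqP := xE; rewrite /= /T -subr_eq0 opprB addrC subrK => /eqP.
  move=> /(congr1 (mulmx^~ L)) /=; rewrite mul0mx /A mulmxKV // => /eqP.
  by rewrite subr_eq0 => /eqP.
have /choice[G hG] : forall z, exists x, ball (F x0) rho z -> `|x0 - x| <= s /\ F x = z.
  move=> z; have [/surj[x hx]|nz] := pselect (ball (F x0) rho z); first by exists x.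
  by exists x0.
(* Such a B differs from L by at most half of the lower bound |v| / C of |v L|, hence stays
   injective. *)
have unit_near (B : 'M[R]_n) :
    (forall v : 'rV[R]_n, `|v *m B - v *m L| <= e * `|v|) -> B \in unitmx.
  move=> H; rewrite -row_free_unit; apply: inj_row_free => v vB.
  have := H v; rewrite vB sub0r normrN => H'.
  have := le_trans (lower v) (ler_wpM2l (ltW C0) H').
  rewrite mulrA [C * e]mulrC eC -[_ * _]addr0 => /le_half_add.
  by rewrite mulr0 normr_le0 => /eqP.
exists r, rho, (2 * C), G; split.
- by split=> //; rewrite mulr_gt0.
- by move=> x bx; have [Ux [H _]] := hr x bx; split; [exact: Ux|exact: unit_near H].
- by move=> z /hG[h1 h2]; split=> //; exact: sr.
- move=> x bx /hG[h1 h2]; apply/eqP; rewrite -subr_eq0 -normr_le0.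
  by rewrite (le_trans (inj _ _ bx (sr _ h1))) // h2 subrr normr0 mulr0.
- move=> z z' /hG[h1 h2] /hG[h3 h4].
  by rewrite -{2}h2 -{2}h4; apply: inj; exact: sr.
Qed.

End InverseFunction.

Section SmoothInverse.
Context {R : realType} {n : nat}.
Variables (U : set 'rV[R]_n) (F : 'rV[R]_n -> 'rV[R]_n) (x0 : 'rV[R]_n).
Hypotheses (oU : open U) (FC : forall k j, Ck k U (fun x => F x 0 j)).
Hypotheses (Ux0 : U x0) (J0 : 'J F x0 \in unitmx).

(** The regularity of G is stated through h o G for all smooth h because this closes the induction:
    the derivative of h o G is again some h' o G, with h' built from the partial derivatives of h
    and the entries of the inverse Jacobian of F. *)
Theorem smooth_inverse_function : exists (r rho : R) (G : 'rV[R]_n -> 'rV[R]_n),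
  [/\ 0 < r /\ 0 < rho,
    forall x, ball x0 r x -> U x /\ 'J F x \in unitmx,
    (forall z, ball (F x0) rho z -> ball x0 r (G z) /\ F (G z) = z),
    (forall x, ball x0 r x -> ball (F x0) rho (F x) -> G (F x) = x) &
    (forall z, ball (F x0) rho z -> differentiable G z) /\
    forall h, (forall k, Ck k (ball x0 r) h) ->
      forall k, Ck k (ball (F x0) rho) (fun z => h (G z))].
Proof.
have [r [rho [K [G [[r0 rho0 K0] hr surj inj lip]]]]] :=
  inverse_function oU FC Ux0 J0.
have oB : open (ball x0 r) by exact: ball_open.
have oB' : open (ball (F x0) rho) by exact: ball_open.
have dF x : U x -> differentiable F x.
  by move=> Ux; apply: differentiable_row => j; exact: (Ck_diff (FC 0%N j)).
have dG z : ball (F x0) rho z ->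
    differentiable G z /\ forall v, 'D_v G z = v *m invmx ('J F (G z)).
  move=> bz; have [bx Fx] := surj z bz; set x := G z in bx Fx *.
  have [Ux Jx] := hr x bx.
  set A := invmx ('J F x).
  have [C C0 hC] := mulmxr_lipschitz A.
  suff dG : is_diff z G (mulmxr A).
    have dGz : differentiable G z by case: dG.
    by split=> // v; rewrite deriveE // diff_val.
  apply: is_diff_eps; first exact: continuous_mulmxr.
  move=> e e0; pose e' := e / (C * K).
  have e'0 : 0 < e' by rewrite divr_gt0 // mulr_gt0.
  have /nbhs_ballP[d /= d0 hd] := diff_eps (dF x Ux) e'0.
  have : \forall h \near (0 : 'rV[R]_n), ball (F x0) rho (h + z).
    have : nbhs z (ball (F x0) rho) by exact: open_nbhs_nbhs.
    rewrite -[nbhs z _]/(\forall x \near z, ball (F x0) rho x) (near_shift 0 z) subr0.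
    by apply: filterS => h.
  have : \forall h \near (0 : 'rV[R]_n), `|h| < d / K.
    have dK : 0 < d / K by rewrite divr_gt0.
    by have := nbhsx_ballx (0 : 'rV[R]_n) _ dK; apply: filterS => h; rewrite -ball_normE /= sub0r normrN.
  apply: filterS2 => h hK bhz.
  (* Since F (x + k) = h + z, the vector k - h A is the expansion error of F at x for the increment
     k, multiplied by - A; the Lipschitz bound |k| <= K |h| turns it into o(h). *)
  pose k := G (h + z) - x.
  have kK : `|k| <= K * `|h|.
    by apply: (le_trans (lip _ _ bhz bz)); rewrite addrK.
  have kd : ball 0 d k.
    by rewrite -ball_normE /= sub0r normrN (le_lt_trans kK) // mulrC -ltr_pdivlMr.
  have := hd _ kd; rewrite /k subrK (surj _ bhz).2 Fx addrK -/k => H.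
    have E : k - h *m A = - ((h - k *m 'J F x) *m A).
    by rewrite mulmxBl mulmxK // opprB.
  rewrite -/x -/k /= E normrN (le_trans (hC _)) //.
  have -> : e * `|h| = C * (e' * (K * `|h|)).
    by rewrite /e'; field; rewrite !gt_eqF.
  rewrite ler_wpM2l ?(ltW C0) //.
  have dFk : 'd F x k = k *m 'J F x by rewrite -derivemxE ?deriveE //; exact: dF.
  by move: H; rewrite dFk => /le_trans; apply; rewrite ler_wpM2l // ltW.
exists r, rho, G; split; [by split|exact: hr|exact: surj|exact: inj|].
split=> [z /dG[]//|h hC k].
elim: k h hC => [|k IH] h hC.
  split=> // z bz; apply: differentiable_comp; first by have [] := dG z bz.
  by apply: (Ck_diff (hC 0%N)); have [] := surj z bz.
split=> [z bz|v].
  apply: differentiable_comp; first by have [] := dG z bz.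
  by apply: (Ck_diff (hC 0%N)); have [] := surj z bz.
pose h' := fun x => \sum_i (\sum_j v 0 j * invmx ('J F x) j i) * 'D_(delta_mx 0 i) h x.
have JC m a b : Ck m (ball x0 r) (fun x => 'J F x a b).
  have H : Ck m U ('D_(delta_mx 0 a) (fun y => F y 0 b)) by exact: (Ck_derive _ (FC m.+1 b)).
  have H' : Ck m (ball x0 r) ('D_(delta_mx 0 a) (fun y => F y 0 b)).
    by apply: (Ck_subset _ H) => x /hr[].
  apply: (Ck_ext oB _ H') => x /hr[Ux _].
  by rewrite (jacobian_coord _ _ (dF _ Ux)).
have Ju x : ball x0 r x -> 'J F x \in unitmx by move=> /hr[].
have h'C m : Ck m (ball x0 r) h'.
  rewrite /h'; apply: Ck_sum => [|i _]; first exact: oB.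
  apply: CkM; [exact: oB| |exact: Ck_derive].
  apply: Ck_sum => [|j _]; first exact: oB.
  apply: CkZ; first exact: oB.
  exact: (Ck_invmx _ _ oB (JC m) Ju).
apply: (Ck_ext oB' _ (IH h' h'C)) => z bz.
have [dGz DG] := dG z bz; have [bx _] := surj z bz.
have dh : differentiable h (G z) by exact: (Ck_diff (hC 0%N)).
rewrite deriveE; last exact: differentiable_comp.
have E : 'd G z v = v *m invmx ('J F (G z)) by rewrite -DG deriveE.
rewrite diff_comp //= E -deriveE // derive_coordE // /h'.
by apply: eq_bigr => i _; rewrite mxE.
Qed.

End SmoothInverse.

(** * A translation invariant integral *)

Section UltraLimit.
Context {R : realType}.
Implicit Types u v : nat -> R.

Definition evbounded u := exists C : R, \forall n \near \oo, `|u n| <= C.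

Lemma evboundedD u v : evbounded u -> evbounded v -> evbounded (fun n => u n + v n).
Proof.
move=> [C hC] [D hD]; exists (C + D).
by apply: filterS2 hC hD => n un vn; rewrite (le_trans (ler_normD _ _)) // lerD.
Qed.

Lemma evboundedZ c u : evbounded u -> evbounded (fun n => c * u n).
Proof.
move=> [C hC]; exists (`|c| * C); apply: filterS hC => n un.
by rewrite normrM ler_wpM2l.
Qed.

(** Limit along an ultrafilter finer than [\oo]: an eventually bounded sequence pushes it to an
    ultrafilter living on a compact segment, which converges. It serves twice, for Riemann sums and
    for collars of width tending to 0. *)
Theorem generalized_limit : exists L : (nat -> R) -> R,
  [/\ forall u v, evbounded u -> evbounded v -> L (fun n => u n + v n) = L u + L v,
    forall c u, evbounded u -> L (fun n => c * u n) = c * L u,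
    (forall u, evbounded u -> (\forall n \near \oo, 0 <= u n) -> 0 <= L u),
    (forall u (c : R), evbounded u -> (\forall n \near \oo, c <= u n) -> c <= L u) &
    (forall u, u n @[n --> \oo] --> (0 : R) -> L u = 0)].
Proof.
have [G [GU ooG]] := @ultraFilterLemma nat \oo _.
have GP : ProperFilter G by exact: ultra_proper.
have cv u : evbounded u -> cvg (u n @[n --> G]).
  move=> [C hC].
  have cK : compact `[- C, C]%classic by exact: segment_compact.
  have UG : UltraFilter (u n @[n --> G]).
    apply: Build_UltraFilter => H HP uGH.
    have HF : Filter H by exact: filter_filter.
    rewrite eqEsubset; split=> // A HA.
    rewrite /fmap /=.
    have [//|GA] := in_ultra_setVsetC (u @^-1` A) GU.
    have HA' : H (~` A) by apply: uGH; exact: GA.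
    have : H (A `&` ~` A) by exact: filterI.
    by rewrite setICr => /filter_not_empty.
  move: cK; rewrite compact_ultra => /(_ _ UG)[|x [_ ux]].
    apply: ooG; apply: filterS hC => n /=.
    by rewrite in_itv /= -ler_norml.
  by apply: cvgP; exact: ux.
exists (fun u => lim (u n @[n --> G])); split.
- by move=> u v /cv cu /cv cv'; exact: limD.
- by move=> c u /cv cu; apply/cvg_lim => //; exact: (cvgM (cvg_cst c) cu).
- move=> u /cv cu u0; apply: limr_ge => //; exact: ooG.
- move=> u c /cv cu u0; apply: limr_ge => //; exact: ooG.
- move=> u u0; apply/cvg_lim => //; apply: cvg_trans u0.
  by move=> A; exact: ooG.
Qed.

End UltraLimit.

(** * Riemann sums on dyadic lattices *)

Section Counting.
Context {R : realType}.

Lemma card_window (K c : nat) (t : R) : 0 <= t ->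
  #|[pred a : 'I_K | `|(a%:R - c%:R : R)| <= t]|%:R <= 2 * t + 1.
Proof.
move=> t0; pose T := Num.truncn t.
have Tt : T%:R <= t by have /andP[] := truncn_itv t0.
have sub (a b : nat) : (a%:R - b%:R : R) <= t -> (a - b <= T)%N.
  move=> ab; rewrite leqNgt; apply/negP => lt.
  have ba : (b <= a)%N by rewrite ltnW // -subn_gt0 (leq_ltn_trans _ lt).
  have : (T.+1%:R : R) <= (a - b)%:R by rewrite ler_nat.
  rewrite natrB // => h; have := le_trans h ab.
  by rewrite leNgt; have /andP[_ ->] := truncn_itv t0.
pose phi (a : 'I_K) : 'I_(2 * T).+1 := inord (a + T - c).
have phiE a : a \in [pred a : 'I_K | `|(a%:R - c%:R : R)| <= t] ->
    (phi a + c = a + T)%N.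
  rewrite inE ler_norml => /andP[h1 h2].
  have h3 : (c - a <= T)%N by apply: sub; lra.
  have h4 : (a - c <= T)%N by apply: sub.
  by rewrite /phi inordK //; lia.
have inj : {in [pred a : 'I_K | `|(a%:R - c%:R : R)| <= t] &, injective phi}.
  move=> a b /phiE ha /phiE hb ab; apply: val_inj => /=.
  by move: ha hb; rewrite ab; lia.
rewrite -(card_in_image inj) (@le_trans _ _ ((2 * T).+1%:R)) //.
  by rewrite ler_nat (leq_trans (max_card _)) // card_ord.
by rewrite -addn1 natrD natrM lerD2r ler_wpM2l.
Qed.

(** The integers from b to b + T - 1, with b and T the integer parts of y and t, lie within t of y;
    and T > t - 1 >= t / 2 since t >= 2. *)
Lemma card_window_lower (K : nat) (y t : R) : 0 <= y -> 2 <= t -> y + t < K%:R ->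
  t / 2 <= #|[pred a : 'I_K | `|(a%:R - y)| < t]|%:R.
Proof.
move=> y0 t2 ytK; have t0 : 0 <= t by lra.
pose T := Num.truncn t; pose b := Num.truncn y.
have /andP[Tt tT] := truncn_itv t0; have /andP[b_y yb] := truncn_itv y0.
rewrite -/T -/b in Tt tT b_y yb.
pose phi (k : 'I_T) : 'I_K.-1.+1 := inord (b + k).
have K0 : (0 < K)%N by rewrite -(ltr_nat R); apply: le_lt_trans ytK; lra.
have kt (k : 'I_T) : (k%:R : R) + 1 <= t.
  by apply: le_trans Tt; rewrite natr1 ler_nat.
have phiE k : phi k = (b + k)%N :> nat.
  rewrite /phi inordK // prednK // -(ltr_nat R) natrD.
  by apply: le_lt_trans ytK; have := kt k; lra.
rewrite -(prednK K0).
have inj : injective phi.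
  by move=> k l /(congr1 val) /=; rewrite !phiE => /addnI /val_inj.
apply: (@le_trans _ _ T%:R); first by rewrite -natr1 in tT; lra.
rewrite -{1}[T]card_ord -(fintype.card_image inj) ler_nat; apply: subset_leq_card.
apply/fintype.subsetP => a /fintype.imageP[k _ ->]; rewrite inE phiE natrD ltr_norml.
rewrite -natr1 in yb.
have := kt k; have : (0 : R) <= k%:R by rewrite ler0n.
by move=> *; apply/andP; split; lra.
Qed.

End Counting.

Section Lattice.
Context {R : realType} {N : nat}.
Implicit Types (f g G : 'rV[R]_N -> R) (z k : 'rV[R]_N) (m : nat).

Definition bounded_support f (C rho : R) :=
  [/\ 0 <= C, 0 <= rho & forall z, `|f z| <= C /\ (rho < `|z| -> f z = 0)].

Definition mesh m : R := (2 ^+ m)^-1.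
(** With step 2^-m, the indices 0 to 2 * 4^m give nodes from -2^m to 2^m: one parameter refines the
    lattice and lets its cube exhaust the space. *)
Definition grid m := (2 * 4 ^ m).+1.
Definition node m (a : nat) : R := (a%:R - (4 ^ m)%:R) * mesh m.
Definition lattice_point m (i : {ffun 'I_N -> 'I_(grid m)}) : 'rV[R]_N :=
  \row_j node m (i j).
Definition lattice_sum f m : R := mesh m ^+ N * \sum_(i : {ffun 'I_N -> 'I_(grid m)}) f (lattice_point i).

Lemma mesh_gt0 m : 0 < mesh m.
Proof. by rewrite invr_gt0 exprn_gt0. Qed.

Lemma mesh_le1 m : mesh m <= 1.
Proof. by rewrite invf_le1 ?exprn_gt0 // exprn_ege1 // ler1n. Qed.

Lemma mesh_cvg : mesh m @[m --> \oo] --> (0 : R).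
Proof.
rewrite (_ : mesh = fun m => 2^-1 ^+ m); last by apply/funext => m; rewrite /mesh exprVn.
by apply: cvg_expr; rewrite ger0_norm ?invr_ge0 // invf_lt1 // ltr1n.
Qed.

Lemma sum_prod_lattice m (P : 'I_N -> pred 'I_(grid m)) :
  \sum_(i : {ffun 'I_N -> 'I_(grid m)}) \prod_j (P j (i j))%:R =
  \prod_j #|P j|%:R :> R.
Proof.
rewrite -(bigA_distr_bigA (fun j a => (P j a)%:R : R)).
apply: eq_bigr => j _; rewrite -sum1_card natr_sum [RHS]big_mkcond /=.
by apply: eq_bigr => a _; rewrite -[a \in _]/(P j a); case: (P j a).
Qed.

(** Lattice points of the supporting cube are counted one coordinate at a time: at most 2 rho / mesh
    + 1 of them, and the mesh is at most 1. The bound does not depend on m, as generalized limits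
    require. *)
Lemma lattice_sum_bound f C rho m : bounded_support f C rho ->
  `|lattice_sum f m| <= C * (2 * rho + 1) ^+ N.
Proof.
move=> [C0 rho0 fC]; rewrite /lattice_sum normrM ger0_norm ?exprn_ge0 ?(ltW (mesh_gt0 m)) //.
pose P : 'I_N -> pred 'I_(grid m) := fun j a => (`|(a%:R - (4 ^ m)%:R : R)| <= rho / mesh m).
have bnd (i : {ffun 'I_N -> 'I_(grid m)}) :
    `|f (lattice_point i)| <= C * \prod_j (P j (i j))%:R.
  have [/forallP h|] := boolP [forall j, P j (i j)].
    rewrite big1 ?mulr1; first by have [] := fC (lattice_point i).
    by move=> j _; rewrite (h j).
  rewrite negb_forall => /existsP[j nP].
  have -> : f (lattice_point i) = 0.
    have [_ ->//] := fC (lattice_point i).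
    apply: (lt_le_trans _ (coord_le_norm _ j)); rewrite mxE /node normrM (gtr0_norm (mesh_gt0 m)).
    by rewrite -ltr_pdivrMr ?mesh_gt0 // ltNge.
  by rewrite normr0 mulr_ge0 // prodr_ge0.
apply: (@le_trans _ _ (mesh m ^+ N * (C * \prod_(j < N) (2 * (rho / mesh m) + 1)))).
  rewrite ler_wpM2l ?exprn_ge0 ?(ltW (mesh_gt0 m)) //.
  rewrite (le_trans (ler_norm_sum _ _ _)) // (le_trans (ler_sum _ (fun i _ => bnd i))) //.
  rewrite -mulr_sumr ler_wpM2l // (sum_prod_lattice P) ler_prod // => j _.
  by rewrite ler0n card_window // divr_ge0 // (ltW (mesh_gt0 m)).
rewrite prodr_const card_ord mulrCA -exprMn ler_wpM2l //.
have -> : mesh m * (2 * (rho / mesh m) + 1) = 2 * rho + mesh m.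
  by field; rewrite gt_eqF // mesh_gt0.
by rewrite lerXn2r ?nnegrE ?addr_ge0 ?mulr_ge0 ?(ltW (mesh_gt0 m)) // lerD2l mesh_le1.
Qed.

Lemma lattice_sum_lower f z0 (c d : R) : 0 < d -> 0 <= c -> (forall z, 0 <= f z) ->
  (forall z, `|z - z0| < d -> c <= f z) ->
  \forall m \near \oo, c * (d / 4) ^+ N <= lattice_sum f m.
Proof.
move=> d0 c0 f0 fc.
(* |z0| + d <= 2^m keeps the window around z0 inside the grid; 4 / d <= 2^m makes its half-width t
   at least 2 steps, as [card_window_lower] requires. *)
have big_m : \forall m \near \oo, `|z0| + d + 4 / d + 4 <= 2 ^+ m.
  have := nbhs_infty_ger (`|z0| + d + 4 / d + 4); apply: filterS => m /le_trans; apply.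
  by rewrite -natrX ler_nat ltnW // ltn_expl.
apply: filterS big_m => m hm.
pose t := d / 2 / mesh m.
pose y (j : 'I_N) := (4 ^ m)%:R + z0 0 j / mesh m : R.
pose P : 'I_N -> pred 'I_(grid m) := fun j a => (`|(a%:R - y j)| < t).
have m0 := mesh_gt0 m.
have E2 : (mesh m)^-1 = 2 ^+ m by rewrite /mesh invrK.
have p0 : 0 < (2 : R) ^+ m by rewrite exprn_gt0.
have E4 : ((4 ^ m)%:R : R) = 2 ^+ m * 2 ^+ m.
  by rewrite natrX -exprMn; congr (_ ^+ _); rewrite -natrM.
have Pcard j : t / 2 <= #|P j|%:R.
  have z0j : `|z0 0 j| <= `|z0| by exact: coord_le_norm.
  have z0j' : - `|z0| <= z0 0 j <= `|z0| by rewrite -ler_norml.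
  have z00 : 0 <= `|z0| by [].
  have d40 : 0 < 4 / d by rewrite divr_gt0.
  move: hm z0j' z00; set a : R := `|z0|; set b : R := z0 0 j => hm z0j' z00.
  have h4 : 4 / d <= 2 ^+ m by lra.
  have h4' : 4 <= 2 ^+ m * d by rewrite -ler_pdivrMr.
  have tE : t = 2 ^+ m * d / 2 by rewrite /t E2; field.
  apply: card_window_lower.
  - by rewrite /y E4 E2 -mulrDl mulr_ge0 ?(ltW p0) //; rewrite -/b; lra.
  - by rewrite tE; lra.
  - have gE : ((grid m)%:R : R) = 2 * (2 ^+ m * 2 ^+ m) + 1.
      by rewrite /grid -addn1 natrD (natrM _ 2) E4.
    rewrite /y tE E2 gE E4 -/b.
    have : (b + d / 2) * 2 ^+ m <= 2 ^+ m * 2 ^+ m by rewrite ler_wpM2r ?(ltW p0) //; lra.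
    by move: (2 ^+ m : R) => p; lra.
have bnd (i : {ffun 'I_N -> 'I_(grid m)}) :
    c * \prod_j (P j (i j))%:R <= f (lattice_point i).
  have [/forallP h|] := boolP [forall j, P j (i j)]; last first.
    rewrite negb_forall => /existsP[j nP].
    by rewrite (bigD1 j) //= (negbTE nP) mul0r mulr0.
  rewrite big1 ?mulr1; last by move=> j _; rewrite (h j).
  apply: fc; apply: (@le_lt_trans _ _ (d / 2)); last by rewrite ltr_pdivrMr // ltr_pMr // ltr1n.
  apply: norm_le_coord => [|j]; first by rewrite divr_ge0 // ltW.
  have := h j; rewrite /P /= /y => /ltW hj.
  have -> : (lattice_point i - z0) 0 j = ((i j)%:R - ((4 ^ m)%:R + z0 0 j / mesh m)) * mesh m.
    by rewrite !mxE /node; field; rewrite gt_eqF.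
  by rewrite normrM (gtr0_norm m0) -ler_pdivlMr.
apply: (@le_trans _ _ (mesh m ^+ N * (c * \prod_(j < N) (t / 2)))).
  rewrite prodr_const card_ord mulrCA -exprMn /t; rewrite ler_wpM2l //.
  rewrite le_eqVlt; apply/orP; left; apply/eqP; congr (_ ^+ _).
  by field; rewrite gt_eqF.
rewrite /lattice_sum ler_wpM2l ?exprn_ge0 ?(ltW m0) //.
apply: (le_trans _ (ler_sum _ (fun i _ => bnd i))).
rewrite -mulr_sumr ler_wpM2l // (sum_prod_lattice P) ler_prod // => j _.
rewrite Pcard andbT /t !divr_ge0 // ltW //.
Qed.

End Lattice.

Section LatticeDivergence.
Context {R : realType} {N : nat}.
Implicit Types (f g G : 'rV[R]_N -> R) (z k : 'rV[R]_N).

Lemma compact_ball_row (rho : R) : compact [set z : 'rV[R]_N | `|z| <= rho].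
Proof.
apply: bounded_closed_compact.
  exists rho; split; first exact: num_real.
  by move=> x rx z /= /le_trans; apply; exact: ltW.
rewrite (_ : [set _ | _] = (fun z : 'rV[R]_N => `|z|) @^-1` [set x : R | x <= rho]) //.
apply: closed_comp; last exact: closed_le.
by move=> x _; exact: norm_continuous.
Qed.

(** Continuity is uniform on the compact ball of radius rho + 1; beyond it both values vanish as
    soon as |k| < 1. *)
Lemma compact_support_uniform g (rho : R) : continuous g ->
  (forall z, rho < `|z| -> g z = 0) ->
  forall e : R, 0 < e -> exists2 d : R, 0 < d &
    forall z k, `|k| < d -> `|g (z + k) - g z| <= e.
Proof.
move=> gc g0 e e0.
pose K := [set z : 'rV[R]_N | `|z| <= rho + 1].
have Kc : compact K by exact: compact_ball_row.
have /compact_near_coveringP cK := Kc.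
have H : \forall k \near (0 : 'rV[R]_N), K `<=` (fun z => `|g (z + k) - g z| <= e).
  apply: (cK _ (nbhs (0 : 'rV[R]_N)) (fun k z => `|g (z + k) - g z| <= e)) => z _.
  have e20 : 0 < e / 2 by rewrite divr_gt0.
  have /cvgrPdist_lt/(_ _ e20)/nbhs_ballP[d /= d0 hd] := gc z.
  exists (ball z (d / 2), ball (0 : 'rV[R]_N) (d / 2)).
    by split; apply: nbhsx_ballx; rewrite divr_gt0.
  move=> [z' k] /= [bz bk].
  have d2 : ball z d z' by apply: le_ball bz; rewrite ler_pdivrMr // ler_pMr // ler1n.
  have d1 : ball z d (z' + k).
    move: bz bk; rewrite -!ball_normE /= sub0r normrN => bz bk.
    by rewrite opprD addrA (le_lt_trans (ler_normB _ _)) // [d]splitr ltrD.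
  have h1 := hd _ d1; have h2 := hd _ d2; rewrite /= in h1 h2.
  have -> : g (z' + k) - g z' = (g z - g z') - (g z - g (z' + k)) by ring.
  by rewrite (le_trans (ler_normB _ _)) // [e]splitr lerD // ltW.
have /nbhs_ballP[d /= d0 hd] := H.
exists (Num.min d 1); first by rewrite lt_min d0 ltr01.
move=> z k; rewrite lt_min => /andP[kd k1].
have [zK|zK] := leP `|z| (rho + 1).
  by apply: hd => //; rewrite -ball_normE /= sub0r normrN.
rewrite !g0 ?subrr ?normr0 ?ltW //; first by rewrite (le_lt_trans _ zK) // lerDl.
rewrite -(ltrD2r 1) (lt_le_trans zK) // .
rewrite -{1}[z](addrK k) (le_trans (ler_normB _ _)) // lerD2l ltW //.
Qed.

(** The shift is cyclic so as to permute the finite grid; it wraps around only at an outer face,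
    where the functions considered vanish. *)
Definition shift_index m (a : 'I_N) (i : {ffun 'I_N -> 'I_(grid m)}) :
    {ffun 'I_N -> 'I_(grid m)} :=
  [ffun j => if j == a then ordS (i j) else i j].

Lemma shift_index_inj m a : injective (@shift_index m a).
Proof.
move=> i i' /ffunP E; apply/ffunP => j; have := E j; rewrite !ffunE.
by case: eqP => // _; exact: (bij_inj (@ordS_bij _)).
Qed.

Lemma lattice_point_shift m a i G (rho : R) : (forall z, rho < `|z| -> G z = 0) ->
  rho + 1 < 2 ^+ m ->
  G (lattice_point (@shift_index m a i)) = G (lattice_point i + mesh m *: delta_mx 0 a).
Proof.
move=> G0 hm; have m0 := @mesh_gt0 R m.
have E2 : (mesh m)^-1 = 2 ^+ m :> R by rewrite /mesh invrK.
have E4 : ((4 ^ m)%:R : R) = 2 ^+ m * 2 ^+ m.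
  by rewrite natrX -exprMn; congr (_ ^+ _); rewrite -natrM.
have p0 : 0 < (2 : R) ^+ m by rewrite exprn_gt0.
have mp : mesh m * 2 ^+ m = 1 :> R by rewrite -E2 mulfV // gt_eqF.
have [lt|ge] := ltnP (i a).+1 (grid m).
  congr G; apply/rowP => j; rewrite !mxE ffunE !eqxx /=.
  have [->|nja] := eqVneq j a; last by rewrite mulr0 addr0.
  by rewrite /= modn_small // mulr1 /node -natr1; ring.
have ia : i a = (2 * 4 ^ m)%N :> nat.
  by apply/eqP; rewrite eqn_leq -ltnS ltn_ord /= -ltnS.
rewrite !G0 //.
  apply: (lt_le_trans _ (coord_le_norm _ a)); rewrite !mxE !eqxx /= mulr1 /node ia.
  rewrite natrM E4.
  have -> : (2 * (2 ^+ m * 2 ^+ m) - 2 ^+ m * 2 ^+ m) * mesh m + mesh m = 2 ^+ m * (mesh m * 2 ^+ m) + mesh m :> R by ring.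
  rewrite mp mulr1 gtr0_norm ?addr_gt0 //; move: hm m0; lra.
apply: (lt_le_trans _ (coord_le_norm _ a)); rewrite !mxE ffunE !eqxx /=.
rewrite ia modnn /node sub0r E4.
have -> : - (2 ^+ m * 2 ^+ m) * mesh m = - (2 ^+ m * (mesh m * 2 ^+ m)) :> R by ring.
by rewrite mp mulr1 normrN gtr0_norm //; move: hm; lra.
Qed.

(** The sum of the difference quotients is 0, because a shift permutes the lattice. They approximate
    the derivative uniformly and with bounded support, so [lattice_sum_bound] controls the
    difference. *)
Lemma lattice_sum_derive G (rho : R) a : 0 <= rho ->
  (forall z, differentiable G z) -> continuous (pd (delta_mx 0 a) G) ->
  (forall z, rho < `|z| -> G z = 0) ->
  lattice_sum (pd (delta_mx 0 a) G) m @[m --> \oo] --> (0 : R).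
Proof.
move=> rho0 dG cG G0; set g := pd (delta_mx 0 a) G.
have g0 z : rho < `|z| -> g z = 0.
  move=> rz; rewrite /g pdxE.
  rewrite (@near_eq_derive _ _ _ G (cst 0)) ?derive_cst //.
  have oU : open [set z : 'rV[R]_N | rho < `|z|].
    rewrite (_ : [set _ | _] = (fun z : 'rV[R]_N => `|z|) @^-1` [set x : R | rho < x]) //.
    apply: open_comp; last exact: open_gt.
    by move=> x _; exact: norm_continuous.
  by apply: filterS (open_nbhs_nbhs (conj oU rz)) => y; exact: G0.
apply/cvgrPdist_le => e e0.
(* The constant of [lattice_sum_bound] for supports of radius rho + 1: one extra unit for the
   translation by a mesh of at most 1. *)
pose B := (2 * (rho + 1) + 1) ^+ N : R.
have B0 : 0 < B by rewrite exprn_gt0 //; lra.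
have [d d0 hd] := compact_support_uniform cG g0 (divr_gt0 e0 B0).
have nd : \forall m \near \oo, mesh m < d.
  by have /cvgrPdist_lt/(_ _ d0) := @mesh_cvg R; apply: filterS => m; rewrite sub0r normrN gtr0_norm // mesh_gt0.
have nr : \forall m \near \oo, rho + 1 < 2 ^+ m.
  have := nbhs_infty_ger (rho + 1); apply: filterS => m /le_lt_trans; apply.
  by rewrite -natrX ltr_nat ltn_expl.
apply: filterS2 nd nr => m md mr; rewrite sub0r normrN.
have m0 := @mesh_gt0 R m.
pose h := mesh m : R; pose v : 'rV[R]_N := delta_mx 0 a.
have vle : `|v| <= 1.
  by apply: norm_le_coord => // j; rewrite mxE; case: (_ && _); rewrite ?normr1 ?normr0.
pose D z := (G (z + h *: v) - G z) / h.
have sumD : lattice_sum D m = 0.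
  rewrite /lattice_sum /D -mulr_suml sumrB.
  rewrite (eq_bigr (fun i => G (lattice_point (shift_index a i)))); last first.
    by move=> i _; rewrite (lattice_point_shift _ _ G0).
  have Es : \sum_i G (lattice_point (@shift_index m a i)) = \sum_i G (@lattice_point R N m i).
    by rewrite [RHS](reindex_inj (@shift_index_inj m a)).
  by rewrite Es subrr mul0r mulr0.
have -> : lattice_sum g m = lattice_sum (fun z => g z - D z) m.
  by rewrite -[LHS]subr0 -sumD /lattice_sum -mulrBr -sumrB.
have bs : bounded_support (fun z => g z - D z) (e / B) (rho + 1).
  split; [by rewrite divr_ge0 // ltW|lra|move=> z; split].
    have [s s01 E] := @mvt_line _ _ G z (h *: v) (fun s _ => dG _).
    have -> : D z = g (z + s *: (h *: v)).
      rewrite /D E deriveE // linearZ /= -deriveE // -pdxE.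
      by rewrite -[_ *: _]/(h * g (z + s *: (h *: v))) mulrC mulKf // gt_eqF.
    rewrite distrC; apply: hd.
    rewrite !normrZ (gtr0_norm m0); apply: le_lt_trans md.
    move: s01 => /andP[s0 s1]; rewrite (ger0_norm s0) mulrA -[leRHS]mulr1.
    apply: ler_pM => //; first by rewrite mulr_ge0 // ltW.
    by rewrite ler_piMl // ltW.
  move=> rz; rewrite g0; last lra.
  rewrite /D !G0 ?subrr ?mul0r ?subrr //; first lra.
  have : `|z| <= `|z + h *: v| + `|h *: v|.
    by rewrite -{1}[z](addrK (h *: v)) ler_normB.
  have : `|h *: v| <= 1.
    by rewrite normrZ (gtr0_norm m0) mulr_ile1 // ?mesh_le1 // ltW.
  by move: rz; move: (`|z|) (`|z + _|) (`|h *: v|) => p q r; lra.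
apply: le_trans (lattice_sum_bound m bs) _.
by rewrite -/B divfK // gt_eqF.
Qed.

End LatticeDivergence.

Section EuclideanIntegral.
Context {R : realType} (N : nat).
Implicit Types (f g G : 'rV[R]_N -> R).

Definition integrand f := exists C rho : R, bounded_support f C rho.

Lemma integrand_evbounded f : integrand f -> evbounded (lattice_sum f).
Proof.
move=> [C [rho fC]]; exists (C * (2 * rho + 1) ^+ N).
by apply: nearW => m; exact: lattice_sum_bound.
Qed.

(** Every bounded function of bounded support has an integral, so indicators and discontinuous
    minorants are admissible below. The last clause is the only form in which translation invariance
    is used. *)
Theorem euclidean_integral : exists I : ('rV[R]_N -> R) -> R,
  [/\ forall f g, integrand f -> integrand g -> I (fun z => f z + g z) = I f + I g,
    forall c f, integrand f -> I (fun z => c * f z) = c * I f,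
    (forall f, integrand f -> (forall z, 0 <= f z) -> 0 <= I f),
    (forall f z0 (c d : R), integrand f -> (forall z, 0 <= f z) -> 0 < c -> 0 < d ->
      (forall z, `|z - z0| < d -> c <= f z) -> 0 < I f) &
    (forall G (rho : R) a, 0 <= rho -> (forall z, differentiable G z) ->
      continuous (pd (delta_mx 0 a) G) -> (forall z, rho < `|z| -> G z = 0) ->
      I (pd (delta_mx 0 a) G) = 0)].
Proof.
have [L [LD LZ L0 Lc Lcvg]] := @generalized_limit R.
exists (fun f => L (lattice_sum f)); split.
- move=> f g bf bg; rewrite -LD; [|exact: integrand_evbounded|exact: integrand_evbounded].
  by congr L; apply/funext => m; rewrite /lattice_sum big_split mulrDr.
- move=> c f bf; rewrite -LZ; last exact: integrand_evbounded.
  by congr L; apply/funext => m; rewrite /lattice_sum -mulr_sumr mulrCA.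
- move=> f bf f0; apply: L0; first exact: integrand_evbounded.
  apply: nearW => m; rewrite /lattice_sum mulr_ge0 ?exprn_ge0 ?(ltW (mesh_gt0 m)) //.
  exact: sumr_ge0.
- move=> f z0 c d bf f0 c0 d0 fc.
  apply: (@lt_le_trans _ _ (c * (d / 4) ^+ N)).
    by rewrite mulr_gt0 // exprn_gt0 // divr_gt0.
  apply: Lc; first exact: integrand_evbounded.
  exact: (lattice_sum_lower d0 (ltW c0) f0 fc).
- by move=> G rho a rho0 dG cG G0; apply: Lcvg; exact: lattice_sum_derive dG cG G0.
Qed.

End EuclideanIntegral.

(** * Fermi coordinates *)

Section DotProduct.
Context {R : realType} {m : nat}.
Implicit Types x y z : 'rV[R]_m.

Lemma dotpE x y : dotp x y = \sum_i x 0 i * y 0 i.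
Proof. by rewrite /dotp mxE; apply: eq_bigr => i _; rewrite mxE. Qed.

Lemma dotpC x y : dotp x y = dotp y x.
Proof. by rewrite !dotpE; apply: eq_bigr => i _; rewrite mulrC. Qed.

Lemma dotpDl x y z : dotp (x + y) z = dotp x z + dotp y z.
Proof. by rewrite !dotpE -big_split; apply: eq_bigr => i _; rewrite mxE mulrDl. Qed.

Lemma dotpZl (c : R) x z : dotp (c *: x) z = c * dotp x z.
Proof. by rewrite !dotpE mulr_sumr; apply: eq_bigr => i _; rewrite mxE mulrA. Qed.

Lemma dotpNl x z : dotp (- x) z = - dotp x z.
Proof. by rewrite -scaleN1r dotpZl mulN1r. Qed.

Lemma dotpBl x y z : dotp (x - y) z = dotp x z - dotp y z.
Proof. by rewrite dotpDl dotpNl. Qed.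

Lemma dotpDr x y z : dotp z (x + y) = dotp z x + dotp z y.
Proof. by rewrite !(dotpC z) dotpDl. Qed.

Lemma dotpZr (c : R) x z : dotp z (c *: x) = c * dotp z x.
Proof. by rewrite !(dotpC z) dotpZl. Qed.

Lemma dotpBr x y z : dotp z (x - y) = dotp z x - dotp z y.
Proof. by rewrite !(dotpC z) dotpBl. Qed.

Lemma dotp0l x : dotp 0 x = 0.
Proof. by rewrite -(scale0r x) dotpZl mul0r. Qed.

Lemma dotp0r x : dotp x 0 = 0.
Proof. by rewrite dotpC dotp0l. Qed.

Lemma dotp_ge0 x : 0 <= dotp x x.
Proof. by rewrite dotpE sumr_ge0 // => i _; rewrite -expr2 sqr_ge0. Qed.

Lemma dotp_eq0 x : dotp x x = 0 -> x = 0.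
Proof.
rewrite dotpE => /eqP; rewrite psumr_eq0; last by move=> i _; rewrite -expr2 sqr_ge0.
move=> /allP x0; apply/rowP => i; rewrite mxE.
by have := x0 i (mem_index_enum _); rewrite -expr2 sqrf_eq0 => /eqP.
Qed.

Lemma dotp_mulmx k x (A : 'M[R]_(k, m)) i : (x *m A^T) 0 i = dotp x (row i A).
Proof. by rewrite dotpE mxE; apply: eq_bigr => j _; rewrite !mxE. Qed.

Lemma enorm1 x : enorm x = 1 -> dotp x x = 1.
Proof. by move=> x1; rewrite -[LHS]sqr_sqrtr ?dotp_ge0 // -/(enorm x) x1 expr1n. Qed.

Lemma coord_sqr_le_dotp x i : x 0 i ^+ 2 <= dotp x x.
Proof.
rewrite dotpE (bigD1 i) //= -expr2 lerDl sumr_ge0 // => j _.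
by rewrite -expr2 sqr_ge0.
Qed.

Lemma dotp_CauchySchwarz x y : dotp x y ^+ 2 <= dotp x x * dotp y y.
Proof.
have [y0|y0] := eqVneq (dotp y y) 0.
  by rewrite (dotp_eq0 y0) !dotp0r mulr0 expr0n.
have yp : 0 < dotp y y by rewrite lt_neqAle eq_sym y0 dotp_ge0.
have := dotp_ge0 (dotp y y *: x - dotp x y *: y).
rewrite dotpBl !dotpBr !dotpZl !dotpZr (dotpC y x).
set a := dotp x x; set b := dotp x y; set c := dotp y y => h.
have : 0 <= c * (a * c - b ^+ 2) by move: h; rewrite expr2; lra.
by rewrite pmulr_rge0 // subr_ge0.
Qed.

Lemma norm_sqr_le_dotp x : `|x| ^+ 2 <= dotp x x.
Proof.
suff : `|x| <= Num.sqrt (dotp x x).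
  move=> h; rewrite -[leRHS]sqr_sqrtr ?dotp_ge0 //.
  by rewrite lerXn2r ?nnegrE ?sqrtr_ge0.
apply: norm_le_coord => [|j]; first exact: sqrtr_ge0.
by rewrite -sqrtr_sqr ler_wsqrtr // coord_sqr_le_dotp.
Qed.

End DotProduct.

(** [Ck] states properties of a total function at each point of the set, which is why arbitrary sets
    U' containing x suffice. *)
Lemma Ck_local {R : realType} {V : normedModType R} k (U : set V) (f : V -> R) :
  (forall x, U x -> exists U' : set V, U' x /\ Ck k U' f) -> Ck k U f.
Proof.
elim: k f => [|k IH] f h.
  by split=> // x /h[U' [U'x fC]]; exact: (Ck_diff fC).
split=> [x /h[U' [U'x fC]]|v]; first exact: (Ck_diff fC).
apply: IH => x /h[U' [U'x fC]]; exists U'; split=> //; exact: Ck_derive.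
Qed.

(** * Smoothness of the Gauss map in a chart *)

Section UnitNormal.
Context {R : realType} {n : nat}.
Variables (U : set 'rV[R]_n) (Y : 'rV[R]_n -> 'rV[R]_n.+1) (nu : 'rV[R]_n -> 'rV[R]_n.+1).
Hypotheses (oU : open U) (YC : forall k j, Ck k U (fun u => Y u 0 j)).
Hypothesis Yimm : forall u, U u -> row_free ('J Y u).
Hypothesis nuN : forall u, U u -> [/\ dotp (nu u) (nu u) = 1,
  nu u *m ('J Y u)^T = 0 & 0 < \det (col_mx (nu u) ('J Y u) : 'M[R]_(1 + n))].

Lemma gram_unitmx k (J : 'M[R]_(n, k)) : row_free J -> J *m J^T \in unitmx.
Proof.
move=> fJ; rewrite -row_free_unit; apply: inj_row_free => v vJJ.
have : dotp (v *m J) (v *m J) = 0.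
  by rewrite /dotp trmx_mul mulmxA -[v *m J *m J^T]mulmxA vJJ mul0mx mxE.
by move=> /dotp_eq0 vJ; apply: (row_free_inj fJ); rewrite vJ mul0mx.
Qed.

Lemma normal_span u x : U u -> x *m ('J Y u)^T = 0 -> x = dotp x (nu u) *: nu u.
Proof.
move=> /nuN[n1 nJ dJ] xJ; apply/eqP; rewrite -subr_eq0; apply/eqP.
set y := x - _.
have : y *m (col_mx (nu u) ('J Y u))^T = 0.
  have yJ : y *m ('J Y u)^T = 0.
    by rewrite /y mulmxBl xJ -scalemxAl nJ scaler0 subr0.
  have yN : y *m (nu u)^T = 0.
    apply/matrixP => i j; rewrite !ord1 [RHS]mxE -[LHS]/(dotp y (nu u)).
    by rewrite /y dotpBl dotpZl n1 mulr1 subrr.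
  by rewrite tr_col_mx mul_mx_row yJ yN row_mx0.
move=> yC; have uC : (col_mx (nu u) ('J Y u) : 'M[R]_(1 + n))^T \in unitmx.
  by rewrite unitmx_tr unitmxE unitfE gt_eqF.
have := congr1 (mulmx^~ (invmx (col_mx (nu u) ('J Y u) : 'M[R]_(1 + n))^T)) yC.
by rewrite /= mul0mx (mulmxK uC).
Qed.

(** The unit normal is given pointwise only, with a sign fixed by the orientation. Near u1 a smooth
    formula recovers it: project the constant vector [nu u1] to the normal line and normalize. The
    orientation determinant of the projection is continuous and positive at u1, so the sign is right
    nearby. *)
Lemma unit_normal_smooth k j : Ck k U (fun u => nu u 0 j).
Proof.
have dY u : U u -> differentiable Y u.
  by move=> Uu; apply: differentiable_row => i; exact: (Ck_diff (YC 0%N i)).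
have JC k' a b : Ck k' U (fun u => 'J Y u a b).
  apply: (Ck_ext oU _ (Ck_derive (delta_mx 0 a) (YC k'.+1 b))) => u Uu.
  by rewrite (jacobian_coord _ _ (dY _ Uu)).
apply: Ck_local => u1 Uu1.
pose b := nu u1.
pose nb u := b - b *m ('J Y u)^T *m invmx ('J Y u *m ('J Y u)^T) *m 'J Y u.
have nbC k' a : Ck k' U (fun u => nb u 0 a).
  have gC i i' : Ck k' U (fun u => ('J Y u *m ('J Y u)^T) i i').
    have H : Ck k' U (fun u => \sum_l 'J Y u i l * 'J Y u i' l).
      by apply: Ck_sum => // l _; exact: CkM.
    apply: (Ck_ext oU _ H) => u _; rewrite mxE.
    by apply: eq_bigr => l _; rewrite [X in _ = _ * X]mxE.
  have giC i i' : Ck k' U (fun u => invmx ('J Y u *m ('J Y u)^T) i i').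
    by apply: (Ck_invmx _ _ oU gC) => u Uu; apply: gram_unitmx; exact: Yimm.
  have H : Ck k' U (fun u => b 0 a - \sum_i' (\sum_i (\sum_l b 0 l * 'J Y u i l) *
     invmx ('J Y u *m ('J Y u)^T) i i') * 'J Y u i' a).
    apply: CkB => //; first exact: Ck_cst.
    apply: Ck_sum => // i' _; apply: CkM => //; apply: Ck_sum => // i _; apply: CkM => //.
    by apply: Ck_sum => // l _; exact: CkZ.
  apply: (Ck_ext oU _ H) => u _; rewrite /nb [RHS]mxE; congr (_ + _).
  rewrite mxE; congr (- _); rewrite mxE; apply: eq_bigr => i' _; congr (_ * _).
  rewrite mxE; apply: eq_bigr => i _; congr (_ * _).
  by rewrite mxE; apply: eq_bigr => l _; rewrite [in RHS]mxE.
pose D u := \det (col_mx (nb u) ('J Y u) : 'M[R]_(1 + n)).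
have DC : Ck 0 U D.
  apply: Ck_det => // i i'; rewrite -(fintype.splitK i).
  case: (fintype.split i) => i0 /=.
    by apply: (Ck_ext oU _ (nbC 0%N i')) => u _; rewrite col_mxEu (ord1 i0).
  by apply: (Ck_ext oU _ (JC 0%N i0 i')) => u _; rewrite col_mxEd.
have nb1 : nb u1 = nu u1.
  by have [_ nJ _] := nuN Uu1; rewrite /nb /b nJ !mul0mx subr0.
have D1 : 0 < D u1 by rewrite /D nb1; have [] := nuN Uu1.
have nD : \forall u \near u1, U u /\ 0 < D u.
  apply: filterI; first exact: open_nbhs_nbhs.
  have cD := Ck_continuous DC Uu1.
  exact: (cvgr_gt _ cD).
have /nbhs_ballP[r /= r0 hr] := nD.
have oB : open (ball u1 r) by exact: ball_open.
exists (ball u1 r); split; first exact: ballxx.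
have BU : ball u1 r `<=` U by move=> u /hr[].
have key u : ball u1 r u -> 0 < dotp (nb u) (nb u) /\
    nu u = (Num.sqrt (dotp (nb u) (nb u)))^-1 *: nb u.
  move=> /hr[Uu Du]; have [n1 nJ dJ] := nuN Uu.
  have nbJ : nb u *m ('J Y u)^T = 0.
    rewrite /nb mulmxBl -!mulmxA mulVmx ?mulmx1 ?subrr //.
    by apply: gram_unitmx; exact: Yimm.
  have nbE := normal_span Uu nbJ; set c := dotp (nb u) (nu u) in nbE.
  (* The determinant is linear in its first row: the positive number [D u] is c times the positive
     determinant formed with [nu u]. *)
  have c0 : 0 < c.
    have : D u = c * \det (col_mx (nu u) ('J Y u) : 'M[R]_(1 + n)).
      rewrite /D nbE.
      have -> : col_mx (c *: nu u) ('J Y u) = block_mx c%:M 0 0 1%:M *m col_mx (nu u) ('J Y u).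
        by rewrite mul_block_col !mul0mx mul1mx add0r addr0 mul_scalar_mx.
      by rewrite det_mulmx det_ublock det_scalar1 det1 mulr1.
    by move=> DE; move: Du; rewrite DE pmulr_lgt0.
  have nn : dotp (nb u) (nb u) = c ^+ 2.
    by rewrite nbE dotpZl dotpZr n1 mulr1 expr2.
  rewrite nn exprn_gt0 // sqrtr_sqr gtr0_norm // nbE scalerA mulVf ?scale1r //.
  by rewrite gt_eqF.
have nnC : Ck k (ball u1 r) (fun u => dotp (nb u) (nb u)).
  have H : Ck k (ball u1 r) (fun u => \sum_i nb u 0 i * nb u 0 i).
    by apply: Ck_sum => // i _; apply: CkM => //; apply: (Ck_subset BU).
  by apply: (Ck_ext oB _ H) => u _; rewrite dotpE.
have H : Ck k (ball u1 r) (fun u => (Num.sqrt (dotp (nb u) (nb u)))^-1 * nb u 0 j).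
  apply: CkM => //; last exact: (Ck_subset BU).
  apply: CkV => //; first by move=> u /key[h _]; rewrite gt_eqF // sqrtr_gt0.
  by apply: Ck_sqrt => // u /key[].
by apply: (Ck_ext oB _ H) => u /key[_ ->]; rewrite [RHS]mxE.
Qed.

End UnitNormal.

Lemma Ck_comp_linear {R : realType} {V V' : normedModType R} k (U : set V) (f : V -> R)
    (L : {linear V' -> V}) :
  open U -> continuous L -> Ck k U f -> Ck k (L @^-1` U) (fun x => f (L x)).
Proof.
move=> oU cL; have oLU : open (L @^-1` U) by apply: open_comp => // x _; exact: cL.
have dL x : differentiable L x by exact: linear_differentiable.
elim: k f => [|k IH] f fC.
  by split=> // x Ux; apply: differentiable_comp => //; exact: (Ck_diff fC).
split=> [x Ux|v].
  by apply: differentiable_comp => //; exact: (Ck_diff fC).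
apply: (Ck_ext oLU _ (IH _ (Ck_derive (L v) fC))) => x Ux.
have dfL : differentiable f (L x) by exact: (Ck_diff fC).
have dc : differentiable (f \o L) x by exact: (differentiable_comp (dL x) dfL).
have -> : 'D_v (fun x => f (L x)) x = 'd (f \o L) x v by exact: deriveE.
rewrite (diff_comp (dL x) dfL) (deriveE _ dfL).
by rewrite (diff_lin x cL).
Qed.

Section Tubes.
Context {R : realType} {n : nat} {M : smooth_manifold R n}.
Variables (X gamma : M -> 'rV[R]_n.+1).

(* Fermi coordinates: every point [z] of a ball around [X p] is uniquely
   [X q + t *: gamma q] with [q] on a small sheet around [p] and [t] small. *)
Record tube (p : M) := Tube {
  tube_radius : R ;
  tube_height : R ;
  tube_foot : 'rV[R]_n.+1 -> M ;
  tube_dist : 'rV[R]_n.+1 -> R ;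
  tube_sheet : set M ;
  tube_radius_gt0 : 0 < tube_radius ;
  tube_height_gt0 : 0 < tube_height ;
  tube_sheet_open : open tube_sheet ;
  tube_sheet_center : tube_sheet p ;
  tubeP : forall z, ball (X p) tube_radius z ->
    [/\ tube_sheet (tube_foot z), `|tube_dist z| < tube_height &
        z = X (tube_foot z) + tube_dist z *: gamma (tube_foot z)] ;
  tube_unique : forall q (s : R), tube_sheet q -> `|s| < tube_height ->
    ball (X p) tube_radius (X q + s *: gamma q) ->
    tube_foot (X q + s *: gamma q) = q /\ tube_dist (X q + s *: gamma q) = s ;
  tube_foot_continuous : forall z, ball (X p) tube_radius z ->
    {for z, continuous tube_foot} ;
  tube_dist_smooth : forall k, Ck k (ball (X p) tube_radius) tube_dist ;
  tube_normal_smooth : forall k a,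
    Ck k (ball (X p) tube_radius) (fun z => gamma (tube_foot z) 0 a) ;
  tube_dist_derive : forall z v, ball (X p) tube_radius z ->
    pd v tube_dist z = dotp (gamma (tube_foot z)) v ;
  tube_divergence : forall z, ball (X p) tube_radius z -> tube_dist z = 0 ->
    \sum_a pd (delta_mx 0 a) (fun z => gamma (tube_foot z) 0 a) z =
    2^-1 * dotp z (gamma (tube_foot z))
}.

Hypotheses (X_immersion : immersion X) (gamma_gauss : gauss_map X gamma).
Hypothesis X_shrinker : self_shrinker X.

Section Chart.
Variables (k : chart R n M) (Ak : atlas M k).
Let U := cimg k.
Let Y u := X (cinv k u).
Let nu u := gamma (cinv k u).

Let oU : open U := @open_cimg _ _ _ k.

Lemma chart_smooth m j : Ck m U (fun u => Y u 0 j).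
Proof.
have [sY _] := X_immersion Ak.
by have /smooth_onE := smooth_on_coordinate j oU sY.
Qed.

Lemma chart_immersion u : U u -> row_free ('J Y u).
Proof. by have [_ h] := X_immersion Ak; exact: h. Qed.

Lemma chart_normal u : U u -> [/\ dotp (nu u) (nu u) = 1,
  nu u *m ('J Y u)^T = 0 & 0 < \det (col_mx (nu u) ('J Y u) : 'M[R]_(1 + n))].
Proof.
move=> Uu; have [n1 h] := gamma_gauss (cinv k u).
have [] := h k Ak (cinv_dom Uu); rewrite (cinvK Uu) => nJ dJ.
by split=> //; exact: enorm1.
Qed.

Lemma chart_normal_smooth m j : Ck m U (fun u => nu u 0 j).
Proof. exact: (unit_normal_smooth oU chart_smooth chart_immersion chart_normal). Qed.

Let dY u : U u -> differentiable Y u.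
Proof. by move=> Uu; apply: differentiable_row => i; exact: (Ck_diff (chart_smooth 0%N i)). Qed.

Let dnu u : U u -> differentiable nu u.
Proof. by move=> Uu; apply: differentiable_row => i; exact: (Ck_diff (chart_normal_smooth 0%N i)). Qed.

Lemma dotp_derive_normal u v : U u -> dotp (v *m 'J nu u) (nu u) = 0.
Proof.
move=> Uu.
have E : 'D_v (fun u => \sum_i nu u 0 i * nu u 0 i) u = 0.
  rewrite (@eq_on_derive _ _ U _ (cst 1) _ _ oU _ Uu) ?derive_cst // => y Uy.
  by have [<- _ _] := chart_normal Uy; rewrite dotpE.
have dn i : differentiable (fun u => nu u 0 i) u by exact: differentiable_coordinate (dnu Uu).
have : \sum_i 2 * (nu u 0 i * pd v (fun u => nu u 0 i) u) = 0.
  rewrite -[RHS]E.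
  rewrite (_ : (fun u => _) = \sum_i (fun u => nu u 0 i * nu u 0 i)); last first.
    by apply/funext => y; rewrite fct_sumE.
  have dd i : derivable (fun u => nu u 0 i * nu u 0 i) u v.
    by apply: diff_derivable; exact: differentiableM.
  rewrite derive_sum //; apply: eq_bigr => i _.
  have -> : 'D_v (fun u => nu u 0 i * nu u 0 i) u = 'D_v ((fun u => nu u 0 i) * (fun u => nu u 0 i)) u by [].
  rewrite (deriveM (diff_derivable (dn i)) (diff_derivable (dn i))) -pdxE.
  rewrite -[_ *: _]/(nu u 0 i * pd v (fun u => nu u 0 i) u).
  by ring.
rewrite -mulr_sumr => /eqP; rewrite mulf_eq0 pnatr_eq0 /= => /eqP S0.
rewrite dotpE -[RHS]S0; apply: eq_bigr => i _.
by rewrite (mulmx_jacobian _ _ (dnu Uu)); exact: mulrC.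
Qed.

(** Differentiate <d_j Y, nu> = 0 along d_i. *)
Lemma dotp_second_derivative u i j : U u ->
  dotp ('D_(delta_mx 0 i) ('D_(delta_mx 0 j) Y) u) (nu u) =
  - ('J nu u *m ('J Y u)^T) i j.
Proof.
move=> Uu; pose e (i : 'I_n) : 'rV[R]_n := delta_mx 0 i.
have C1 a : Ck 1 U (fun u => nu u 0 a) by exact: chart_normal_smooth.
have C2 a : Ck 1 U ('D_(e j) (fun u => Y u 0 a)).
  exact: (Ck_derive _ (chart_smooth 2 a)).
have dn a : differentiable (fun u => nu u 0 a) u by exact: (Ck_diff (C1 a)).
have d2 a : differentiable ('D_(e j) (fun u => Y u 0 a)) u by exact: (Ck_diff (C2 a)).
have E : 'D_(e i) (fun u => \sum_a 'D_(e j) (fun u => Y u 0 a) u * nu u 0 a) u = 0.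
  rewrite (@eq_on_derive _ _ U _ (cst 0) _ _ oU _ Uu) ?derive_cst // => y Uy.
  have [_ nJ _] := chart_normal Uy.
  transitivity ((nu y *m ('J Y y)^T) 0 j); last by rewrite nJ mxE.
  rewrite dotp_mulmx dotpE; apply: eq_bigr => a _; rewrite mulrC; congr (_ * _).
  by rewrite [RHS]mxE (jacobian_coord _ _ (dY Uy)).
have D2 a : ('D_(e i) ('D_(e j) Y) u) 0 a = 'D_(e i) ('D_(e j) (fun u => Y u 0 a)) u.
  have eqn y : U y -> ('D_(e j) Y y) 0 a = 'D_(e j) (fun u => Y u 0 a) y.
    by move=> Uy; rewrite derive_row //; exact: dY.
  rewrite derive_row; first exact: (eq_on_derive _ oU eqn Uu).
  apply: differentiable_row => b.
  apply: (@near_eq_differentiable _ _ _ ('D_(e j) (fun u => Y u 0 b))).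
    apply: (eq_on_near oU _ Uu) => y Uy; rewrite derive_row //; exact: dY.
  exact: (Ck_diff (Ck_derive (e j) (chart_smooth 1 b))).
have : \sum_a (('D_(e i) ('D_(e j) Y) u) 0 a * nu u 0 a
     + pd (e j) (fun u => Y u 0 a) u * pd (e i) (fun u => nu u 0 a) u) = 0.
  rewrite -[RHS]E.
  rewrite (_ : (fun u => _) = \sum_a (fun u => 'D_(e j) (fun u => Y u 0 a) u * nu u 0 a)); last first.
    by apply/funext => y; rewrite fct_sumE.
  rewrite derive_sum; last by move=> a; apply: diff_derivable; exact: differentiableM.
  apply: eq_bigr => a _.
  have -> : 'D_(e i) (fun u => 'D_(e j) (fun u => Y u 0 a) u * nu u 0 a) u =
     'D_(e i) ('D_(e j) (fun u => Y u 0 a) * (fun u => nu u 0 a)) u by [].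
  rewrite (deriveM (diff_derivable (d2 a)) (diff_derivable (dn a))) D2 addrC.
  by rewrite -!pdxE; congr (_ + _); rewrite mulrC.
rewrite big_split /= => /eqP; rewrite addr_eq0 => /eqP E'.
rewrite dotpE E'; congr (- _); rewrite [RHS]mxE; apply: eq_bigr => a _.
rewrite [X in _ = _ * X]mxE.
have e1 : pd (e i) (fun u => nu u 0 a) u = 'J nu u i a by rewrite (jacobian_pd _ _ (dnu Uu)).
have e2 : pd (e j) (fun u => Y u 0 a) u = 'J Y u j a by rewrite (jacobian_pd _ _ (dY Uu)).
by rewrite e1 e2; exact: mulrC.
Qed.

(** Scalar product of the self-shrinker equation with nu: g^{ij} <d_i d_j Y, nu> = - <Y, nu> / 2;
    then [dotp_second_derivative] moves one derivative onto nu, which changes the sign. *)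
Lemma chart_trace u : U u ->
  \tr (invmx (induced_metric Y u) *m ('J nu u *m ('J Y u)^T)) =
  2^-1 * dotp (Y u) (nu u).
Proof.
move=> Uu; have [n1 nJ _] := chart_normal Uu.
have H := X_shrinker Ak Uu.
have npE x : dotp (normal_part Y u x) (nu u) = dotp x (nu u).
  rewrite /normal_part dotpBl.
  have -> : dotp (x *m ('J Y u)^T *m invmx (induced_metric Y u) *m 'J Y u) (nu u) = 0.
    rewrite /dotp -mulmxA.
    have -> : 'J Y u *m (nu u)^T = 0.
      by apply: trmx_inj; rewrite trmx_mul trmxK nJ trmx0.
    by rewrite mulmx0 mxE.
  by rewrite subr0.
have := congr1 (fun x => dotp x (nu u)) H; rewrite /= dotpZl npE.
have -> : dotp (mean_curvature Y u) (nu u) =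
   - \sum_(i < n) \sum_(j < n) invmx (induced_metric Y u) i j * ('J nu u *m ('J Y u)^T) i j.
  rewrite /mean_curvature.
  have dsum (I : finType) (F : I -> 'rV[R]_n.+1) x : dotp (\sum_i F i) x = \sum_i dotp (F i) x.
    elim/big_ind2: _ => //; first exact: dotp0l.
    by move=> a b c d <- <-; rewrite dotpDl.
  rewrite dsum -sumrN; apply: eq_bigr => i _; rewrite dsum -sumrN; apply: eq_bigr => j _.
  by rewrite dotpZl npE dotp_second_derivative // mulrN.
have -> : \tr (invmx (induced_metric Y u) *m ('J nu u *m ('J Y u)^T)) =
  \sum_(i < n) \sum_(j < n) invmx (induced_metric Y u) i j * ('J nu u *m ('J Y u)^T) i j.
  have sym : (invmx (induced_metric Y u))^T = invmx (induced_metric Y u).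
    by rewrite trmx_inv /induced_metric trmx_mul trmxK.
  rewrite -{1}sym /mxtrace [RHS]exchange_big /=; apply: eq_bigr => i _.
  by rewrite mxE; apply: eq_bigr => j _; rewrite [X in X * _ = _]mxE.
move: (\sum_(i < n) _) => T E.
rewrite -[X (cinv k u)]/(Y u) in E; move: E; move: (dotp (Y u) (nu u)) => d.
lra.
Qed.

End Chart.
End Tubes.

Section PartialDerivativeRules.
Context {R : realType} {V : normedModType R}.
Implicit Types (f g : V -> R) (v x : V).

Lemma pd_cst v (c : R) x : pd v (fun=> c) x = 0.
Proof. by rewrite pdxE; exact: derive_cst. Qed.

Lemma pdD v f g x : differentiable f x -> differentiable g x ->
  pd v (fun y => f y + g y) x = pd v f x + pd v g x.
Proof. by move=> df dg; rewrite !pdxE; exact: (deriveD (diff_derivable df) (diff_derivable dg)). Qed.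

Lemma pdN v f x : differentiable f x -> pd v (fun y => - f y) x = - pd v f x.
Proof. by move=> df; rewrite !pdxE; exact: (deriveN (diff_derivable df)). Qed.

Lemma pdB v f g x : differentiable f x -> differentiable g x ->
  pd v (fun y => f y - g y) x = pd v f x - pd v g x.
Proof. by move=> df dg; rewrite !pdxE; exact: (deriveB (diff_derivable df) (diff_derivable dg)). Qed.

Lemma pdM v f g x : differentiable f x -> differentiable g x ->
  pd v (fun y => f y * g y) x = pd v f x * g x + f x * pd v g x.
Proof.
move=> df dg; rewrite !pdxE.
have -> : 'D_v (fun y => f y * g y) x = 'D_v (f * g) x by [].
rewrite (deriveM (diff_derivable df) (diff_derivable dg)) addrC.
by rewrite /GRing.scale /= mulrC.
Qed.

Lemma pdZ v (c : R) f x : differentiable f x -> pd v (fun y => c * f y) x = c * pd v f x.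
Proof.
move=> df; have dc : differentiable (cst c : V -> R) x by exact: differentiable_cst.
rewrite (pdM _ dc df).
by rewrite pd_cst mul0r add0r.
Qed.

Lemma pdV v f x : differentiable f x -> f x != 0 ->
  pd v (fun y => (f y)^-1) x = - pd v f x / f x ^+ 2.
Proof.
move=> df f0; rewrite !pdxE (deriveV f0 (diff_derivable df)) /GRing.scale /=.
by rewrite mulNr mulrC mulNr.
Qed.

Lemma pd_sum v m (F : 'I_m -> V -> R) x : (forall i, differentiable (F i) x) ->
  pd v (fun y => \sum_i F i y) x = \sum_i pd v (F i) x.
Proof.
move=> dF; rewrite pdxE.
rewrite (_ : (fun y => _) = \sum_i F i); last by apply/funext => y; rewrite fct_sumE.
rewrite derive_sum; last by move=> i; exact: diff_derivable.
by apply: eq_bigr => i _; rewrite pdxE.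
Qed.

Lemma differentiable_fsum m (F : 'I_m -> V -> R) x : (forall i, differentiable (F i) x) ->
  differentiable (fun y => \sum_i F i y) x.
Proof.
move=> dF; rewrite (_ : (fun y => _) = \sum_i F i); first exact: differentiable_sum.
by apply/funext => y; rewrite fct_sumE.
Qed.

Lemma pd_comp1 v (g : R -> R) (dg : R) f x : is_derive (f x) 1 g dg ->
  differentiable f x -> pd v (fun y => g (f y)) x = dg * pd v f x.
Proof. by move=> hg df; rewrite !pdxE; have [_] := is_derive_comp1 v hg df. Qed.

Lemma pd_ext (U : set V) v f g x : open U -> (forall y, U y -> f y = g y) -> U x ->
  pd v f x = pd v g x.
Proof. by move=> oU fg Ux; rewrite !pdxE; exact: (eq_on_derive v oU fg Ux). Qed.

Lemma pd_near v f g x : {near x, f =1 g} -> pd v f x = pd v g x.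
Proof. by move=> fg; rewrite !pdxE; exact: near_eq_derive. Qed.

Lemma pd_linD v w f x : differentiable f x -> pd (v + w) f x = pd v f x + pd w f x.
Proof. by move=> df; rewrite !pdxE !(deriveE _ df) linearD. Qed.

Lemma pd_linZ (c : R) v f x : differentiable f x -> pd (c *: v) f x = c * pd v f x.
Proof. by move=> df; rewrite !pdxE !(deriveE _ df) linearZ. Qed.

Lemma pd_diff_comp {V' : normedModType R} (L : V' -> V) f (v x : V') :
  differentiable L x -> differentiable f (L x) ->
  pd v (fun y => f (L y)) x = pd ('D_v L x) f (L x).
Proof.
move=> dL df; rewrite !pdxE (deriveE _ df) (deriveE _ dL).
have -> : 'D_v (fun y => f (L y)) x = 'd (f \o L) x v.
  by apply: deriveE; exact: (differentiable_comp dL df).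
by rewrite (diff_comp dL df).
Qed.

End PartialDerivativeRules.

Section PartialDerivativeRows.
Context {R : realType} {m : nat}.

Lemma pd_coordE (f : 'rV[R]_m -> R) x v : differentiable f x ->
  pd v f x = \sum_i v 0 i * pd (delta_mx 0 i) f x.
Proof.
move=> df; rewrite pdxE (derive_coordE _ df).
by apply: eq_bigr => i _; rewrite pdxE.
Qed.

Lemma pd_coord j v (x : 'rV[R]_m) : pd v (fun y : 'rV[R]_m => y 0 j) x = v 0 j.
Proof.
rewrite pdxE -(@derive_row R _ m id x v j); last by [].
by rewrite derive_id.
Qed.

Lemma Ck_coord k (U : set 'rV[R]_m) j : Ck k U (fun x : 'rV[R]_m => x 0 j).
Proof.
case: k => [|k]; first by split=> // x _; exact: differentiable_coord.
split=> [x _|v]; first exact: differentiable_coord.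
rewrite -pdE (_ : pd v _ = cst (v 0 j)); first exact: Ck_cst.
by apply/funext => x; rewrite pd_coord.
Qed.

End PartialDerivativeRows.

Lemma dotp_normal_component {R : realType} m (N A B : 'rV[R]_m) (b c : R) :
  dotp N N = 1 -> dotp A N = 0 -> dotp B N = 0 ->
  dotp N (A + b *: N + c *: B) = b.
Proof. by move=> N1 A0 B0; rewrite dotpC !dotpDl !dotpZl A0 B0 N1; ring. Qed.

(* Unification would otherwise unfold derivatives into limits. *)
#[local] Opaque jacobian derive diff.

Section TubeExistence.
Context {R : realType} {n : nat} {M : smooth_manifold R n}.
Variables (X gamma : M -> 'rV[R]_n.+1).
Hypotheses (X_immersion : immersion X) (gamma_gauss : gauss_map X gamma).
Hypothesis X_shrinker : self_shrinker X.

(** A vector of ['rV[R]_n.+1] stands for a pair (t, u): coordinate 0 is the height, [uco] extracts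
    the chart coordinates. The detour by [uco'] identifies [1 + n] with [n.+1] by conversion. *)
Let uco' : {linear 'M[R]_(1, 1 + n) -> 'M[R]_(1, n)} := @rsubmx R 1 1 n.
Let uco : {linear 'rV[R]_n.+1 -> 'rV[R]_n} := uco'.

Let uco_continuous : continuous uco.
Proof. exact: (@continuous_rsubmx R 1 1 n). Qed.

(** In the sup norm a ball is a product; the inverse function theorem thus yields directly a sheet
    and an interval of heights. *)
Let ball_row (t : R) (u u0 : 'rV[R]_n) (r : R) :
  ball (row_mx (0 : 'rV[R]_1) u0 : 'rV[R]_(1 + n)) r (row_mx (t%:M : 'rV[R]_1) u : 'rV[R]_(1 + n)) <->
  `|t| < r /\ ball u0 r u.
Proof.
split.
- rewrite /ball /= /mx_ball => -[r0 h]; split; last first.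
    by split=> // i j; have := h i (rshift 1 j); rewrite !row_mxEr.
  have := h 0 (lshift n 0); rewrite !row_mxEl !mxE /ball /= sub0r normrN.
  by rewrite mulr1n.
- move=> [tr [r0 h]]; split=> // i j.
  rewrite -(fintype.splitK j); case: (fintype.split j) => j0 /=.
    by rewrite !row_mxEl !ord1 !mxE /ball /= sub0r normrN mulr1n.
  by rewrite !row_mxEr.
Qed.

(** Phi (t, u) = Y u + t nu u is a local diffeomorphism at t = 0, since nu is independent of the
    rows of the Jacobian of Y; the components of its smooth inverse are the distance and the chart
    coordinates of the foot. *)
Lemma tube_exists p : inhabited (tube X gamma p).
Proof.
have [k Ak kp] := atlas_cover p.
pose U := cimg k; have oU : open U := @open_cimg _ _ _ k.
pose Y u := X (cinv k u); pose nu u := gamma (cinv k u).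
have YC := chart_smooth X_immersion Ak.
have nuC := chart_normal_smooth X_immersion gamma_gauss Ak.
have nuN := chart_normal gamma_gauss Ak.
have Yim := chart_immersion X_immersion Ak.
have tr_div := chart_trace X_immersion gamma_gauss X_shrinker Ak.
have nu_dn := dotp_derive_normal X_immersion gamma_gauss Ak.
rewrite -/U -/Y -/nu in YC nuC nuN Yim tr_div nu_dn.
have dY u : U u -> differentiable Y u.
  by move=> Uu; apply: differentiable_row => i; exact: (Ck_diff (YC 0%N i)).
have dnu u : U u -> differentiable nu u.
  by move=> Uu; apply: differentiable_row => i; exact: (Ck_diff (nuC 0%N i)).
pose W := uco @^-1` U.
have oW : open W by apply: open_comp => // x _; exact: uco_continuous.
pose Phi (x : 'rV[R]_n.+1) : 'rV[R]_n.+1 := Y (uco x) + x 0 0 *: nu (uco x).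
have PhiC m j : Ck m W (fun x => Phi x 0 j).
  have H : Ck m W (fun x : 'rV[R]_n.+1 => Y (uco x) 0 j + x 0 0 * nu (uco x) 0 j).
    apply: CkD; [exact: oW|exact: (Ck_comp_linear oU uco_continuous (YC m j))|].
    apply: CkM; [exact: oW|exact: Ck_coord|].
    exact: (Ck_comp_linear oU uco_continuous (nuC m j)).
  by apply: (Ck_ext oW _ H) => x _; rewrite [RHS]mxE; congr (_ + _); rewrite [RHS]mxE.
have dPhi x : W x -> differentiable Phi x.
  by move=> Wx; apply: differentiable_row => i; exact: (Ck_diff (PhiC 0%N i)).
have duco x : differentiable uco x by exact: linear_differentiable.
have Duco v x : 'D_v uco x = uco v.
  by rewrite (deriveE _ (duco x)) (diff_lin x uco_continuous).
have JPhi x v : W x -> v *m 'J Phi x =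
    uco v *m 'J Y (uco x) + v 0 0 *: nu (uco x) + x 0 0 *: (uco v *m 'J nu (uco x)).
  move=> Wx; apply/rowP => j; rewrite (mulmx_jacobian _ _ (dPhi _ Wx)).
  have d1 : differentiable (fun x => Y (uco x) 0 j) x.
    exact: (differentiable_comp (duco x) (Ck_diff (YC 0%N j) Wx)).
  have d2 : differentiable (fun x => nu (uco x) 0 j) x.
    exact: (differentiable_comp (duco x) (Ck_diff (nuC 0%N j) Wx)).
  have d3 : differentiable (fun x : 'rV[R]_n.+1 => x 0 0) x by exact: differentiable_coord.
  rewrite (@pd_ext _ _ W _ _ (fun x => Y (uco x) 0 j + x 0 0 * nu (uco x) 0 j) _ oW _ Wx); last first.
    by move=> y _; rewrite /Phi mxE; congr (_ + _); rewrite mxE.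
  rewrite pdD ?pdM ?pd_coord //; last exact: differentiableM.
  rewrite (@pd_diff_comp _ _ _ uco (fun u => Y u 0 j) v x (duco x) (Ck_diff (YC 0%N j) Wx)).
  rewrite (@pd_diff_comp _ _ _ uco (fun u => nu u 0 j) v x (duco x) (Ck_diff (nuC 0%N j) Wx)).
  rewrite !Duco -(mulmx_jacobian _ _ (dY _ Wx)) -(mulmx_jacobian _ _ (dnu _ Wx)).
  by rewrite [in RHS]mxE [X in _ = X + _]mxE [X in _ = _ + X + _]mxE [X in _ = _ + X]mxE addrA.
have JYn u (a : 'rV[R]_n) : U u -> dotp (a *m 'J Y u) (nu u) = 0.
  move=> Uu; have [_ nJ _] := nuN u Uu; rewrite /dotp -mulmxA.
  have -> : 'J Y u *m (nu u)^T = 0 by apply: trmx_inj; rewrite trmx_mul trmxK nJ trmx0.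
  by rewrite mulmx0 mxE.
pose u0 := cmap k p.
have Uu0 : U u0 by exact: cmap_img.
pose x0 : 'rV[R]_n.+1 := row_mx (0 : 'rV[R]_1) u0.
have ux0 : uco x0 = u0 by exact: row_mxKr.
have tx0 : x0 0 0 = 0.
  transitivity (((row_mx (0 : 'rV[R]_1) u0) : 'rV[R]_(1 + n)) 0 (lshift n 0)).
    by congr (x0 0 _); apply: val_inj.
  by rewrite row_mxEl mxE.
have Wx0 : W x0 by rewrite /W /= ux0.
have Phix0 : Phi x0 = X p by rewrite /Phi tx0 scale0r addr0 ux0 /Y /u0 cmapK.
have J0 : 'J Phi x0 \in unitmx.
  rewrite -row_free_unit; apply: inj_row_free => v; rewrite (JPhi _ _ Wx0) tx0 scale0r addr0 ux0.
  move=> vE; have [n1 nJ _] := nuN u0 Uu0.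
  have v0 : v 0 0 = 0.
    have := congr1 (fun y => dotp y (nu u0)) vE.
    by rewrite /= dotpDl dotpZl n1 mulr1 (JYn _ _ Uu0) add0r dotp0l.
  move: vE; rewrite v0 scale0r addr0 => vE.
  have uv : uco v = 0 by apply: (row_free_inj (Yim _ Uu0)); rewrite vE mul0mx.
  rewrite -[v](@hsubmxK R 1 1 n) -[rsubmx _]/(uco v) uv.
  rewrite (_ : lsubmx _ = 0) ?row_mx0 //; apply/rowP => i; rewrite !ord1 !mxE -[RHS]v0.
  by congr (v 0 _); apply: val_inj.
have [r [rho [G [[r0 rho0] hr surj inj [dG CG]]]]] := smooth_inverse_function oW PhiC Wx0 J0.
rewrite Phix0 in surj inj dG CG.
have WG z : ball (X p) rho z -> W (G z) by move=> /surj[/hr[]].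
have oB : open (ball (X p) rho) by exact: ball_open.
(* Differentiate Phi (G z) = z: any v splits into a multiple of nu and combinations of the
   derivatives of Y and of nu, which are orthogonal to nu. Hence the gradient of the distance is
   nu. *)
have key z v : ball (X p) rho z -> v = 'D_v G z *m 'J Phi (G z).
  move=> bz; have dGz := dG z bz; have dP := dPhi _ (WG _ bz).
  have E : 'D_v (Phi \o G) z = v.
    rewrite -[RHS](@derive_id _ _ z v); apply: near_eq_derive.
    by apply: filterS (open_nbhs_nbhs (conj oB bz)) => y /surj[].
  rewrite -derivemxE // -{1}E (deriveE _ (differentiable_comp dGz dP)).
  by rewrite (diff_comp dGz dP) (deriveE _ dP) (deriveE _ dGz).
have dtG z v : ball (X p) rho z -> pd v (fun z => G z 0 0) z = ('D_v G z) 0 0.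
  by move=> bz; rewrite pdxE (derive_row _ _ (dG z bz)).
have Gn z v : ball (X p) rho z -> ('D_v G z) 0 0 = dotp (nu (uco (G z))) v.
  move=> bz; have Wz := WG _ bz; have [n1 _ _] := nuN _ Wz.
  have := key z v bz; rewrite (JPhi _ _ Wz); move: ('D_v G z) => w ->.
  by rewrite (dotp_normal_component _ _ n1 (JYn _ (uco w) Wz) (nu_dn _ (uco w) Wz)).
have Gsplit z : G z = row_mx ((G z 0 0)%:M : 'rV[R]_1) (uco (G z)) :> 'rV[R]_(1 + n).
  rewrite -[LHS](@hsubmxK R 1 1 n); congr row_mx; apply/rowP => i; rewrite !ord1 !mxE mulr1n.
  by congr (G z 0 _); apply: val_inj.
have sheetG z : ball (X p) rho z -> `|G z 0 0| < r /\ ball u0 r (uco (G z)).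
  by move=> /surj[bG _]; apply/ball_row; rewrite -Gsplit.
pose P : set M := cdom k `&` cmap k @^-1` ball u0 r.
have oP : open P.
  rewrite openE => q [kq bq]; apply: filterI.
    by apply: open_nbhs_nbhs; split=> //; exact: open_cdom.
  apply: (cmap_continuous kq); apply: open_nbhs_nbhs; split=> //; exact: ball_open.
have BU u : ball u0 r u -> U u.
  move=> bu; have : ball x0 r (row_mx (0%:M : 'rV[R]_1) u : 'rV[R]_(1 + n)).
    by apply/ball_row; rewrite normr0.
  by move=> /hr[]; rewrite /W /= /uco' /= row_mxKr.
have PhiG z : ball (X p) rho z -> z = X (cinv k (uco (G z))) + G z 0 0 *: gamma (cinv k (uco (G z))).
  by move=> /surj[_ {1}<-].
have tGs m : Ck m (ball (X p) rho) (fun z => G z 0 0).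
  by apply: (CG (fun x : 'rV[R]_n.+1 => x 0 0)) => m'; exact: Ck_coord.
have BW : ball x0 r `<=` W by move=> x /hr[].
have nGs m a : Ck m (ball (X p) rho) (fun z => nu (uco (G z)) 0 a).
  apply: (CG (fun x => nu (uco x) 0 a)) => m'.
  by apply: (Ck_subset BW); exact: (Ck_comp_linear oU uco_continuous (nuC m' a)).
constructor.
refine (@Tube R n M X gamma p rho r (fun z => cinv k (uco (G z))) (fun z => G z 0 0) P
  rho0 r0 oP _ _ _ _ tGs nGs _ _).
- by split=> //; exact: ballxx.
- move=> z bz; have [tr ur] := sheetG z bz; split=> //; last exact: PhiG.
  by split; [apply: cinv_dom; exact: BU|rewrite /= cinvK //; exact: BU].
- move=> q s [kq bq] sr bz.
  pose x : 'rV[R]_(1 + n) := row_mx (s%:M : 'rV[R]_1) (cmap k q).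
  have bx : ball x0 r x by apply/ball_row.
  have ux : uco x = cmap k q by exact: row_mxKr.
  have tx : x 0 0 = s.
    transitivity (x 0 (lshift n 0)); first by congr (x 0 _); apply: val_inj.
    by rewrite row_mxEl mxE mulr1n.
  have Px : Phi x = X q + s *: gamma q.
    rewrite /Phi -[(x : 'rV[R]_n.+1) 0 0]/(x 0 0) tx ux /Y /nu cmapK //.
  have Gx : G (X q + s *: gamma q) = x by rewrite -Px; apply: inj => //; rewrite Px.
  by rewrite Gx ux cmapK.
- move=> z bz; have cG := differentiable_continuous (dG z bz).
  have cu : {for z, continuous (fun z => uco (G z))}.
    by apply: continuous_comp; [exact: cG|exact: uco_continuous].
  by apply: (continuous_comp cu); exact: (cinv_continuous (WG _ bz)).
- by move=> z v bz; rewrite dtG // Gn.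
- move=> z bz tz; have Wz := WG _ bz; set u := uco (G z) in Wz *.
  have zE : Y u = z by rewrite [RHS](PhiG z bz) tz scale0r addr0.
  have [n1 nJ _] := nuN _ Wz.
  pose Wm : 'M[R]_(n.+1, n) := \matrix_(a, i) uco ('D_(delta_mx 0 a) G z) 0 i.
  pose wc : 'cV[R]_n.+1 := \col_a ('D_(delta_mx 0 a) G z) 0 0.
  have rW a : row a Wm = uco ('D_(delta_mx 0 a) G z) by apply/rowP => i; rewrite !mxE.
  (* At height 0 the identity decomposes as W J + w nu; multiplying by J^T kills the normal part and
     gives W = J^T g^-1. The Euclidean divergence of the normal is the trace of W times ['J nu],
     which is the trace in [chart_trace] up to cyclic order. *)
  have E1 : 1%:M = Wm *m 'J Y u + wc *m nu u.
    apply/row_matrixP => a; have K := key z (delta_mx 0 a) bz.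
    rewrite (JPhi _ _ Wz) tz scale0r addr0 in K.
    rewrite row1 [LHS]K linearD /= !row_mul rW; congr (_ + _).
    apply/rowP => i; rewrite !mxE big_ord1 !mxE.
    by [].
  have E2 : Wm = ('J Y u)^T *m invmx (induced_metric Y u).
    have g1 : induced_metric Y u \in unitmx by apply: gram_unitmx; exact: Yim.
    rewrite -[LHS](mulmxK g1); congr (_ *m _).
    have := congr1 (mulmx^~ ('J Y u)^T) E1; rewrite /= mul1mx mulmxDl -mulmxA => ->.
    by rewrite -[wc *m _ *m _]mulmxA nJ mulmx0 addr0.
  have -> : dotp z (gamma (cinv k u)) = dotp (Y u) (nu u) by rewrite zE.
  rewrite -(tr_div _ Wz).
  rewrite mulmxA mxtrace_mulC mulmxA -E2 /mxtrace; apply: eq_bigr => a _.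
  have dn := dnu _ Wz.
  have dnG : differentiable (fun u => nu u 0 a) (uco (G z)) by exact: differentiable_coordinate.
  have duG : differentiable (fun z => uco (G z)) z by exact: (differentiable_comp (dG z bz) (duco _)).
  transitivity (pd ('D_(delta_mx 0 a) (fun z => uco (G z)) z) (fun u => nu u 0 a) (uco (G z))).
    exact: (@pd_diff_comp _ _ _ (fun z => uco (G z)) (fun u => nu u 0 a) _ z duG dnG).
  rewrite -(mulmx_jacobian _ _ dn).
  have -> : 'D_(delta_mx 0 a) (fun z => uco (G z)) z = row a Wm.
    rewrite rW (deriveE _ duG) (deriveE _ (dG z bz)).
    by rewrite (diff_comp (dG z bz) (duco _)) /= (diff_lin _ uco_continuous).
  by rewrite -row_mul mxE.
Qed.

End TubeExistence.

#[local] Transparent jacobian derive diff.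

(** * Geometry of the distance function *)

Section DistanceFunction.
Context {R : realType} {m : nat}.
Variables (Om : set 'rV[R]_m) (t : 'rV[R]_m -> R) (N : 'rV[R]_m -> 'rV[R]_m).
Hypotheses (oOm : open Om) (tC : forall k, Ck k Om t).
Hypothesis tN : forall z v, Om z -> pd v t z = dotp (N z) v.
Hypothesis N1 : forall z, Om z -> dotp (N z) (N z) = 1.

Let e (a : 'I_m) : 'rV[R]_m := delta_mx 0 a.
Let Nw w := fun z => dotp (N z) w.

Let dotp_e (x : 'rV[R]_m) a : dotp x (e a) = x 0 a.
Proof.
rewrite dotpE (bigD1 a) //= mxE !eqxx mulr1 big1 ?addr0 // => i ia.
by rewrite mxE eqxx (negbTE ia) mulr0.
Qed.

Lemma normal_dotp_smooth w k : Ck k Om (Nw w).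
Proof.
by apply: (Ck_ext oOm _ (Ck_derive w (tC k.+1))) => z Oz; rewrite -pdxE tN.
Qed.

Lemma normal_coord_smooth a k : Ck k Om (fun z => N z 0 a).
Proof. by apply: (Ck_ext oOm _ (normal_dotp_smooth (e a) k)) => z _; exact: dotp_e. Qed.

Let dNa a z : Om z -> differentiable (fun z => N z 0 a) z.
Proof. by move=> Oz; exact: (Ck_diff (normal_coord_smooth a 0%N) Oz). Qed.

Lemma pd_comm (f : 'rV[R]_m -> R) v w z : Ck 1 Om f -> Om z ->
  pd v (pd w f) z = pd w (pd v f) z.
Proof.
move=> fC Oz; rewrite !pdE; apply: derive_comm.
- by apply: filterS (open_nbhs_nbhs (conj oOm Oz)) => y Oy; exact: (Ck_diff fC Oy).
- exact: (Ck_diff (Ck_derive _ fC) Oz).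
- exact: (Ck_diff (Ck_derive _ fC) Oz).
Qed.

Lemma pd_smooth (f : 'rV[R]_m -> R) v k : Ck k.+1 Om f -> Ck k Om (pd v f).
Proof. by move=> fC; rewrite pdE; exact: Ck_derive. Qed.

(** N is the gradient of t: this is the symmetry of the Hessian of t. *)
Lemma shape_sym v w z : Om z -> pd v (Nw w) z = pd w (Nw v) z.
Proof.
move=> Oz.
have E u : forall y, Om y -> pd u t y = Nw u y by move=> y Oy; rewrite tN.
by rewrite -(pd_ext v oOm (E w) Oz) -(pd_ext w oOm (E v) Oz) (pd_comm _ _ (tC 1) Oz).
Qed.

Lemma pd_Nw v w z : Om z -> pd v (Nw w) z = \sum_a w 0 a * pd v (fun z => N z 0 a) z.
Proof.
move=> Oz.
have E y : Om y -> Nw w y = \sum_a w 0 a * N y 0 a.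
  by move=> _; rewrite /Nw dotpC dotpE.
have dc a : differentiable (cst (w 0 a) : 'rV[R]_m -> R) z by exact: differentiable_cst.
rewrite (pd_ext v oOm E Oz) pd_sum; last by move=> a; exact: (differentiableM (dc a) (dNa a Oz)).
by apply: eq_bigr => a _; rewrite pdZ //; exact: dNa.
Qed.

Lemma shape_sym_coord a b z : Om z ->
  pd (e a) (fun z => N z 0 b) z = pd (e b) (fun z => N z 0 a) z.
Proof.
move=> Oz; have E c : forall y, Om y -> N y 0 c = Nw (e c) y by move=> y _; rewrite /Nw dotp_e.
by rewrite (pd_ext (e a) oOm (E b) Oz) (pd_ext (e b) oOm (E a) Oz) shape_sym.
Qed.

(** By symmetry the derivative of N along N is the gradient of |N|^2 / 2, and |N| = 1. *)
Lemma pd_normal_normal z w : Om z -> pd (N z) (Nw w) z = 0.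
Proof.
move=> Oz; rewrite shape_sym // pd_Nw //.
have E y : Om y -> \sum_a N y 0 a * N y 0 a = 1 by move=> Oy; rewrite -dotpE N1.
have := pd_ext w oOm E Oz; rewrite pd_cst pd_sum; last first.
  by move=> a; apply: differentiableM; exact: dNa.
rewrite (eq_bigr (fun a => 2 * (N z 0 a * pd w (fun z => N z 0 a) z))); last first.
  by move=> a _; rewrite pdM; [ring|exact: dNa|exact: dNa].
by rewrite -mulr_sumr => /eqP; rewrite mulf_eq0 pnatr_eq0 /= => /eqP.
Qed.

Lemma pd_normal_coord z a : Om z -> pd (N z) (fun z => N z 0 a) z = 0.
Proof.
move=> Oz; rewrite -(pd_normal_normal (e a) Oz); apply: (pd_ext _ oOm _ Oz) => y _.
by rewrite /Nw dotp_e.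
Qed.

Definition flat_div (Z : 'rV[R]_m -> 'rV[R]_m) z : R :=
  \sum_a pd (delta_mx 0 a) (fun y => Z y 0 a) z.
(** N being constant along itself, this is |A|^2, the squared norm of the second fundamental form of
    the level set of t. *)
Definition shape_norm z : R :=
  \sum_a \sum_b pd (delta_mx 0 a) (fun y => N y 0 b) z ^+ 2.

Lemma flat_div_smooth k : Ck k Om (flat_div N).
Proof.
apply: Ck_sum => // a _; exact: (pd_smooth _ (normal_coord_smooth a k.+1)).
Qed.

(** Three derivatives of t commute, N being its gradient. *)
Lemma laplacian_normal w z : Om z ->
  \sum_a pd (e a) (pd (e a) (Nw w)) z = pd w (flat_div N) z.
Proof.
move=> Oz.
rewrite pd_sum; last first.
  by move=> a; exact: (Ck_diff (pd_smooth _ (normal_coord_smooth a 1)) Oz).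
apply: eq_bigr => a _.
have E y : Om y -> pd (e a) (Nw w) y = pd w (fun y => N y 0 a) y.
  move=> Oy; rewrite shape_sym //; apply: (pd_ext _ oOm _ Oy) => x _.
  by rewrite /Nw dotp_e.
by rewrite (pd_ext _ oOm E Oz) (pd_comm _ _ (normal_coord_smooth a 1) Oz).
Qed.

(** Riccati equation: apply d_a to the a-th component of the identity that N is constant along N,
    and sum over a. *)
Lemma pd_normal_div z : Om z -> pd (N z) (flat_div N) z = - shape_norm z.
Proof.
move=> Oz.
have dd c a : differentiable (pd (e c) (fun y => N y 0 a)) z.
  exact: (Ck_diff (pd_smooth _ (normal_coord_smooth a 1)) Oz).
rewrite pd_sum // /shape_norm -sumrN; apply: eq_bigr => a _.
have E y : Om y -> \sum_c N y 0 c * pd (e c) (fun y => N y 0 a) y = 0.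
  move=> Oy; rewrite -[RHS](pd_normal_coord a Oy) [RHS]pd_coordE //; exact: dNa.
have := pd_ext (e a) oOm E Oz; rewrite pd_cst pd_sum; last first.
  by move=> c; apply: differentiableM; [exact: dNa|exact: dd].
rewrite (eq_bigr (fun c => pd (e a) (fun y => N y 0 c) z ^+ 2 +
    N z 0 c * pd (e c) (pd (e a) (fun y => N y 0 a)) z)); last first.
  move=> c _; rewrite pdM; [|exact: dNa|exact: dd].
  by rewrite (pd_comm _ _ (normal_coord_smooth a 1) Oz) [in X in _ * X + _]shape_sym_coord // expr2.
rewrite big_split /= => /eqP; rewrite addrC addr_eq0 => /eqP <-.
by rewrite pd_coordE.
Qed.

Hypothesis retract : forall z, Om z -> t z = 0 -> \forall y \near z,
  Om y /\ Om (y - t y *: N y) /\ t (y - t y *: N y) = 0.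
Hypothesis shrinker : forall z, Om z -> t z = 0 ->
  flat_div N z = 2^-1 * dotp z (N z).

(** The shrinker equation div N = <z, N> / 2 holds on the zero level only, so it may be
    differentiated in tangential directions only; this is done by composing with the retraction
    [pr], whose derivative is the tangential projection. The normal part of w is supplied by the
    Riccati equation and yields the |A|^2 term. Together with [laplacian_normal] this is the
    equation of the coordinates of the Gauss map. *)
Lemma pd_div_zero_level w z : Om z -> t z = 0 ->
  pd w (flat_div N) z = 2^-1 * pd z (Nw w) z - shape_norm z * Nw w z.
Proof.
move=> Oz tz.
pose h y := flat_div N y - 2^-1 * \sum_a y 0 a * N y 0 a.
have dya a y : differentiable (fun y : 'rV[R]_m => y 0 a) y by exact: differentiable_coord.
have dyN a : differentiable (fun y : 'rV[R]_m => y 0 a * N y 0 a) z.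
  by apply: differentiableM; [exact: dya|exact: dNa].
have dS : differentiable (fun y : 'rV[R]_m => \sum_a y 0 a * N y 0 a) z by exact: differentiable_fsum.
have dc (c : R) : differentiable (cst c : 'rV[R]_m -> R) z by exact: differentiable_cst.
have dcS : differentiable (fun y : 'rV[R]_m => 2^-1 * \sum_a y 0 a * N y 0 a) z.
  exact: (differentiableM (dc _) dS).
have ddiv : differentiable (flat_div N) z by exact: (Ck_diff (flat_div_smooth 0) Oz).
have dh : differentiable h z by exact: differentiableB.
pose pr y := y - t y *: N y.
have dt : differentiable t z by exact: (Ck_diff (tC 0) Oz).
have dtN a : differentiable (fun y => t y * N y 0 a) z.
  by apply: differentiableM; [exact: dt|exact: dNa].
have prE a : (fun y => pr y 0 a) = (fun y : 'rV[R]_m => y 0 a - t y * N y 0 a).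
  by apply/funext => y; rewrite !mxE.
have dpr : differentiable pr z.
  by apply: differentiable_row => a; rewrite prE; apply: differentiableB.
have prz : pr z = z by rewrite /pr tz scale0r subr0.
have Dpr v : 'D_v pr z = v - dotp (N z) v *: N z.
  apply/rowP => a; rewrite (derive_row _ _ dpr) -pdxE prE pdB //.
  rewrite pd_coord pdM //; last exact: dNa.
  by rewrite tN // tz mul0r addr0 !mxE.
have h0 : pd w (fun y => h (pr y)) z = 0.
  rewrite -(pd_cst w 0 z); apply: pd_near.
  apply: filterS (retract Oz tz) => y [Oy [Opr tpr]].
  by rewrite /h (shrinker Opr tpr) dotpE subrr.
have dh' : differentiable h (pr z) by rewrite prz.
rewrite (pd_diff_comp _ dpr dh') prz Dpr in h0.
rewrite -scaleNr pd_linD // pd_linZ // in h0.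
have hE v : pd v h z = pd v (flat_div N) z - 2^-1 * (dotp (N z) v + pd z (Nw v) z).
  rewrite (pdB v ddiv dcS) (pdZ v _ dS) (pd_sum v dyN); congr (_ - _ * _).
  rewrite (eq_bigr (fun a => N z 0 a * v 0 a + z 0 a * pd v (fun y => N y 0 a) z)); last first.
    by move=> a _; rewrite pdM ?pd_coord; [ring|exact: dya|exact: dNa].
  by rewrite big_split /= -dotpE shape_sym // pd_Nw.
have N0 : pd z (Nw (N z)) z = 0.
  by rewrite shape_sym // pd_normal_normal.
rewrite !hE N1 // N0 pd_normal_div // -/(Nw w z) in h0.
by move: h0; rewrite /Nw; move: (pd w _ z) (pd z _ z) (dotp _ _) (shape_norm z) => A B C D; lra.
Qed.

End DistanceFunction.

(** * Functions of class C^1 and cut-offs *)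

Section C1Class.
Context {R : realType} {V : normedModType R}.
Implicit Types (U : set V) (f g : V -> R).

(** The cut-offs are piecewise polynomial, hence not in every [Ck]; continuous first derivatives are
    what integration by parts asks for. *)
Definition C1 U f := forall x, U x ->
  differentiable f x /\ forall v, {for x, continuous (pd v f)}.

Lemma near_eq_continuous {S T : topologicalType} (f g : S -> T) x :
  {near x, f =1 g} -> {for x, continuous f} -> {for x, continuous g}.
Proof.
move=> fg fc; have fgx := nbhs_singleton fg; rewrite /= in fgx.
rewrite /prop_for /continuous_at -fgx; apply: cvg_trans fc.
by apply: near_eq_cvg; apply: filterS fg => y ->.
Qed.

Lemma C1_continuous U f x : C1 U f -> U x -> {for x, continuous f}.
Proof. by move=> fC /fC[df _]; exact: differentiable_continuous. Qed.

Lemma C1_ext U f g : open U -> (forall y, U y -> f y = g y) -> C1 U f -> C1 U g.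
Proof.
move=> oU fg fC x Ux; have [df cf] := fC x Ux.
split=> [|v]; first exact: near_eq_differentiable (eq_on_near oU fg Ux) df.
apply: near_eq_continuous (cf v).
by apply: filterS (open_nbhs_nbhs (conj oU Ux)) => y Uy; exact: (pd_ext v oU fg Uy).
Qed.

Lemma C1_near U f : (forall x, U x -> exists U' g, [/\ open U', U' x, C1 U' g &
  forall y, U' y -> g y = f y]) -> C1 U f.
Proof.
move=> h x /h[U' [g [oU' U'x gC gf]]].
exact: (C1_ext oU' gf gC U'x).
Qed.

Lemma C1_subset U U' f : U' `<=` U -> C1 U f -> C1 U' f.
Proof. by move=> UU' fC x /UU'; exact: fC. Qed.

Lemma Ck_C1 U f : Ck 1 U f -> C1 U f.
Proof.
move=> fC x Ux; split=> [|v]; first exact: (Ck_diff fC Ux).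
by rewrite pdE; exact: (Ck_continuous (Ck_derive v fC) Ux).
Qed.

Lemma C1_cst U (c : R) : C1 U (fun=> c).
Proof. exact/Ck_C1/Ck_cst. Qed.

Lemma C1D U f g : open U -> C1 U f -> C1 U g -> C1 U (fun x => f x + g x).
Proof.
move=> oU fC gC x Ux; have [df cf] := fC x Ux; have [dg cg] := gC x Ux.
split=> [|v]; first exact: differentiableD.
apply: (@near_eq_continuous _ _ (fun y => pd v f y + pd v g y)).
  apply: filterS (open_nbhs_nbhs (conj oU Ux)) => y Uy.
  by rewrite pdD //; [have [] := fC y Uy|have [] := gC y Uy].
exact: (@continuousD _ _ _ (pd v f) (pd v g) x (cf v) (cg v)).
Qed.

Lemma C1M U f g : open U -> C1 U f -> C1 U g -> C1 U (fun x => f x * g x).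
Proof.
move=> oU fC gC x Ux; have [df cf] := fC x Ux; have [dg cg] := gC x Ux.
split=> [|v]; first exact: differentiableM.
apply: (@near_eq_continuous _ _ (fun y => pd v f y * g y + f y * pd v g y)).
  apply: filterS (open_nbhs_nbhs (conj oU Ux)) => y Uy.
  by rewrite pdM //; [have [] := fC y Uy|have [] := gC y Uy].
have c1 := C1_continuous fC Ux; have c2 := C1_continuous gC Ux.
apply: (@continuousD _ _ _ (fun y => pd v f y * g y) (fun y => f y * pd v g y) x).
  exact: (@continuousM _ _ (pd v f) g x (cf v) c2).
exact: (@continuousM _ _ f (pd v g) x c1 (cg v)).
Qed.

Lemma C1Z U (c : R) f : open U -> C1 U f -> C1 U (fun x => c * f x).
Proof. by move=> oU; apply: C1M => //; exact: C1_cst. Qed.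

Lemma C1N U f : open U -> C1 U f -> C1 U (fun x => - f x).
Proof.
move=> oU fC; apply: (C1_ext oU _ (C1Z (-1) oU fC)) => y _.
by rewrite mulN1r.
Qed.

Lemma C1B U f g : open U -> C1 U f -> C1 U g -> C1 U (fun x => f x - g x).
Proof. by move=> oU fC gC; apply: C1D => //; exact: C1N. Qed.

Lemma C1_sum U m (F : 'I_m -> V -> R) : open U ->
  (forall i, C1 U (F i)) -> C1 U (fun x => \sum_i F i x).
Proof.
move=> oU FC; elim: (index_enum _) => [|i r IH].
  by apply: (C1_ext oU _ (@C1_cst U 0)) => y _; rewrite big_nil.
by apply: (C1_ext oU _ (C1D oU (FC i) IH)) => y _; rewrite big_cons.
Qed.

Lemma C1_comp U (g dg : R -> R) f : open U -> C1 U f ->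
  (forall x, U x -> is_derive (f x) 1 g (dg (f x)) /\ {for f x, continuous dg}) ->
  C1 U (fun x => g (f x)).
Proof.
move=> oU fC hg x Ux; have [df cf] := fC x Ux; have [dgx cdg] := hg x Ux.
split=> [|v]; first by have [] := is_derive_comp1 0 dgx df.
apply: (@near_eq_continuous _ _ (fun y => dg (f y) * pd v f y)).
  apply: filterS (open_nbhs_nbhs (conj oU Ux)) => y Uy.
  by rewrite (pd_comp1 v (hg y Uy).1) //; have [] := fC y Uy.
apply: (@continuousM _ _ (fun y => dg (f y)) (pd v f) x); last exact: cf.
exact: (continuous_comp (C1_continuous fC Ux) cdg).
Qed.

Lemma C1V U f : open U -> (forall x, U x -> f x != 0) -> C1 U f ->
  C1 U (fun x => (f x)^-1).
Proof.
move=> oU f0 fC; apply: (C1_comp (dg := fun y => - y ^- 2) oU fC) => x Ux.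
split.
  have d : derivable (@id R) (f x) 1 by exact: derivable_id.
  have := @deriveV R R^o id (f x) 1 (f0 _ Ux) d.
  have := @derivableV R R^o id (f x) 1 (f0 _ Ux) d.
  move=> d1 e1; apply: DeriveDef; first exact: d1.
  by rewrite e1 derive_id /GRing.scale /= mulr1.
apply: continuousN; apply: continuousV; first by rewrite expf_neq0 // f0.
exact: exprn_continuous.
Qed.

End C1Class.

Section Cutoffs.
Context {R : realType}.
Implicit Types x : R.

Definition pospow (k : nat) x : R := (Num.max 0 x) ^+ k.

Lemma pospow_ge0 k x : 0 <= pospow k x.
Proof. by rewrite exprn_ge0 // le_max lexx. Qed.

Lemma pospow_pos k x : 0 <= x -> pospow k x = x ^+ k.
Proof. by move=> x0; rewrite /pospow; have [/max_idPr ->] := (x0, x0). Qed.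

Lemma pospow_neg k x : x <= 0 -> pospow k.+1 x = 0.
Proof. by move=> x0; rewrite /pospow (max_idPl x0) expr0n. Qed.

Lemma pospow_continuous k : continuous (pospow k).
Proof.
rewrite (_ : pospow k = (fun y : R => y ^+ k) \o (fun y => Num.max 0 y)) //.
move=> x; apply: continuous_comp; last exact: exprn_continuous.
apply: (@continuous_max _ _ (fun=> 0) id x); first exact: cst_continuous.
by move=> A; apply.
Qed.

Lemma is_derive_pospow k x :
  is_derive x 1 (pospow k.+2) (k.+2%:R * pospow k.+1 x).
Proof.
have [x0|x0|->] := ltgtP x 0.
- rewrite pospow_neg ?ltW // mulr0.
  have : is_derive x 1 (cst (0 : R)) (0 : R) by exact: is_derive_cst.
  apply: near_eq_is_derive.
  near=> y; rewrite /cst /= pospow_neg //; apply: ltW; near: y; exact: (lt_nbhsl x0).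
- rewrite pospow_pos ?ltW //.
  have : is_derive x 1 (fun y : R => y ^+ k.+2) (k.+2%:R * x ^+ k.+1).
    apply: DeriveDef; first exact: exprn_derivable.
    by rewrite exp_derive /GRing.scale /= mulr1.
  apply: near_eq_is_derive.
  by near=> y; rewrite pospow_pos //; apply: ltW; near: y; exact: (lt_nbhsr x0).
rewrite pospow_neg // mulr0.
have C : (fun h : R => h^-1 *: (pospow k.+2 (h *: 1 + 0) - pospow k.+2 0)) @ 0^' --> (0 : R).
  apply/cvgrPdist_le => e e0.
  have : \forall h \near (0 : R)^', `|h| < Num.min e 1.
    apply: nbhs_dnbhs.
    have := @nbhsx_ballx R R 0 (Num.min e 1); rewrite lt_min e0 ltr01 => /(_ isT).
    by apply: filterS => h; rewrite -ball_normE /= sub0r normrN.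
  apply: filterS => h; rewrite lt_min => /andP[he h1].
  rewrite sub0r normrN addr0 [h *: 1]mulr1 (pospow_neg k.+1 (lexx 0)) subr0.
  rewrite -[_ *: _]/(h^-1 * _).
  have [h0|h0] := leP h 0; first by rewrite pospow_neg // mulr0 normr0 ltW.
  rewrite pospow_pos ?ltW // exprS mulKf ?gt_eqF // normrX.
  rewrite exprS; apply: (le_lt_trans _ he).
  by rewrite ler_piMr // exprn_ile1 // ltW.
by split; [apply: cvgP C|exact: cvg_lim C].
Unshelve. all: by end_near. Qed.

Lemma C1_pospow {V : normedModType R} (U : set V) k f : open U -> C1 U f ->
  C1 U (fun y => pospow k.+2 (f y)).
Proof.
move=> oU fC; apply: (C1_comp (dg := fun y => k.+2%:R * pospow k.+1 y) oU fC) => x Ux.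
split; first exact: is_derive_pospow.
by apply: continuousM; [exact: cst_continuous|exact: pospow_continuous].
Qed.

Definition plateau x : R := pospow 2 (1 - pospow 2 (x - 1)).

Lemma plateau1 x : x <= 1 -> plateau x = 1.
Proof.
move=> x1; rewrite /plateau (@pospow_neg 1 (x - 1)) ?subr0 ?subr_le0 //.
by rewrite pospow_pos ?expr1n // ler01.
Qed.

Lemma plateau0 x : 2 <= x -> plateau x = 0.
Proof.
move=> x2; apply: pospow_neg; rewrite (pospow_pos 2); last by lra.
by rewrite subr_le0 exprn_ege1 //; lra.
Qed.

Lemma plateau_ge0 x : 0 <= plateau x. Proof. exact: pospow_ge0. Qed.

Lemma plateau_le1 x : plateau x <= 1.
Proof.
rewrite /plateau; set y := pospow 2 (x - 1).
have y0 : 0 <= y by exact: pospow_ge0.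
have [h|h] := leP (1 - y) 0; first by rewrite pospow_neg ?ler01.
by rewrite (pospow_pos _ (ltW h)) exprn_ile1 ?(ltW h) //; lra.
Qed.

Lemma C1_plateau {V : normedModType R} (U : set V) f : open U -> C1 U f ->
  C1 U (fun y => plateau (f y)).
Proof.
move=> oU fC; apply: C1_pospow => //; apply: C1B => //; first exact: C1_cst.
by apply: C1_pospow => //; apply: C1B => //; exact: C1_cst.
Qed.

(** A C^2 transition from 0 to 1 on [0, 1]: with exponent 3 its derivative [bump] is still C^1.
    Since [bump] has integral 1, [bump (t / eps) / eps] averages across a collar of width eps. *)
Definition step x : R := pospow 3 (1 - pospow 3 (1 - x)).
Definition bump x : R := 9 * (pospow 2 (1 - pospow 3 (1 - x)) * pospow 2 (1 - x)).

Lemma is_derive_step x : is_derive x 1 step (bump x).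
Proof.
have d0 : is_derive x 1 (fun y : R => 1 - y) (-1).
  have := is_deriveB (is_derive_cst (1 : R^o) x 1) (is_derive_id x 1).
  by rewrite sub0r.
have comp (g f : R -> R) (df dg : R) (y : R) : is_derive y 1 f df -> is_derive (f y) 1 g dg ->
    is_derive y 1 (fun y => g (f y)) (dg * df).
  move=> hf hg; have dfy : differentiable f y by apply/derivable1_diffP; case: hf.
  have [h1 h2] := @is_derive_comp1 R R g dg f y 1 hg dfy.
  split; first exact: diff_derivable.
  by rewrite [LHS]h2; case: hf => _ ->.
have d1 := comp _ _ _ _ _ d0 (is_derive_pospow 1 (1 - x)).
have d2 : is_derive x 1 (fun y : R => 1 - pospow 3 (1 - y)) (- (3%:R * pospow 2 (1 - x) * -1)).
  have := is_deriveB (is_derive_cst (1 : R^o) x 1) d1.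
  by rewrite sub0r.
have := comp _ _ _ _ _ d2 (is_derive_pospow 1 _).
by congr (is_derive _ _ _ _); rewrite /bump; ring.
Qed.

Lemma bump_ge0 x : 0 <= bump x.
Proof. by apply: mulr_ge0 => //; apply: mulr_ge0; exact: pospow_ge0. Qed.

Lemma bump_neg x : x <= 0 -> bump x = 0.
Proof.
move=> x0; rewrite /bump (pospow_neg 1) ?mul0r ?mulr0 //.
rewrite (pospow_pos 3) ?subr_ge0; last by lra.
by rewrite subr_le0 exprn_ege1 //; lra.
Qed.

Lemma bump_large x : 1 <= x -> bump x = 0.
Proof. by move=> x1; rewrite /bump (@pospow_neg 1 (1 - x)) ?mulr0 ?subr_le0. Qed.

Lemma step_ge0 x : 0 <= step x. Proof. exact: pospow_ge0. Qed.

Lemma step_neg x : x <= 0 -> step x = 0.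
Proof.
move=> x0; apply: pospow_neg; rewrite (pospow_pos 3); last by lra.
by rewrite subr_le0 exprn_ege1 //; lra.
Qed.

Lemma step_large x : 1 <= x -> step x = 1.
Proof.
move=> x1; rewrite /step (@pospow_neg 2 (1 - x)) ?subr0 ?subr_le0 //.
by rewrite pospow_pos ?expr1n ?ler01.
Qed.

Lemma step_le1 x : step x <= 1.
Proof.
have y0 : 0 <= pospow 3 (1 - x) by exact: pospow_ge0.
rewrite /step; have [h|h] := leP (1 - pospow 3 (1 - x)) 0; first by rewrite pospow_neg ?ler01.
by rewrite (pospow_pos _ (ltW h)) exprn_ile1 ?(ltW h) //; lra.
Qed.

Lemma C1_step {V : normedModType R} (U : set V) f : open U -> C1 U f ->
  C1 U (fun y => step (f y)).
Proof.
move=> oU fC; apply: C1_pospow => //; apply: C1B => //; first exact: C1_cst.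
by apply: C1_pospow => //; apply: C1B => //; exact: C1_cst.
Qed.

Lemma C1_bump {V : normedModType R} (U : set V) f : open U -> C1 U f ->
  C1 U (fun y => bump (f y)).
Proof.
move=> oU fC; apply: C1Z => //; apply: C1M => //; apply: C1_pospow => //; apply: C1B => //; try exact: C1_cst.
by apply: C1_pospow => //; apply: C1B => //; exact: C1_cst.
Qed.

End Cutoffs.

Section CompactBounds.
Context {R : realType} {T : topologicalType}.

Lemma bounded_on_compact (K : set T) (g : T -> R) : compact K ->
  (forall x, K x -> {for x, continuous g}) ->
  exists2 C : R, 0 <= C & forall x, K x -> `|g x| <= C.
Proof.
move=> /compact_near_coveringP cK gc.
have H : \forall C \near +oo, K `<=` (fun x => `|g x| <= C).
  apply: (cK _ (pinfty_nbhs R) (fun C x => `|g x| <= C)) => x Kx.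
  have /cvgrPdist_lt/(_ 1 ltr01) := gc x Kx => nx.
  exists ([set y | `|g x - g y| < 1], [set C | `|g x| + 1 <= C]).
    split=> //=; exact: nbhs_pinfty_ge (num_real _).
  move=> [y C] /= [gxy gC]; apply: le_trans gC.
  rewrite -[g y](subKr (g x)) (le_trans (ler_normB _ _)) // lerD2l ltW //.
have /filter_ex[C [C0 hC]] : \forall C \near +oo, 0 <= C /\ K `<=` (fun x => `|g x| <= C).
  apply: filterI H; exact: nbhs_pinfty_ge (num_real _).
by exists C.
Qed.

End CompactBounds.

(** * Extension by zero and the flat divergence theorem *)

Section ZeroExtension.
Context {R : realType} {m : nat}.
Variables (c : 'rV[R]_m) (rho r : R).
Hypotheses (r0 : 0 <= r) (r_rho : r < rho).
Let Om := ball c rho.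
Let oOm : open Om. Proof. exact: ball_open. Qed.
Implicit Types (F G : 'rV[R]_m -> R).

(** The foot and the distance of a tube are meaningful on its ball only, while the integral takes
    functions on the whole space. Functions that vanish beyond a radius r < rho keep their
    regularity when extended by 0. *)
Definition zero_ext (U : set 'rV[R]_m) F z : R := if `[< U z >] then F z else 0.

Lemma zero_ext_in (U : set 'rV[R]_m) F z : U z -> zero_ext U F z = F z.
Proof. by rewrite /zero_ext => Uz; case: asboolP. Qed.

Lemma zero_ext_out (U : set 'rV[R]_m) F z : ~ U z -> zero_ext U F z = 0.
Proof. by rewrite /zero_ext => Uz; case: asboolP. Qed.

Definition vanishes_outside F := forall z, Om z -> r < `|z - c| -> F z = 0.

Lemma zero_ext_far F z : vanishes_outside F -> r < `|z - c| -> zero_ext Om F z = 0.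
Proof.
move=> F0 rz; have [Oz|nOz] := pselect (Om z); first by rewrite zero_ext_in // F0.
by rewrite zero_ext_out.
Qed.

Lemma open_far : open [set z : 'rV[R]_m | r < `|z - c|].
Proof.
rewrite (_ : [set _ | _] = (fun z : 'rV[R]_m => `|z - c|) @^-1` [set x : R | r < x]) //.
apply: open_comp; last exact: open_gt.
move=> z _; apply: continuous_comp; last exact: norm_continuous.
by apply: continuousB; [by move=> A; apply|exact: cst_continuous].
Qed.

Lemma not_ball_far z : ~ Om z -> r < `|z - c|.
Proof.
rewrite /Om -ball_normE /= distrC => h; apply: (lt_le_trans r_rho).
by rewrite leNgt; apply/negP.
Qed.

Lemma near_zero_ext_in F z : Om z -> {near z, F =1 zero_ext Om F}.
Proof.
move=> Oz; apply: filterS (open_nbhs_nbhs (conj oOm Oz)) => y Oy.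
by rewrite zero_ext_in.
Qed.

Lemma near_zero_ext_out F z : vanishes_outside F -> ~ Om z ->
  {near z, cst 0 =1 zero_ext Om F}.
Proof.
move=> F0 /not_ball_far rz.
by apply: filterS (open_nbhs_nbhs (conj open_far rz)) => y ry; rewrite zero_ext_far.
Qed.

Lemma zero_ext_continuous F : (forall z, Om z -> {for z, continuous F}) ->
  vanishes_outside F -> continuous (zero_ext Om F).
Proof.
move=> Fc F0 z; have [Oz|nOz] := pselect (Om z).
  exact: (near_eq_continuous (near_zero_ext_in F Oz) (Fc z Oz)).
apply: (near_eq_continuous (near_zero_ext_out F0 nOz)).
exact: cst_continuous.
Qed.

Lemma zero_ext_differentiable F z : C1 Om F -> vanishes_outside F ->
  differentiable (zero_ext Om F) z.
Proof.
move=> FC F0; have [Oz|nOz] := pselect (Om z).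
  by apply: (near_eq_differentiable (near_zero_ext_in F Oz)); have [] := FC z Oz.
apply: (near_eq_differentiable (near_zero_ext_out F0 nOz)).
exact: differentiable_cst.
Qed.

Lemma pd_vanishes_outside F v : vanishes_outside F -> vanishes_outside (pd v F).
Proof.
move=> F0 z Oz rz; rewrite -(pd_cst v 0 z); apply: pd_near.
have oI : open (Om `&` [set z | r < `|z - c|]) by apply: openI => //; exact: open_far.
by apply: filterS (open_nbhs_nbhs (conj oI (conj Oz rz))) => y [Oy ry]; exact: F0.
Qed.

Lemma pd_zero_ext F v : C1 Om F -> vanishes_outside F ->
  pd v (zero_ext Om F) = zero_ext Om (pd v F).
Proof.
move=> FC F0; apply/funext => z; have [Oz|nOz] := pselect (Om z).
  by rewrite zero_ext_in // -(pd_near v (near_zero_ext_in F Oz)).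
by rewrite zero_ext_out // -(pd_near v (near_zero_ext_out F0 nOz)) pd_cst.
Qed.

Lemma zero_ext_support F z : vanishes_outside F -> `|c| + r < `|z| ->
  zero_ext Om F z = 0.
Proof.
move=> F0 h; apply: zero_ext_far => //; rewrite -(ltrD2l `|c|) (lt_le_trans h) //.
by rewrite -{1}[z](subrK c) addrC ler_normD.
Qed.

Lemma integrand_zero_ext F (C : R) : 0 <= C ->
  (forall z, Om z -> `|F z| <= C) -> vanishes_outside F -> integrand (zero_ext Om F).
Proof.
move=> C0 FC F0; exists C, (`|c| + r); split=> //; first by rewrite addr_ge0.
move=> z; split; last exact: zero_ext_support.
by rewrite /zero_ext; case: asboolP => [/FC//|_]; rewrite normr0.
Qed.

Lemma compact_tube_ball : compact [set z : 'rV[R]_m | `|z - c| <= r].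
Proof.
have -> : [set z : 'rV[R]_m | `|z - c| <= r] = (fun x => x + c) @` [set x : 'rV[R]_m | `|x| <= r].
  apply/seteqP; split=> [z /= h|z [x /= h <-]]; last by rewrite addrK.
  by exists (z - c) => //; rewrite subrK.
apply: continuous_compact; last exact: compact_ball_row.
apply: continuous_subspaceT => x; apply: continuousD; [by move=> A; apply|exact: cst_continuous].
Qed.

Lemma tube_ball_in z : `|z - c| <= r -> Om z.
Proof. by move=> h; rewrite /Om -ball_normE /= distrC; exact: le_lt_trans h r_rho. Qed.

Lemma integrand_zero_ext_continuous F : (forall z, Om z -> {for z, continuous F}) ->
  vanishes_outside F -> integrand (zero_ext Om F).
Proof.
move=> Fc F0.
have [C C0 hC] := bounded_on_compact compact_tube_ball (fun z h => Fc z (tube_ball_in h)).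
apply: (integrand_zero_ext C0 _ F0) => z Oz.
by have [/hC//|h] := leP `|z - c| r; rewrite F0 // normr0.
Qed.

Variable I : ('rV[R]_m -> R) -> R.
Hypothesis ID : forall f g, integrand f -> integrand g ->
  I (fun z => f z + g z) = I f + I g.
Hypothesis IZ : forall k f, integrand f -> I (fun z => k * f z) = k * I f.
Hypothesis Ider : forall G (s : R) a, 0 <= s -> (forall z, differentiable G z) ->
      continuous (pd (delta_mx 0 a) G) -> (forall z, s < `|z| -> G z = 0) ->
      I (pd (delta_mx 0 a) G) = 0.

Lemma integrand0 : integrand (fun=> 0 : R) (N := m).
Proof. by exists 0, 0; split=> // z; rewrite normr0. Qed.

Lemma integrandD f g : integrand f -> integrand g -> @integrand R m (fun z => f z + g z).
Proof.
move=> [C [s [C0 s0 fC]]] [D [s' [D0 s'0 gD]]].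
exists (C + D), (s + s'); split; [exact: addr_ge0|exact: addr_ge0|move=> z; split].
  by rewrite (le_trans (ler_normD _ _)) // lerD //; [have [] := fC z|have [] := gD z].
move=> h; rewrite (fC z).2 ?(gD z).2 ?addr0 //.
  by apply: le_lt_trans h; rewrite lerDr.
by apply: le_lt_trans h; rewrite lerDl.
Qed.

Lemma integral0 : I (fun=> 0) = 0.
Proof.
have E : I (fun=> 0 * 0) = 0 * I (fun=> 0) by exact: (IZ 0 integrand0).
by rewrite mulr0 mul0r in E.
Qed.

Lemma integral_sum (J : Type) (s : seq J) (f : J -> 'rV[R]_m -> R) :
  (forall j, integrand (f j)) -> integrand (fun z => \sum_(j <- s) f j z) /\
  I (fun z => \sum_(j <- s) f j z) = \sum_(j <- s) I (f j).
Proof.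
move=> fi; elim: s => [|j s [IH1 IH2]].
  rewrite big_nil (_ : (fun _ => _) = (fun=> 0)); last by apply/funext => z; rewrite big_nil.
  by split; [exact: integrand0|exact: integral0].
rewrite (_ : (fun _ => _) = (fun z => f j z + \sum_(j <- s) f j z)); last first.
  by apply/funext => z; rewrite big_cons.
by split; [exact: integrandD|rewrite ID // IH2 big_cons].
Qed.

(** Component by component, the a-th derivative of a compactly supported C^1 function integrates to
    0. *)
Lemma flat_divergence (Z : 'rV[R]_m -> 'rV[R]_m) :
  (forall a, C1 Om (fun z => Z z 0 a)) -> (forall a, vanishes_outside (fun z => Z z 0 a)) ->
  integrand (zero_ext Om (flat_div Z)) /\ I (zero_ext Om (flat_div Z)) = 0.
Proof.
move=> ZC Z0.
have E : zero_ext Om (flat_div Z) =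
    (fun z => \sum_(a < m) zero_ext Om (pd (delta_mx 0 a) (fun z => Z z 0 a)) z).
  apply/funext => z; rewrite /zero_ext; case: asboolP => // _.
  by rewrite big1.
have i1 a : integrand (zero_ext Om (pd (delta_mx 0 a) (fun z => Z z 0 a))).
  apply: integrand_zero_ext_continuous; last exact: pd_vanishes_outside.
  by move=> z Oz; have [_] := ZC a z Oz; exact.
have [h1 h2] := integral_sum (index_enum _) i1.
rewrite E; split=> //; rewrite h2 big1 // => a _.
rewrite -pd_zero_ext //; apply: (Ider (s := `|c| + r)).
- exact: addr_ge0.
- by move=> z; exact: zero_ext_differentiable.
- rewrite pd_zero_ext //; apply: zero_ext_continuous; last exact: pd_vanishes_outside.
  by move=> z Oz; have [_] := ZC a z Oz; exact.
- by move=> z; exact: zero_ext_support.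
Qed.

End ZeroExtension.

(** * The area functional *)

Section TubeFacts.
Context {R : realType} {n : nat} {M : smooth_manifold R n}.
Variables (X gamma : M -> 'rV[R]_n.+1).
Hypothesis Xc : continuous X.
Hypothesis g1 : forall q, dotp (gamma q) (gamma q) = 1.

Definition tube_ball p (T : tube X gamma p) : set 'rV[R]_n.+1 := ball (X p) (tube_radius T).
Definition tube_normal p (T : tube X gamma p) (z : 'rV[R]_n.+1) := gamma (tube_foot T z).

Lemma gamma_norm q : `|gamma q| <= 1.
Proof.
have := norm_sqr_le_dotp (gamma q); rewrite g1 => h.
by rewrite -(@expr_le1 _ 2).
Qed.

Section OneTube.
Variables (p : M) (T : tube X gamma p).
Let Om := tube_ball T.
Let foot := tube_foot T.
Let dist := tube_dist T.
Let N := tube_normal T.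

Lemma tube_ball_open : open Om. Proof. exact: ball_open. Qed.
Let oOm := tube_ball_open.

Lemma tube_center_in : Om (X p).
Proof. exact: (ballxx _ (tube_radius_gt0 T)). Qed.

Lemma tube_footE z : Om z -> X (foot z) = z - dist z *: N z.
Proof. by move=> /tubeP[_ _ zE]; apply/eqP; rewrite eq_sym subr_eq -zE. Qed.

Lemma tube_foot_sheet z : Om z -> tube_sheet T (foot z).
Proof. by move=> /tubeP[]. Qed.

Lemma tube_sheetE q : tube_sheet T q -> Om (X q) -> foot (X q) = q /\ dist (X q) = 0.
Proof.
move=> sq Oq; have := @tube_unique _ _ _ _ _ _ T q 0 sq.
by rewrite scale0r addr0 normr0; apply => //; exact: tube_height_gt0.
Qed.

Lemma tube_center : foot (X p) = p /\ dist (X p) = 0.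
Proof. by apply: tube_sheetE; [exact: tube_sheet_center|exact: tube_center_in]. Qed.

Lemma tube_dist_derivative z v : Om z -> pd v dist z = dotp (N z) v.
Proof. exact: tube_dist_derive. Qed.

Lemma tube_normal1 z : Om z -> dotp (N z) (N z) = 1.
Proof. by move=> _; exact: g1. Qed.

Lemma tube_dist_continuous z : Om z -> {for z, continuous dist}.
Proof. by move=> Oz; exact: (Ck_continuous (tube_dist_smooth T 0) Oz). Qed.

Lemma tube_comp_continuous (f : M -> R) z : Om z -> continuous f ->
  {for z, continuous (fun y => f (foot y))}.
Proof. by move=> Oz fc A /fc h; exact: (tube_foot_continuous Oz h). Qed.

Lemma C1_dist : C1 Om dist. Proof. exact: (Ck_C1 (tube_dist_smooth T 1)). Qed.

Lemma C1_normal a : C1 Om (fun z => N z 0 a).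
Proof. exact: (Ck_C1 (tube_normal_smooth T 1 a)). Qed.

Lemma C1_foot a : C1 Om (fun z => X (foot z) 0 a).
Proof.
have H : C1 Om (fun z : 'rV[R]_n.+1 => z 0 a - dist z * N z 0 a).
  apply: C1B => //; first exact/Ck_C1/Ck_coord.
  by apply: C1M => //; [exact: C1_dist|exact: C1_normal].
by apply: (C1_ext oOm _ H) => z Oz; rewrite tube_footE // !mxE.
Qed.

Lemma tube_retract z : Om z -> dist z = 0 -> \forall y \near z,
  Om y /\ Om (y - dist y *: N y) /\ dist (y - dist y *: N y) = 0.
Proof.
move=> Oz dz.
have cX : {for z, continuous (fun y => X (foot y))}.
  by apply: (continuous_comp (tube_foot_continuous Oz)); exact: Xc.
have n1 : \forall y \near z, Om (X (foot y)).
  apply: cX; rewrite tube_footE // dz scale0r subr0.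
  exact: open_nbhs_nbhs.
have n2 : \forall y \near z, Om y by exact: open_nbhs_nbhs.
apply: filterS2 n1 n2 => y O1 Oy; rewrite -tube_footE //; split=> //; split=> //.
by have [] := tube_sheetE (tube_foot_sheet Oy) O1.
Qed.

(** Separate q from the foot q1 of [X q] by open sets. A point of the sheet near q is its own foot,
    hence would be near q1 as well. *)
Lemma tube_sheet_closed q : Om (X q) -> ~ tube_sheet T q ->
  \forall q' \near q, ~ tube_sheet T q'.
Proof.
move=> Oq nsq; set q1 := foot (X q).
have sq1 : tube_sheet T q1 by exact: tube_foot_sheet.
have qq1 : q != q1 by apply/eqP => qE; apply: nsq; rewrite qE.
have := @manifold_hausdorff _ _ M; rewrite open_hausdorff => /(_ q q1 qq1).
move=> [[A B] /= [/set_mem Aq /set_mem Bq1] [oA oB AB]].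
have n1 : \forall q' \near q, A q' by exact: open_nbhs_nbhs.
have n2 : \forall q' \near q, Om (X q').
  by apply: Xc; exact: open_nbhs_nbhs.
have n3 : \forall q' \near q, B (foot (X q')).
  have c : {for q, continuous (fun q' => foot (X q'))}.
    by move=> Z /(tube_foot_continuous Oq) h; exact: (@Xc _ _ h).
  by apply: c; exact: open_nbhs_nbhs.
apply: filterS3 n1 n2 n3 => q' Aq' Oq' Bq' sq'.
have [E _] := tube_sheetE sq' Oq'; rewrite E in Bq'.
by have : (A `&` B) q' by []; move/eqP: AB => ->.
Qed.

(** With |X q - X p| < 2 radius8 and heights below radius8, collars stay in the concentric ball of
    half the radius; see [tube_reach]. *)
Definition radius8 := tube_radius T / 8.
Definition center_dist2 q := dotp (X q - X p) (X q - X p).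
(** On the sheet it is 1 for |X q - X p|^2 <= radius8^2 / k, in the Euclidean norm, and 0 beyond
    twice that bound. Other sheets of the immersion through the same ball are ignored. *)
Definition sheet_cutoff (k : R) q : R :=
  if `[< tube_sheet T q >] then plateau (k * (center_dist2 q / radius8 ^+ 2)) else 0.

Lemma radius8_gt0 : 0 < radius8.
Proof. by rewrite divr_gt0 // tube_radius_gt0. Qed.

Lemma center_dist2_norm q : `|X q - X p| ^+ 2 <= center_dist2 q.
Proof. exact: norm_sqr_le_dotp. Qed.

Lemma sheet_cutoff_neq0 k q : 0 < k -> sheet_cutoff k q != 0 ->
  tube_sheet T q /\ center_dist2 q < 2 / k * radius8 ^+ 2.
Proof.
move=> k0; rewrite /sheet_cutoff; case: asboolP => [sq|_]; last by rewrite eqxx.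
move=> h; split=> //; rewrite ltNge; apply/negP => le; move/eqP: h; apply.
have r0 : 0 < radius8 ^+ 2 by rewrite exprn_gt0 // radius8_gt0.
by apply: plateau0; rewrite mulrC -ler_pdivrMr // ler_pdivlMr.
Qed.

Lemma sheet_cutoff1 k q : 0 < k -> tube_sheet T q ->
  center_dist2 q <= k^-1 * radius8 ^+ 2 -> sheet_cutoff k q = 1.
Proof.
move=> k0 sq le; rewrite /sheet_cutoff; case: asboolP => // _.
have r0 : 0 < radius8 ^+ 2 by rewrite exprn_gt0 // radius8_gt0.
by apply: plateau1; rewrite -ler_pdivlMl // mulr1 ler_pdivrMr.
Qed.

Lemma sheet_cutoff_ge0 k q : 0 <= sheet_cutoff k q.
Proof. by rewrite /sheet_cutoff; case: asboolP => // _; exact: plateau_ge0. Qed.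

Lemma sheet_cutoff_le1 k q : sheet_cutoff k q <= 1.
Proof. by rewrite /sheet_cutoff; case: asboolP => // _; exact: plateau_le1. Qed.

Lemma near_center_small q (b : R) : b <= 2 * radius8 -> `|X q - X p| < b -> Om (X q).
Proof.
move=> b2 h; rewrite /Om /tube_ball -ball_normE /= distrC; apply: (lt_le_trans h).
by apply: (le_trans b2); have := tube_radius_gt0 T; rewrite /radius8; lra.
Qed.

Lemma wide_norm q : center_dist2 q < 2 * radius8 ^+ 2 -> `|X q - X p| < 2 * radius8.
Proof.
move=> h; have r0 := radius8_gt0.
rewrite -(@ltr_pXn2r _ 2) ?nnegrE ?mulr_ge0 // ?(ltW r0) //.
apply: (le_lt_trans (center_dist2_norm q)); apply: (lt_le_trans h).
have a0 := sqr_ge0 (radius8); have -> : (2 * radius8) ^+ 2 = 4 * radius8 ^+ 2 by ring.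
  by lra.
exact: ltW (tube_radius_gt0 T).
Qed.

Lemma tube_reach q (s : R) : center_dist2 q < 2 * radius8 ^+ 2 -> `|s| < radius8 ->
  `|X q + s *: gamma q - X p| <= tube_radius T / 2.
Proof.
move=> /wide_norm h1 h2; rewrite addrAC (le_trans (ler_normD _ _)) //.
have h3 : `|s *: gamma q| <= radius8.
  rewrite normrZ -[leRHS]mulr1; apply: ler_pM => //; [exact: ltW|exact: gamma_norm].
have -> : tube_radius T / 2 = 2 * radius8 + 2 * radius8 by rewrite /radius8; field.
by apply: lerD; [exact: ltW|apply: (le_trans h3); have := radius8_gt0; lra].
Qed.

End OneTube.

(** Regularity on M is tested on the extension that is constant along normals, so that tangential
    derivatives are Euclidean ones. *)
Definition C1T (f : M -> R) := forall p (T : tube X gamma p),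
  C1 (tube_ball T) (fun z => f (tube_foot T z)).

(** Near [X q] the foot and the height given by T are admissible for T' by continuity; uniqueness in
    T' concludes. *)
Lemma tube_agree p p' (T : tube X gamma p) (T' : tube X gamma p') q :
  tube_sheet T q -> tube_ball T (X q) -> tube_sheet T' q -> tube_ball T' (X q) ->
  \forall z \near X q, tube_foot T z = tube_foot T' z /\ tube_dist T z = tube_dist T' z.
Proof.
move=> sq Oq sq' Oq'.
have [fq dq] := tube_sheetE sq Oq.
have n1 : \forall z \near X q, tube_ball T z by apply: open_nbhs_nbhs; split=> //; exact: tube_ball_open.
have n2 : \forall z \near X q, tube_ball T' z by apply: open_nbhs_nbhs; split=> //; exact: tube_ball_open.
have n3 : \forall z \near X q, tube_sheet T' (tube_foot T z).
  apply: (tube_foot_continuous Oq); rewrite fq; apply: open_nbhs_nbhs; split=> //.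
  exact: tube_sheet_open.
have n4 : \forall z \near X q, `|tube_dist T z| < tube_height T'.
  move: (tube_dist_continuous Oq) => /cvgrPdist_lt/(_ _ (tube_height_gt0 T')).
  by apply: filterS => z /=; rewrite dq sub0r normrN.
have n34 : \forall z \near X q, tube_sheet T' (tube_foot T z) /\ `|tube_dist T z| < tube_height T'.
  by apply: filterI.
apply: filterS3 n1 n2 n34 => z O1 O2 [s3 h4].
have [_ _ zE] := tubeP O1.
have h := tube_unique s3 h4; rewrite -zE in h.
by have [h1 h2] := h O2; split; [exact: esym h1|exact: esym h2].
Qed.

(** Near a point of the sheet the formula is C^1. Near a point q off the sheet the cut-off vanishes:
    either [X q] is in the ball and the complement of the sheet is a neighbourhood of q, or [X q] is
    farther than the support of the plateau. *)
Lemma sheet_cutoff_C1T p (T : tube X gamma p) k : 1 <= k -> C1T (sheet_cutoff T k).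
Proof.
move=> k1 p' T'; apply: C1_near => z Oz; set q := tube_foot T' z.
have cf := tube_foot_continuous Oz.
have oT' := @tube_ball_open p' T'.
have [sq|nsq] := pselect (tube_sheet T q).
  pose U' := [set y | tube_ball T' y /\ tube_sheet T (tube_foot T' y)].
  exists U', (fun y => plateau (k * ((\sum_(a < n.+1) (X (tube_foot T' y) 0 a - X p 0 a) *
     (X (tube_foot T' y) 0 a - X p 0 a)) / radius8 T ^+ 2))).
  have oU' : open U'.
    rewrite openE => y [Oy sy]; apply: filterI; first exact: open_nbhs_nbhs.
    by apply: (tube_foot_continuous Oy); apply: open_nbhs_nbhs; split=> //; exact: tube_sheet_open.
  split=> //.
    apply: C1_plateau => //; apply: C1Z => //; apply: C1M => //; last exact: C1_cst.
    have H a : C1 U' (fun y => X (tube_foot T' y) 0 a - X p 0 a).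
      apply: C1B => //; last exact: C1_cst.
      have CF : C1 (tube_ball T') (fun y => X (tube_foot T' y) 0 a) by exact: C1_foot.
      by apply: (C1_subset _ CF) => y [].
    by apply: C1_sum => // a; apply: C1M.
  move=> y [Oy sy]; rewrite /sheet_cutoff; case: asboolP => // _.
  have -> // : center_dist2 p (tube_foot T' y) = \sum_(a < n.+1) (X (tube_foot T' y) 0 a - X p 0 a) *
     (X (tube_foot T' y) 0 a - X p 0 a).
  by rewrite /center_dist2 dotpE; apply: eq_bigr => a _; rewrite !mxE.
have n0 : \forall q' \near q, sheet_cutoff T k q' = 0.
  have [Oq|nOq] := pselect (tube_ball T (X q)).
    apply: filterS (tube_sheet_closed Oq nsq) => q' nsq'.
    by rewrite /sheet_cutoff; case: asboolP.
  have r0 := radius8_gt0 T.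
  have far : 2 * radius8 T < `|X q - X p|.
    move: nOq; rewrite /tube_ball -ball_normE /= distrC => /negP; rewrite -leNgt.
    by apply: lt_le_trans; have := tube_radius_gt0 T; rewrite /radius8; lra.
  have : \forall q' \near q, 2 * radius8 T < `|X q' - X p|.
    have h := open_nbhs_nbhs (conj (@open_far R n.+1 (X p) (2 * radius8 T)) far).
    exact: (@Xc q _ h).
  apply: filterS => q' h; apply/eqP; apply/negPn/negP => /(sheet_cutoff_neq0 (lt_le_trans ltr01 k1))[_ h'].
  have := center_dist2_norm p q'; rewrite leNgt => /negP; apply.
  apply: (lt_le_trans h'); apply: (@le_trans _ _ ((2 * radius8 T) ^+ 2)).
    have a0 := sqr_ge0 (radius8 T); have -> : (2 * radius8 T) ^+ 2 = 4 * radius8 T ^+ 2 by ring.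
    apply: ler_pM => //; first by rewrite divr_ge0 // (le_trans ler01).
    by rewrite ler_pdivrMr ?(lt_le_trans ltr01) //; lra.
  apply: lerXn2r; [|exact: normr_ge0|exact: ltW].
    by apply: mulr_ge0 => //; exact: ltW.
have n1 : \forall y \near z, sheet_cutoff T k (tube_foot T' y) = 0 by exact: (cf _ n0).
exists ([set y | sheet_cutoff T k (tube_foot T' y) = 0]°), (fun=> 0); split.
- exact: open_interior.
- exact: n1.
- exact: C1_cst.
- by move=> y /interior_subset.
Qed.

Lemma tube_continuous (f : M -> R) p (T : tube X gamma p) :
  {for X p, continuous (fun z => f (tube_foot T z))} -> {for p, continuous f}.
Proof.
move=> fc; apply: (@near_eq_continuous _ _ (fun q => f (tube_foot T (X q)))).
  have n1 : \forall q \near p, tube_sheet T q.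
    by apply: open_nbhs_nbhs; split; [exact: tube_sheet_open|exact: tube_sheet_center].
  have n2 : \forall q \near p, tube_ball T (X q).
    by apply: Xc; apply: open_nbhs_nbhs; split; [exact: tube_ball_open|exact: tube_center_in].
  by apply: filterS2 n1 n2 => q sq Oq; have [->] := tube_sheetE sq Oq.
by move=> A /fc h; exact: (@Xc _ _ h).
Qed.

Variable TB : forall p, tube X gamma p.

Lemma C1T_continuous f : C1T f -> continuous f.
Proof.
by move=> fC p; apply: (tube_continuous (T := TB p)); exact: (C1_continuous (fC p (TB p)) (tube_center_in _)).
Qed.

Lemma center_dist2_continuous p : continuous (@center_dist2 p).
Proof.
have -> : @center_dist2 p = (fun q => \sum_(a < n.+1) (X q 0 a - X p 0 a) * (X q 0 a - X p 0 a)).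
  by apply/funext => q; rewrite /center_dist2 dotpE; apply: eq_bigr => a _; rewrite !mxE.
apply: C1T_continuous => p' T'; have oT' := @tube_ball_open p' T'.
apply: C1_sum => // a.
have H : C1 (tube_ball T') (fun z => X (tube_foot T' z) 0 a - X p 0 a).
  by apply: C1B => //; [exact: C1_foot|exact: C1_cst].
exact: C1M.
Qed.

(** The parameter 2 places its support where [sheet_cutoff] with parameter 1 equals 1, so that the
    latter dominates, up to a constant, its product with any continuous function. *)
Definition cover_cutoff p q := sheet_cutoff (TB p) 2 q.

(** Replaces a partition of unity. In f = f chi_p + f (1 - chi_p) the first summand is local and the
    second vanishes wherever chi_p = 1; after finitely many p covering K nothing remains. F is a
    class stable under the factors 1 - chi_p, Q the property to be proved. *)
Lemma local_induction (Q F : (M -> R) -> Prop) :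
  Q (fun=> 0) -> (forall f g, Q f -> Q g -> Q (fun q => f q + g q)) ->
  (forall p f, F f -> F (fun q => f q * (1 - cover_cutoff p q))) ->
  (forall p f, F f -> Q (fun q => f q * cover_cutoff p q)) ->
  forall f (K : set M), compact K -> (forall q, f q != 0 -> K q) -> F f -> Q f.
Proof.
move=> Q0 QD F1 Qloc f K cK fK Ff.
have [s hs] : exists s : seq M, forall q, K q -> exists2 p, p \in s & cover_cutoff p q = 1.
  have nearone p : \forall q \near p, cover_cutoff p q = 1.
    have c2 := @center_dist2_continuous p p.
    have r0 : 0 < 2^-1 * radius8 (TB p) ^+ 2 by rewrite mulr_gt0 ?exprn_gt0 ?radius8_gt0.
    have n1 : \forall q \near p, @center_dist2 p q < 2^-1 * radius8 (TB p) ^+ 2.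
      apply: (cvgr_lt _ c2); rewrite /center_dist2 subrr dotp0l //.
    have n2 : \forall q \near p, tube_sheet (TB p) q.
      by apply: open_nbhs_nbhs; split; [exact: tube_sheet_open|exact: tube_sheet_center].
    by apply: filterS2 n1 n2 => q h sq; apply: sheet_cutoff1 => //; exact: ltW.
  pose P (s : seq M) (q : M) := exists2 p, p \in s & cover_cutoff p q = 1.
  (* Finite sets of centres ordered by inclusion generate a filter, which lets
     [compact_near_coveringP] extract a finite cover. *)
  pose Fs : set_system (seq M) := fun A => exists s0 : seq M, forall s, {subset s0 <= s} -> A s.
  have FsF : Filter Fs.
    split; first by exists [::].
    - move=> A B [s1 h1] [s2 h2]; exists (s1 ++ s2) => s hs; split.
        by apply: h1 => x xs; apply: hs; rewrite mem_cat xs.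
      by apply: h2 => x xs; apply: hs; rewrite mem_cat xs orbT.
    - by move=> A B AB [s1 h1]; exists s1 => s /h1/AB.
  have /compact_near_coveringP cK' := cK.
  have [s hs] : \forall s \near Fs, K `<=` P s.
    apply: (cK' _ Fs P FsF) => p Kp.
    exists ([set q | cover_cutoff p q = 1], (fun s : seq M => is_true (p \in s))).
      by split; [exact: nearone|exists [:: p] => s; apply; rewrite inE].
    by move=> [q s'] /= [h1 h2]; exists p.
  by exists s => q Kq; exact: (hs s (fun _ => id) q Kq).
have {}hs q : f q != 0 -> exists2 p, p \in s & cover_cutoff p q = 1 by move=> /fK/hs.
clear fK; elim: s f Ff hs => [|p s IH] f Ff hs.
  rewrite (_ : f = fun=> 0) //; apply/funext => q; apply/eqP; apply/negPn/negP.
  by move=> /hs[].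
have -> : f = (fun q => f q * cover_cutoff p q + f q * (1 - cover_cutoff p q)).
  by apply/funext => q; ring.
apply: QD; first exact: Qloc.
apply: IH; first exact: F1.
move=> q; rewrite mulf_eq0 negb_or => /andP[fq].
rewrite subr_eq0 => pq; have [p' ] := hs q fq.
rewrite inE => /orP[/eqP->|p's] p'1; last by exists p'.
by rewrite p'1 eqxx in pq.
Qed.

End TubeFacts.

Lemma sum_continuous {R : realType} {S : topologicalType} m (F : 'I_m -> S -> R) x :
  (forall i, {for x, continuous (F i)}) -> {for x, continuous (fun y => \sum_i F i y)}.
Proof.
move=> Fc; elim: (index_enum _) => [|i r IH].
  rewrite (_ : (fun y => _) = cst 0); first exact: cst_continuous.
  by apply/funext => y; rewrite big_nil.
rewrite (_ : (fun y => _) = (fun y => F i y + \sum_(j <- r) F j y)); last first.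
  by apply/funext => y; rewrite big_cons.
exact: (@continuousD _ _ _ (F i) (fun y => \sum_(j <- r) F j y) x (Fc i) IH).
Qed.

Section Divergence.
Context {R : realType} {m : nat}.
Implicit Types (f : 'rV[R]_m -> R) (Z : 'rV[R]_m -> 'rV[R]_m) (U : set 'rV[R]_m).

Lemma pd_basis (v : 'rV[R]_m) f z : differentiable f z ->
  pd v f z = \sum_a v 0 a * pd (delta_mx 0 a) f z.
Proof.
move=> df; rewrite {1}(row_sum_delta v).
elim: (index_enum _) => [|a r IH].
  rewrite !big_nil -(scale0r (0 : 'rV[R]_m)) (pd_linZ _ _ df).
  by rewrite mul0r.
by rewrite !big_cons (pd_linD _ _ df) (pd_linZ _ _ df) IH.
Qed.

Lemma flat_divM f Z z : differentiable f z ->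
  (forall a, differentiable (fun y : 'rV[R]_m => Z y 0 a) z) ->
  flat_div (fun y => f y *: Z y) z = pd (Z z) f z + f z * flat_div Z z.
Proof.
move=> df dZ; rewrite (pd_basis _ df) /flat_div mulr_sumr -big_split /=.
apply: eq_bigr => a _.
rewrite (_ : (fun y : 'rV[R]_m => _) = (fun y => f y * Z y 0 a)); last first.
  by apply/funext => y; rewrite mxE.
by rewrite (pdM _ df (dZ a)) mulrC.
Qed.

Lemma flat_div_continuous Z U z : U z -> (forall a, C1 U (fun y => Z y 0 a)) ->
  {for z, continuous (flat_div Z)}.
Proof. by move=> Uz ZC; apply: sum_continuous => a; have [_] := ZC a z Uz; exact. Qed.

Lemma pd_line_cst (v : 'rV[R]_m) f z :
  (\forall h \near (0 : R), f (h *: v + z) = f z) -> pd v f z = 0.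
Proof.
move=> h; rewrite pdxE /derive; apply: cvg_lim => //; apply: cvg_near_cst.
apply: nbhs_dnbhs; apply: filterS h => h /= ->.
by rewrite subrr scaler0.
Qed.

End Divergence.

(** * Integration over the hypersurface through thin collars *)

Section Functional.
Context {R : realType} {n : nat} {M : smooth_manifold R n}.
Variables (X gamma : M -> 'rV[R]_n.+1).
Hypothesis Xc : continuous X.
Hypothesis g1 : forall q, dotp (gamma q) (gamma q) = 1.
Variable I : ('rV[R]_n.+1 -> R) -> R.
Hypothesis ID : forall f g, integrand f -> integrand g ->
  I (fun z => f z + g z) = I f + I g.
Hypothesis IZ : forall k f, integrand f -> I (fun z => k * f z) = k * I f.
Hypothesis Ige0 : forall f, integrand f -> (forall z, 0 <= f z) -> 0 <= I f.
Hypothesis Igt0 : forall f z0 (c d : R), integrand f -> (forall z, 0 <= f z) -> 0 < c ->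
  0 < d -> (forall z, `|z - z0| < d -> c <= f z) -> 0 < I f.
Hypothesis Ider : forall G (s : R) a, 0 <= s -> (forall z, differentiable G z) ->
      continuous (pd (delta_mx 0 a) G) -> (forall z, s < `|z| -> G z = 0) ->
      I (pd (delta_mx 0 a) G) = 0.

(* [push eps f] spreads [f] over the one-sided collar of width [eps], along the normals; its
   integral divided by [eps] approximates the area integral of [f]. *)
Definition kernel (eps : R) (q : M) (z : 'rV[R]_n.+1) : R :=
  let tau := dotp (z - X q) (gamma q) in
  if z == X q + tau *: gamma q then bump (tau / eps) else 0.

Definition push (eps : R) (f : M -> R) (z : 'rV[R]_n.+1) : R :=
  \sum_(q \in [set: M]) (f q * kernel eps q z).

Lemma kernel_line eps q (s : R) : kernel eps q (X q + s *: gamma q) = bump (s / eps).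
Proof. by rewrite /kernel [X q + _]addrC addrK dotpZl g1 mulr1 addrC eqxx. Qed.

Lemma kernel_neq0 eps q z : 0 < eps -> kernel eps q z != 0 ->
  exists2 s : R, 0 < s < eps & z = X q + s *: gamma q.
Proof.
move=> e0; rewrite /kernel; case: (z =P _) => [zE|_]; last by rewrite eqxx.
set s := dotp _ _ in zE * => b0; exists s => //.
have [h|h] := leP s 0; first by rewrite bump_neg ?eqxx // pmulr_lle0 ?invr_gt0 in b0.
have [h'|h'] := leP eps s; first by rewrite bump_large ?eqxx // ler_pdivlMr ?mul1r in b0.
by [].
Qed.

Lemma kernel_ge0 eps q z : 0 <= kernel eps q z.
Proof. by rewrite /kernel; case: ifP => // _; exact: bump_ge0. Qed.

Lemma I_le f g : integrand f -> integrand g -> (forall z, f z <= g z) -> I f <= I g.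
Proof.
move=> fi gi fg.
have ni : integrand (fun z => -1 * f z).
  move: fi => [C [s [C0 s0 h]]]; exists C, s; split=> // z; have [h1 h2] := h z.
  by split; [rewrite mulN1r normrN|move=> /h2 ->; rewrite mulr0].
have di : integrand (fun z => g z + -1 * f z) by exact: integrandD.
have := Ige0 di; rewrite ID // IZ // mulN1r subr_ge0; apply => z.
by rewrite mulN1r subr_ge0.
Qed.

Lemma integrandZ (k : R) f : integrand f -> @integrand R n.+1 (fun z => k * f z).
Proof.
move=> [C [s [C0 s0 h]]]; exists (`|k| * C), s; split=> //; first exact: mulr_ge0.
move=> z; have [h1 h2] := h z; split; first by rewrite normrM ler_wpM2l.
by move=> /h2 ->; rewrite mulr0.
Qed.

Section InTube.
Variables (p : M) (T : tube X gamma p).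
Let Om := tube_ball T.
Let foot := tube_foot T.
Let dist := tube_dist T.
Let N := tube_normal T.
Let oOm : open Om := tube_ball_open (T := T).
Let r := tube_radius T / 2.
Let r0 : 0 <= r. Proof. by rewrite divr_ge0 // ltW // tube_radius_gt0. Qed.
Let r_lt : r < tube_radius T.
Proof. by have := tube_radius_gt0 T; rewrite /r; lra. Qed.

Definition wide (f : M -> R) := forall q, f q != 0 ->
  tube_sheet T q /\ center_dist2 X p q < 2 * radius8 T ^+ 2.

Definition vanishes F := vanishes_outside (X p) (tube_radius T) r F.

Lemma wide_far f z : wide f -> Om z -> r < `|z - X p| -> f (foot z) != 0 ->
  radius8 T <= `|dist z|.
Proof.
move=> fw Oz rz /fw[_ h]; rewrite leNgt; apply/negP => h'.
have [_ _ zE] := tubeP Oz.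
have := tube_reach (T := T) g1 h h'.
by rewrite -zE leNgt rz.
Qed.

Lemma wide_vanishes f (g : R -> R) : wide f -> (forall t, radius8 T <= `|t| -> g t = 0) ->
  vanishes (fun z => f (foot z) * g (dist z)).
Proof.
move=> fw g0 z Oz rz; have [->|h] := eqVneq (f (foot z)) 0; first by rewrite mul0r.
by rewrite g0 ?mulr0 //; exact: (wide_far fw Oz rz h).
Qed.

Lemma bump_far (eps t : R) : 0 < eps -> eps <= radius8 T -> radius8 T <= `|t| ->
  bump (t / eps) = 0.
Proof.
move=> e0 er rt; have [h|h] := leP t 0; first by rewrite bump_neg // pmulr_lle0 ?invr_gt0.
by apply: bump_large; rewrite ler_pdivlMr // mul1r (le_trans er) // -(gtr0_norm h).
Qed.

Lemma push_wide_support f eps z q : wide f -> 0 < eps -> eps <= radius8 T ->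
  eps <= tube_height T -> f q * kernel eps q z != 0 -> Om z /\ q = foot z.
Proof.
move=> fw e0 er eh; rewrite mulf_eq0 negb_or => /andP[/fw[sq cq]] /(kernel_neq0 e0)[s /andP[s0 se] zE].
have ns : `|s| = s by exact: gtr0_norm.
have Oz : Om z.
  rewrite zE; apply: (tube_ball_in r_lt); apply: (tube_reach (T := T) g1 cq).
  by rewrite ns (lt_le_trans se).
split=> //; have sh : `|s| < tube_height T by rewrite ns (lt_le_trans se).
have := tube_unique sq sh; rewrite -zE => /(_ Oz)[fz _]; exact: esym fz.
Qed.

(** For f supported in one sheet, the foot of z is the only possible term of the sum over M: the
    push-forward becomes explicit in Fermi coordinates. *)
Lemma push_wide f eps : wide f -> 0 < eps -> eps <= radius8 T -> eps <= tube_height T ->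
  push eps f = zero_ext Om (fun z => f (foot z) * bump (dist z / eps)).
Proof.
move=> fw e0 er eh; apply/funext => z; rewrite /zero_ext; case: asboolP => [Oz|nOz].
  rewrite /push -(@fsbig_widen _ _ _ _ [set foot z]) //=; last first.
    move=> q [_ /= qz]; apply/eqP; apply/negPn/negP.
    by move=> /(push_wide_support fw e0 er eh)[_ /qz].
  rewrite fsbig_set1; have [_ _ zE] := tubeP Oz.
  have <- : kernel eps (foot z) (X (tube_foot T z) + tube_dist T z *: gamma (tube_foot T z)) =
    bump (dist z / eps) by exact: kernel_line.
  by rewrite -zE.
apply: fsbig1 => q _; apply/eqP; apply/negPn/negP.
by move=> /(push_wide_support fw e0 er eh)[].
Qed.

Lemma C1_scaled (eps : R) : C1 Om (fun z => dist z / eps).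
Proof. by apply: C1M => //; [exact: C1_dist|exact: C1_cst]. Qed.

Lemma C1_height (h : R) : C1 Om (fun z => h - dist z).
Proof. by apply: C1B => //; [exact: C1_cst|exact: C1_dist]. Qed.

Lemma tube_div_continuous z : Om z -> {for z, continuous (flat_div N)}.
Proof. by move=> Oz; apply: (flat_div_continuous Oz) => a; exact: C1_normal. Qed.

Lemma pd_normal_comp (f : M -> R) z : Om z -> pd (N z) (fun y => f (foot y)) z = 0.
Proof.
move=> Oz; apply: pd_line_cst.
have [sz hz zE] := tubeP Oz.
have c0 : {for (0 : R), continuous (fun h : R => h *: N z + z)}.
  apply: (@continuousD _ _ _ (fun h : R => h *: N z) (fun=> z)); last exact: cst_continuous.
  exact: scalel_continuous.
have n1 : \forall h \near (0 : R), Om (h *: N z + z).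
  by apply: c0; rewrite scale0r add0r; exact: open_nbhs_nbhs.
have n2 : \forall h \near (0 : R), `|dist z + h| < tube_height T.
  have c1 : {for (0 : R), continuous (fun h : R => `|dist z + h|)}.
    apply: (@continuous_comp _ _ _ (fun h : R => dist z + h) (fun h : R => `|h|)).
      by apply: (@continuousD _ _ _ (fun=> dist z) id); [exact: cst_continuous|by move=> A; apply].
    exact: norm_continuous.
  by apply: (cvgr_lt _ c1); rewrite addr0.
apply: filterS2 n1 n2 => h Oh hh.
have E : h *: N z + z = X (foot z) + (dist z + h) *: gamma (foot z).
  by rewrite {2}zE scalerDl addrC addrA.
by congr f; have := tube_unique sz hh; rewrite -E => /(_ Oh)[].
Qed.

Section Collar.
Variables (B : M -> R) (h : R).
Hypotheses (Bw : wide B) (BC : C1 Om (fun z => B (foot z))).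
Hypotheses (h0 : 0 < h) (hr : h <= radius8 T).

Definition collar_weight eps z := B (foot z) * bump (dist z / eps).
Definition collar_source eps z := collar_weight eps z * pospow 2 (h - dist z).
Definition collar_flux eps z := B (foot z) * (step (dist z / eps) *
  (2 * pospow 1 (h - dist z) - pospow 2 (h - dist z) * flat_div N z)).

Lemma flux_far eps t : 0 < eps -> radius8 T <= `|t| -> step (t / eps) * pospow 1 (h - t) = 0.
Proof.
move=> e0 rt; have [t0|t0] := leP t 0.
  by rewrite step_neg ?mul0r // pmulr_lle0 ?invr_gt0.
by rewrite (@pospow_neg R 0) ?mulr0 // subr_le0 (le_trans hr) // -(gtr0_norm t0).
Qed.

Lemma pospow_split x : pospow 2 x = pospow 1 x * pospow 1 x :> R.
Proof. by []. Qed.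

Lemma flux_factor eps z : collar_flux eps z = B (foot z) *
  ((fun t => step (t / eps) * pospow 1 (h - t)) (dist z)) *
  (2 - pospow 1 (h - dist z) * flat_div N z).
Proof. by rewrite /collar_flux pospow_split; ring. Qed.

(* The divergence of [B * step (t / eps) * (h - t)_+^2 * N]: it expresses the volume of the collar
   divided by [eps] through an integral that is bounded, and bounded away from 0, as [eps] tends
   to 0. *)
Lemma collar_identity eps : 0 < eps -> eps <= radius8 T ->
  [/\ integrand (zero_ext Om (collar_source eps)), integrand (zero_ext Om (collar_flux eps)) &
    eps^-1 * I (zero_ext Om (collar_source eps)) = I (zero_ext Om (collar_flux eps))].
Proof.
move=> e0 er.
have Bc z : Om z -> {for z, continuous (fun z => B (foot z))}.
  by move=> Oz; exact: (C1_continuous BC Oz).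
have hc z : Om z -> {for z, continuous (fun z => h - dist z)}.
  by move=> Oz; exact: (C1_continuous (C1_height h) Oz).
have CP2 : C1 Om (fun z => pospow 2 (h - dist z)) by apply: C1_pospow => //; exact: C1_height.
have Cs : C1 Om (fun z => step (dist z / eps)) by apply: C1_step => //; exact: C1_scaled.
have p1 z : Om z -> {for z, continuous (fun z => pospow 1 (h - dist z))}.
  move=> Oz; apply: (@continuous_comp _ _ _ (fun z => h - dist z) (pospow 1)); first exact: hc.
  exact: pospow_continuous.
have si : integrand (zero_ext Om (collar_source eps)).
  apply: (integrand_zero_ext_continuous r0 r_lt) => [z Oz|].
    apply: (C1_continuous (U := Om) _ Oz); apply: C1M => //; apply: C1M => //.
    by apply: C1_bump => //; exact: C1_scaled.
  move=> z Oz rz; rewrite /collar_source /collar_weight.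
  rewrite (wide_vanishes (g := fun t => bump (t / eps)) Bw _ Oz rz) ?mul0r // => t.
  exact: bump_far.
have fi : integrand (zero_ext Om (collar_flux eps)).
  apply: (integrand_zero_ext_continuous r0 r_lt) => [z Oz|].
    apply: (@continuousM _ _ (fun z => B (foot z))); first exact: Bc.
    apply: (@continuousM _ _ (fun z => step (dist z / eps))); first exact: (C1_continuous Cs Oz).
    apply: (@continuousB _ _ _ (fun z => 2 * pospow 1 (h - dist z))).
      by apply: (@continuousM _ _ (fun=> 2)); [exact: cst_continuous|exact: p1].
    apply: (@continuousM _ _ (fun z => pospow 2 (h - dist z))); first exact: (C1_continuous CP2 Oz).
    exact: tube_div_continuous.
  move=> z Oz rz; rewrite flux_factor.
  rewrite (wide_vanishes (g := fun t => step (t / eps) * pospow 1 (h - t)) Bw _ Oz rz) ?mul0r // => t.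
  exact: flux_far.
split=> //.
pose F z := B (foot z) * (step (dist z / eps) * pospow 2 (h - dist z)).
have FC : C1 Om F by apply: C1M => //; exact: C1M.
have F0 : vanishes F.
  apply: (wide_vanishes (g := fun t => step (t / eps) * pospow 2 (h - t)) Bw) => t rt.
  by rewrite pospow_split mulrA flux_far // mul0r.
have [] := @flat_divergence R n.+1 (X p) (tube_radius T) r r0 r_lt I ID IZ Ider
   (fun z => F z *: N z).
- move=> a; apply: (C1_ext oOm (f := fun z => F z * N z 0 a)) => [z _|]; first by rewrite mxE.
  by apply: C1M => //; exact: C1_normal.
- by move=> a z Oz rz; rewrite mxE F0 // mul0r.
move=> _ E0.
have dE z : Om z -> flat_div (fun z => F z *: N z) z =
    eps^-1 * collar_source eps z + -1 * collar_flux eps z.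
  move=> Oz.
  have dd : differentiable dist z by have [] := C1_dist Oz.
  have dF : differentiable F z by have [] := FC z Oz.
  have dB : differentiable (fun z => B (foot z)) z by have [] := BC Oz.
  have ds : differentiable (fun z => step (dist z / eps)) z by have [] := Cs z Oz.
  have d2 : differentiable (fun z => pospow 2 (h - dist z)) z by have [] := CP2 z Oz.
  have dse : differentiable (fun z => dist z / eps) z by have [] := C1_scaled eps Oz.
  have dhe : differentiable (fun z => h - dist z) z by have [] := C1_height h Oz.
  have dc : differentiable (fun=> eps^-1 : R) z by exact: differentiable_cst.
  have dh : differentiable (fun=> h : R) z by exact: differentiable_cst.
  have pdd : pd (N z) dist z = 1 by rewrite tube_dist_derivative // tube_normal1.
  rewrite flat_divM //; last by move=> a; have [] := C1_normal a Oz.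
  have -> : pd (N z) F z = B (foot z) *
      (bump (dist z / eps) / eps * pospow 2 (h - dist z) -
       step (dist z / eps) * (2 * pospow 1 (h - dist z))).
    rewrite (pdM _ dB (differentiableM ds d2)) pd_normal_comp // mul0r add0r; congr (_ * _).
    rewrite (pdM _ ds d2) (pd_comp1 _ (is_derive_step _) dse) (pd_comp1 _ (is_derive_pospow 0 _) dhe).
    rewrite (pdM _ dd dc) (pdB _ dh dd) !pd_cst pdd.
    by ring.
  by rewrite /collar_source /collar_flux /collar_weight /F; ring.
have E1 : zero_ext Om (flat_div (fun z => F z *: N z)) =
   (fun z => eps^-1 * zero_ext Om (collar_source eps) z + -1 * zero_ext Om (collar_flux eps) z).
  apply/funext => z; rewrite /zero_ext; case: asboolP => [/dE//|_].
  by rewrite !mulr0 addr0.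
move: E0; rewrite -/(tube_ball T) -/Om E1 ID; [|exact: integrandZ|exact: integrandZ].
by rewrite !IZ // mulN1r => /eqP; rewrite subr_eq0 => /eqP.
Qed.

Lemma weight_integrand eps : 0 < eps -> eps <= radius8 T ->
  integrand (zero_ext Om (collar_weight eps)).
Proof.
move=> e0 er; apply: (integrand_zero_ext_continuous r0 r_lt) => [z Oz|].
  apply: (C1_continuous (U := Om) _ Oz); apply: C1M => //.
  by apply: C1_bump => //; exact: C1_scaled.
by apply: (wide_vanishes (g := fun t => bump (t / eps)) Bw) => t; exact: bump_far.
Qed.

Hypothesis B01 : forall q, 0 <= B q <= 1.

Lemma weight_ge0 eps z : 0 <= collar_weight eps z.
Proof. by have /andP[B0 _] := B01 (foot z); rewrite mulr_ge0 // bump_ge0. Qed.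

(** Where [bump (t / eps)] is not 0 one has 0 < t < eps, so (h - t)_+^2 is at most h^2, and at least
    (h / 2)^2 if eps <= h / 2. *)
Lemma source_bounds eps z : 0 < eps ->
  (eps <= h / 2 -> (h / 2) ^+ 2 * collar_weight eps z <= collar_source eps z) /\
  collar_source eps z <= h ^+ 2 * collar_weight eps z.
Proof.
move=> e0; rewrite /collar_source; have w0 := weight_ge0 eps z.
have [->|wn] := eqVneq (collar_weight eps z) 0; first by rewrite !mulr0 !mul0r.
have bn : bump (dist z / eps) != 0.
  by move: wn; rewrite /collar_weight mulf_eq0 negb_or => /andP[].
have t0 : 0 < dist z.
  rewrite ltNge; apply/negP => t0; move/eqP: bn; apply.
  by rewrite bump_neg // pmulr_lle0 ?invr_gt0.
have te : dist z < eps.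
  rewrite ltNge; apply/negP => te; move/eqP: bn; apply.
  by rewrite bump_large // ler_pdivlMr // mul1r.
rewrite ![_ * collar_weight _ _]mulrC; split=> [eh|].
  apply: ler_wpM2l => //; rewrite pospow_pos; last by have := h0; lra.
  by apply: lerXn2r; rewrite ?nnegrE; have := h0; lra.
apply: ler_wpM2l => //; apply: lerXn2r; rewrite ?nnegrE ?le_max ?lexx ?(ltW h0) //.
by rewrite ge_max (ltW h0) /=; lra.
Qed.

Lemma flux_profile eps t : 0 < eps ->
  step (t / eps) * pospow 1 (h - t) = 0 \/ [/\ 0 < t, 0 <= pospow 1 (h - t) <= h &
  0 <= step (t / eps) * pospow 1 (h - t) <= h].
Proof.
move=> e0; have [t0|t0] := leP t 0.
  by left; rewrite step_neg ?mul0r // pmulr_lle0 ?invr_gt0.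
right; have p0 : 0 <= pospow 1 (h - t) by exact: pospow_ge0.
have p1 : pospow 1 (h - t) <= h by rewrite /pospow expr1 ge_max (ltW h0) /=; lra.
split; rewrite ?p0 ?p1 // mulr_ge0 ?step_ge0 //= -[leRHS]mul1r.
by apply: ler_pM => //; [exact: step_ge0|exact: step_le1].
Qed.

Definition cube_indicator z : R := if `|z - X p| <= r then 1 else 0.

Lemma integrand_cube : integrand cube_indicator.
Proof.
exists 1, (`|X p| + r); split; rewrite ?addr_ge0 // => z; rewrite /cube_indicator; split.
  by case: ifP => _; rewrite ?normr1 ?normr0 ?ler01.
case: ifP => // zr; rewrite ltNge => /negP[]; rewrite -[z](subrK (X p)) addrC.
by rewrite (le_trans (ler_normD _ _)) // lerD2l.
Qed.

Lemma flux_vanishes eps : 0 < eps -> vanishes (collar_flux eps).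
Proof.
move=> e0 z Oz rz; rewrite flux_factor.
rewrite (wide_vanishes (g := fun t => step (t / eps) * pospow 1 (h - t)) Bw _ Oz rz) ?mul0r // => t.
exact: flux_far.
Qed.

(** A minorant of the flux that does not depend on eps: for t >= h / 4 >= eps the step is 1, and h D
    <= 1, with D a bound for div N, makes the factor 2 - (h - t)_+ div N at least 1. *)
Definition collar_core z : R := B (foot z) * (if h / 4 <= dist z then pospow 1 (h - dist z) else 0).

Lemma core_far t : radius8 T <= `|t| -> (if h / 4 <= t then pospow 1 (h - t) else 0) = 0.
Proof.
move=> rt; case: ifP => // ht; apply: (@pospow_neg R 0).
have t0 : 0 <= t by rewrite (le_trans _ ht) // divr_ge0 // ltW.
by rewrite subr_le0 (le_trans hr) // -(ger0_norm t0).
Qed.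

Lemma core_ge0 z : 0 <= collar_core z.
Proof.
have /andP[B0 _] := B01 (foot z); rewrite mulr_ge0 //.
by case: ifP => // _; exact: pospow_ge0.
Qed.

Lemma integrand_core : integrand (zero_ext Om collar_core).
Proof.
apply: (integrand_zero_ext r0 (ltW h0)) => [z Oz|]; last first.
  exact: (wide_vanishes (g := fun t => if h / 4 <= t then pospow 1 (h - t) else 0) Bw core_far).
rewrite ger0_norm ?core_ge0 // -[leRHS]mul1r; have /andP[B0 B1] := B01 (foot z).
apply: ler_pM => //; first by case: ifP => // _; exact: pospow_ge0.
case: ifP => [ht|_]; last exact: ltW.
by rewrite /pospow expr1 ge_max (ltW h0) /=; have := h0; lra.
Qed.

Lemma core_integral_gt0 : h <= tube_height T -> B p = 1 -> 0 < I (zero_ext Om collar_core).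
Proof.
move=> hh B1; pose z0 := X p + (h / 2) *: gamma p.
have hn : `|h / 2| = h / 2 by rewrite ger0_norm // divr_ge0 // ltW.
have Oz : Om z0.
  apply: (tube_ball_in r_lt); apply: (tube_reach (T := T) g1).
    by rewrite /center_dist2 subrr dotp0l mulr_gt0 // exprn_gt0 // radius8_gt0.
  by rewrite hn; have := hr; have := h0; lra.
have sh : `|h / 2| < tube_height T by rewrite hn; have := h0; lra.
have [fz dz] := tube_unique (tube_sheet_center T) sh Oz.
have n1 : \forall z \near z0, Om z by exact: open_nbhs_nbhs.
have n2 : \forall z \near z0, 2^-1 < B (foot z).
  apply: (cvgr_gt _ (C1_continuous BC Oz)); rewrite [foot _]fz B1.
  by rewrite invf_lt1 // ltr1n.
have n3 : \forall z \near z0, h / 4 < dist z.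
  by apply: (cvgr_gt _ (tube_dist_continuous Oz)); rewrite [tube_dist _ _]dz; have := h0; lra.
have n4 : \forall z \near z0, dist z < 3 * h / 4.
  by apply: (cvgr_lt _ (tube_dist_continuous Oz)); rewrite [tube_dist _ _]dz; have := h0; lra.
have n34 : \forall z \near z0, h / 4 < dist z /\ dist z < 3 * h / 4 by apply: filterI.
(* Near the point at height h / 2 above p one has B > 1/2 and h - t > h / 4. *)
have : \forall z \near z0, h / 8 <= zero_ext Om collar_core z.
  apply: filterS3 n1 n2 n34 => z O1 h2 [h3 h4].
  rewrite zero_ext_in // /collar_core (ltW h3).
  have -> : h / 8 = 2^-1 * (h / 4) by field.
  apply: ler_pM; [by []|by have := h0; lra|exact: ltW|].
  by rewrite pospow_pos ?expr1; lra.
move=> /nbhs_ballP[d /= d0 hd].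
apply: (Igt0 (z0 := z0) (c := h / 8) (d := d)) => //.
- exact: integrand_core.
- by move=> z; rewrite /zero_ext; case: asboolP => // _; exact: core_ge0.
- by have := h0; lra.
- by move=> z zd; apply: hd; rewrite -ball_normE /= distrC.
Qed.

Variable D : R.
Hypotheses (D0 : 0 <= D) (divD : forall z, `|z - X p| <= r -> `|flat_div N z| <= D).

Lemma flux_le eps z : 0 < eps -> eps <= radius8 T ->
  zero_ext Om (collar_flux eps) z <= h * (2 + h * D) * cube_indicator z.
Proof.
move=> e0 er; rewrite /cube_indicator; have [zr|zr] := leP (`|z - X p|) r; last first.
  rewrite mulr0 /zero_ext; case: asboolP => // Oz.
  by rewrite flux_vanishes.
have K0 : 0 <= h * (2 + h * D) by rewrite mulr_ge0 ?addr_ge0 ?mulr_ge0 ?(ltW h0).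
rewrite mulr1 (zero_ext_in _ (tube_ball_in r_lt zr)) flux_factor.
have /andP[B0 B1] := B01 (foot z).
have [/= ->|[t0 /andP[a0 a1] /andP[/= b0 b1]]] := flux_profile (dist z) e0.
  by rewrite mulr0 mul0r.
apply: (le_trans (ler_norm _)); rewrite normrM; apply: ler_pM => //.
  rewrite normrM ger0_norm // ger0_norm // -[leRHS]mul1r.
  by apply: ler_pM.
apply: (le_trans (ler_normB _ _)); rewrite normr_nat lerD2l normrM.
by apply: ler_pM => //; [rewrite ger0_norm|exact: divD].
Qed.

Lemma core_le eps z : 0 < eps -> eps <= radius8 T -> eps <= h / 4 -> h * D <= 1 ->
  zero_ext Om collar_core z <= zero_ext Om (collar_flux eps) z.
Proof.
move=> e0 er eh hD; rewrite /zero_ext; case: asboolP => // Oz.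
have [zr|zr] := leP (`|z - X p|) r; last first.
  rewrite flux_vanishes //.
  have -> // : collar_core z = 0.
  exact: (wide_vanishes (g := fun t => if h / 4 <= t then pospow 1 (h - t) else 0) Bw core_far Oz zr).
have /andP[B0 B1] := B01 (foot z).
rewrite flux_factor /collar_core -mulrA; apply: ler_wpM2l => //.
have key : 0 < dist z -> pospow 1 (h - dist z) <= h -> 1 <= 2 - pospow 1 (h - dist z) * flat_div N z.
  move=> t0 ph; have q1 : pospow 1 (h - dist z) * flat_div N z <= h * D.
    apply: (le_trans (ler_norm _)); rewrite normrM; apply: ler_pM => //; last exact: divD.
    by rewrite ger0_norm // pospow_ge0.
  by lra.
have [/= E|[t0 /andP[a0 a1] /andP[/= b0 b1]]] := flux_profile (dist z) e0.
  rewrite E mul0r; case: ifP => // ht; move: E; rewrite step_large ?mul1r => [->//|].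
  by rewrite ler_pdivlMr // mul1r; exact: le_trans ht.
case: ifP => ht; last by rewrite mulr_ge0 // (le_trans ler01) // key.
rewrite step_large; last by rewrite ler_pdivlMr // mul1r; exact: le_trans ht.
by rewrite mul1r -[leLHS]mulr1; apply: ler_wpM2l => //; exact: key.
Qed.

End Collar.

Lemma tube_div_bound : exists2 D : R, 0 <= D & forall z, `|z - X p| <= r -> `|flat_div N z| <= D.
Proof.
exact: (bounded_on_compact (@compact_tube_ball R n.+1 (X p) r)
  (fun z h => tube_div_continuous (tube_ball_in r_lt h))).
Qed.

Section Weight.
Variable B : M -> R.
Hypotheses (Bw : wide B) (BC : C1 Om (fun z => B (foot z))) (B01 : forall q, 0 <= B q <= 1).

(** Source and weight are comparable, and the source divided by eps has the same integral as the
    flux, which is at most h (2 + h D) on a fixed cube. *)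
Lemma weight_upper : exists K : R, forall eps, 0 < eps -> eps <= radius8 T / 2 ->
  0 <= eps^-1 * I (zero_ext Om (collar_weight B eps)) <= K.
Proof.
have [D D0 hD] := tube_div_bound.
have h0 := radius8_gt0 T; set h := radius8 T in h0 *.
exists (((h / 2) ^+ 2)^-1 * (h * (2 + h * D) * I cube_indicator)) => eps e0 eh.
have er : eps <= radius8 T by rewrite -/h; lra.
have wi := weight_integrand Bw BC e0 er.
apply/andP; split.
  rewrite mulr_ge0 ?invr_ge0 ?(ltW e0) //; apply: Ige0 => // z.
  by rewrite /zero_ext; case: asboolP => // _; exact: weight_ge0.
have [si fi E] := collar_identity Bw BC (lexx _) e0 er.
rewrite ler_pdivlMl ?exprn_gt0 ?divr_gt0 //.
apply: (@le_trans _ _ (eps^-1 * I (zero_ext Om (collar_source B h eps)))).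
  rewrite mulrCA; apply: ler_wpM2l; first by rewrite invr_ge0 ltW.
  rewrite -IZ //; apply: I_le => //; first exact: integrandZ.
  move=> z; rewrite /zero_ext; case: asboolP => [Oz|_]; last by rewrite mulr0.
  by have [H _] := source_bounds h0 B01 z e0; exact: H.
rewrite E -IZ; last exact: integrand_cube.
apply: I_le => //; first by apply: integrandZ; exact: integrand_cube.
by move=> z; apply: flux_le.
exact: tube_radius_gt0.
Qed.

(** This keeps the area functional from degenerating: h is taken so small that the flux dominates
    [collar_core], whose integral is positive. *)
Lemma weight_lower : B p = 1 -> exists2 k : R, 0 < k & exists2 e1 : R, 0 < e1 &
  forall eps, 0 < eps -> eps <= e1 -> k <= eps^-1 * I (zero_ext Om (collar_weight B eps)).
Proof.
move=> B1; have [D D0 hD] := tube_div_bound.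
pose h := Num.min (radius8 T) (Num.min (tube_height T) (D + 1)^-1).
have D1 : 0 < D + 1 by lra.
have h0 : 0 < h by rewrite !lt_min radius8_gt0 tube_height_gt0 invr_gt0.
have hr : h <= radius8 T by rewrite ge_min lexx.
have hh : h <= tube_height T by rewrite !ge_min lexx orbT.
have hd : h * D <= 1.
  apply: (@le_trans _ _ ((D + 1)^-1 * (D + 1))); last by rewrite mulVf // gt_eqF.
  by apply: ler_pM => //; [exact: ltW|rewrite !ge_min lexx !orbT|lra].
have c0 := core_integral_gt0 Bw BC h0 hr B01 hh B1.
exists ((h ^+ 2)^-1 * I (zero_ext Om (collar_core B h))).
  by rewrite mulr_gt0 // invr_gt0 exprn_gt0.
exists (h / 4); first by rewrite divr_gt0.
move=> eps e0 eh; have er : eps <= radius8 T by lra.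
have wi := weight_integrand Bw BC e0 er.
have [si fi E] := collar_identity Bw BC hr e0 er.
rewrite ler_pdivrMl ?exprn_gt0 //.
apply: (@le_trans _ _ (eps^-1 * I (zero_ext Om (collar_source B h eps)))).
  rewrite E; apply: I_le => //; first exact: integrand_core.
  by move=> z; exact: (core_le Bw h0 hr B01 hD).
rewrite mulrCA; apply: ler_wpM2l; first by rewrite invr_ge0 ltW.
rewrite -IZ //; apply: I_le => //; first exact: integrandZ.
move=> z; rewrite /zero_ext; case: asboolP => [Oz|_]; last by rewrite mulr0.
by have [_ H] := source_bounds h0 B01 z e0.
Qed.

End Weight.

Lemma sheet_cutoff_wide k : 1 <= k -> wide (sheet_cutoff T k).
Proof.
move=> k1 q h; have k0 := lt_le_trans ltr01 k1; have [sq cq] := sheet_cutoff_neq0 k0 h.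
split=> //; apply: (lt_le_trans cq); apply: ler_wpM2r; first exact: sqr_ge0.
by rewrite ler_pdivrMr // ler_pMr.
Qed.

Lemma sheet_cutoff01 k q : 0 <= sheet_cutoff T k q <= 1.
Proof. by rewrite sheet_cutoff_ge0 sheet_cutoff_le1. Qed.

End InTube.

Variable L : (nat -> R) -> R.
Hypothesis LD : forall u v, evbounded u -> evbounded v -> L (fun n => u n + v n) = L u + L v.
Hypothesis LZ : forall c u, evbounded u -> L (fun n => c * u n) = c * L u.
Hypothesis Lge0 : forall u, evbounded u -> (\forall n \near \oo, 0 <= u n) -> 0 <= L u.
Hypothesis Lge : forall u (c : R), evbounded u -> (\forall n \near \oo, c <= u n) -> c <= L u.

Lemma L_le u v : evbounded u -> evbounded v -> (\forall n \near \oo, u n <= v n) -> L u <= L v.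
Proof.
move=> bu bv uv; have bn : evbounded (fun n => -1 * u n) by exact: evboundedZ.
have : 0 <= L (fun n => v n + -1 * u n).
  apply: Lge0; first exact: evboundedD.
  by apply: filterS uv => m uv; rewrite mulN1r subr_ge0.
by rewrite LD // LZ // mulN1r subr_ge0.
Qed.

Lemma L_near u v : evbounded u -> evbounded v -> (\forall n \near \oo, u n = v n) -> L u = L v.
Proof.
move=> bu bv uv; apply/eqP; rewrite eq_le; apply/andP; split; apply: L_le => //.
  by apply: filterS uv => m ->.
by apply: filterS uv => m ->.
Qed.

Lemma mesh_small (e : R) : 0 < e -> \forall m \near \oo, mesh m <= e.
Proof.
move=> e0; have : \forall m \near \oo, mesh m < e by exact: (cvgr_lt _ (@mesh_cvg R)).
by apply: filterS => m /ltW.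
Qed.

Definition area_sum f m := (mesh m)^-1 * I (push (mesh m) f).
Definition area f := L (area_sum f).

(** Finiteness matters because a sum over an infinite support is 0 by convention, which would spoil
    additivity; boundedness of the quotients puts them in the domain where L is linear. *)
Definition measurable_density f :=
  (\forall m \near \oo, (forall z, finite_set [set q | f q * kernel (mesh m) q z != 0]) /\
     integrand (push (mesh m) f)) /\ evbounded (area_sum f).

Lemma pushD eps f g z : finite_set [set q | f q * kernel eps q z != 0] ->
  finite_set [set q | g q * kernel eps q z != 0] ->
  push eps (fun q => f q + g q) z = push eps f z + push eps g z.
Proof.
move=> ff fg; set A := [set q | _] in ff; set A' := [set q | _] in fg.
have fA : finite_set (A `|` A') by rewrite finite_setU.
have W (k : M -> R) : (forall q, ~ (A `|` A') q -> k q * kernel eps q z = 0) ->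
    push eps k z = \sum_(q \in A `|` A') (k q * kernel eps q z).
  by move=> k0; rewrite /push -(@fsbig_widen _ _ _ _ (A `|` A')) // => q [_ /k0].
have a0 q : ~ (A `|` A') q -> f q * kernel eps q z = 0.
  by move=> nA; apply/eqP; apply/negPn/negP => h; apply: nA; left.
have b0 q : ~ (A `|` A') q -> g q * kernel eps q z = 0.
  by move=> nA; apply/eqP; apply/negPn/negP => h; apply: nA; right.
rewrite (W f a0) (W g b0) W; last by move=> q nA; rewrite mulrDl a0 // b0 // addr0.
by rewrite -fsbig_split //; apply: eq_fsbigr => q _; rewrite mulrDl.
Qed.

Lemma pushZ eps (c : R) f z : push eps (fun q => c * f q) z = c * push eps f z.
Proof. by rewrite /push mulr_fsumr; apply: eq_fsbigr => q _; rewrite mulrA. Qed.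

Lemma push_ge0 eps f z : (forall q, 0 <= f q) -> 0 <= push eps f z.
Proof. by move=> f0; apply: fsumr_ge0 => q _; rewrite mulr_ge0 // kernel_ge0. Qed.

Lemma push0 eps z : push eps (fun=> 0) z = 0.
Proof. by apply: fsbig1 => q _; rewrite mul0r. Qed.

Lemma integral_zero : I (fun=> 0) = 0.
Proof. exact: (integral0 IZ). Qed.

Lemma density0 : measurable_density (fun=> 0) /\ area (fun=> 0) = 0.
Proof.
have E m : push (mesh m) (fun=> 0) = (fun=> 0) by apply/funext => z; exact: push0.
have b0 : evbounded (area_sum (fun=> 0)).
  by exists 0; apply: nearW => m; rewrite /area_sum E integral_zero mulr0 normr0.
split; first split=> //.
  apply: nearW => m; split=> [z|]; last by rewrite E; exact: integrand0.
  rewrite (_ : [set q | _] = set0) //; apply/seteqP; split=> q //=.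
  by rewrite mul0r eqxx.
have E0 : L (fun m => 0 * area_sum (fun=> 0) m) = 0 * area (fun=> 0) by exact: LZ.
rewrite mul0r in E0; rewrite -[RHS]E0; congr L; apply/funext => m.
by rewrite /area_sum E integral_zero !mulr0.
Qed.

Lemma densityD f g : measurable_density f -> measurable_density g ->
  measurable_density (fun q => f q + g q) /\ area (fun q => f q + g q) = area f + area g.
Proof.
move=> [nf bf] [ng bg].
have E : \forall m \near \oo, area_sum (fun q => f q + g q) m = area_sum f m + area_sum g m.
  apply: filterS2 nf ng => m [ff fi] [gf gi].
  rewrite /area_sum -mulrDr -ID //; congr (_ * I _); apply/funext => z.
  exact: pushD.
have b : evbounded (area_sum (fun q => f q + g q)).
  have [C hC] := evboundedD bf bg; exists C.
  by apply: filterS2 E hC => m ->.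
split; last by rewrite /area -LD //; apply: L_near => //; exact: evboundedD.
split=> //; apply: filterS2 nf ng => m [ff fi] [gf gi]; split=> [z|].
  apply: (sub_finite_set (B := [set q | f q * kernel (mesh m) q z != 0] `|`
     [set q | g q * kernel (mesh m) q z != 0])); last by rewrite finite_setU.
  move=> q /=; rewrite mulrDl; have [->|h] := eqVneq (f q * kernel (mesh m) q z) 0.
    by rewrite add0r; right.
  by move=> _; left.
rewrite (_ : push _ _ = fun z => push (mesh m) f z + push (mesh m) g z); first exact: integrandD.
by apply/funext => z; exact: pushD.
Qed.

Lemma densityZ (c : R) f : measurable_density f ->
  measurable_density (fun q => c * f q) /\ area (fun q => c * f q) = c * area f.
Proof.
move=> [nf bf].
have E m : push (mesh m) (fun q => c * f q) = (fun z => c * push (mesh m) f z).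
  by apply/funext => z; exact: pushZ.
have E' : \forall m \near \oo, area_sum (fun q => c * f q) m = c * area_sum f m.
  by apply: filterS nf => m [_ fi]; rewrite /area_sum E IZ // mulrCA.
have b : evbounded (area_sum (fun q => c * f q)).
  have [C hC] := evboundedZ c bf; exists C.
  by apply: filterS2 E' hC => m ->.
split; last by rewrite /area -LZ //; apply: L_near => //; exact: evboundedZ.
split=> //; apply: filterS nf => m [ff fi]; split=> [z|]; last by rewrite E; exact: integrandZ.
apply: sub_finite_set (ff z) => q /=; rewrite -mulrA mulf_eq0 negb_or.
by move=> /andP[].
Qed.

Lemma area_ge0 f : measurable_density f -> (forall q, 0 <= f q) -> 0 <= area f.
Proof.
move=> [nf bf] f0; apply: Lge0 => //; apply: filterS nf => m [_ fi].
rewrite mulr_ge0 ?invr_ge0 ?(ltW (@mesh_gt0 R _)) //; apply: Ige0 => // z.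
exact: push_ge0.
Qed.

Section LocalDensity.
Variables (p : M) (T : tube X gamma p) (f : M -> R) (C : R).
Hypotheses (fc : continuous f) (fw : wide T f) (C0 : 0 <= C).
Hypothesis fB : forall q, `|f q| <= C * sheet_cutoff T 1 q.

Let small : \forall m \near \oo, mesh m <= radius8 T / 2 /\ mesh m <= tube_height T.
Proof.
apply: filterI; apply: mesh_small; last exact: tube_height_gt0.
by rewrite divr_gt0 // radius8_gt0.
Qed.

Let small8 m : mesh m <= radius8 T / 2 -> mesh m <= radius8 T.
Proof. by have := radius8_gt0 T; lra. Qed.

Lemma push_wide_near : \forall m \near \oo, integrand (push (mesh m) f) /\
  push (mesh m) f = zero_ext (tube_ball T) (fun z => f (tube_foot T z) * bump (tube_dist T z / mesh m)).
Proof.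
have r0 := tube_radius_gt0 T.
apply: filterS small => m [m1 m2]; have m0 := @mesh_gt0 R m.
have E := push_wide fw m0 (small8 m1) m2; split=> //; rewrite E.
have r00 : 0 <= tube_radius T / 2 by lra.
have r01 : tube_radius T / 2 < tube_radius T by lra.
apply: (integrand_zero_ext_continuous r00 r01) => [z Oz|].
  apply: (@continuousM _ _ (fun z => f (tube_foot T z))).
    exact: (tube_comp_continuous Oz fc).
  apply: (C1_continuous (U := tube_ball T) _ Oz); apply: C1_bump; first exact: tube_ball_open.
  exact: C1_scaled.
apply: (wide_vanishes (T := T) (g := fun t => bump (t / mesh m)) fw) => t.
by apply: bump_far => //; exact: small8.
Qed.

(** |f| is at most C times a cut-off whose collar quotients are bounded by [weight_upper]. *)
Lemma local_density : measurable_density f.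
Proof.
have [K hK] := weight_upper (sheet_cutoff_wide (T := T) (lexx 1))
  (sheet_cutoff_C1T Xc T (lexx 1) (T := T)) (sheet_cutoff01 T 1).
split.
  apply: filterS2 small push_wide_near => m [m1 m2] [fi _]; split=> // z.
  apply: (sub_finite_set (B := [set tube_foot T z])); last exact: finite_set1.
  by move=> q /= /(push_wide_support fw (@mesh_gt0 R m) (small8 m1) m2)[_ ->].
exists (C * K); apply: filterS2 small push_wide_near => m [m1 m2] [fi E].
have m0 := @mesh_gt0 R m; have /andP[_ hKm] := hK _ m0 m1.
have wi := weight_integrand (sheet_cutoff_wide (T := T) (lexx 1))
  (sheet_cutoff_C1T Xc T (lexx 1) (T := T)) m0 (small8 m1).
have H (c : R) : `|c| = 1 -> c * I (push (mesh m) f) <=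
    C * I (zero_ext (tube_ball T) (collar_weight T (sheet_cutoff T 1) (mesh m))).
  move=> c1; rewrite -!IZ //; apply: I_le; [exact: integrandZ|exact: integrandZ|move=> z].
  rewrite E /zero_ext; case: asboolP => [Oz|_]; last by rewrite !mulr0.
  rewrite /collar_weight !(mulrA _ _ (bump _)).
  have cf : c * f (tube_foot T z) <= C * sheet_cutoff T 1 (tube_foot T z).
    by apply: (le_trans _ (fB _)); apply: (le_trans (ler_norm _)); rewrite normrM c1 mul1r.
  exact: (ler_wpM2r (bump_ge0 (tube_dist T z / mesh m)) cf).
rewrite /area_sum normrM (ger0_norm (_ : 0 <= (mesh m)^-1)) ?invr_ge0 ?(ltW m0) //.
apply: (@le_trans _ _ ((mesh m)^-1 * (C * I (zero_ext (tube_ball T) (collar_weight T (sheet_cutoff T 1) (mesh m)))))).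
  apply: ler_wpM2l; first by rewrite invr_ge0 ltW.
  rewrite ler_norml; apply/andP; split; last by have := H 1 (normr1 _); rewrite mul1r.
  by rewrite lerNl; have := H (-1) (normrN1 _); rewrite mulN1r.
by rewrite mulrCA; apply: ler_wpM2l.
Qed.

End LocalDensity.

Variable TB : forall p, tube X gamma p.

Lemma cutoff_local p (f : M -> R) : continuous f -> exists2 C : R, 0 <= C &
  forall q, `|f q * cover_cutoff TB p q| <= C * sheet_cutoff (TB p) 1 q.
Proof.
move=> fc; set T := TB p; have r0 := radius8_gt0 T.
have r_lt : 2 * radius8 T < tube_radius T by have := tube_radius_gt0 T; rewrite /radius8; lra.
have [C C0 hC] := bounded_on_compact (@compact_tube_ball R n.+1 (X p) (2 * radius8 T))
  (fun z h => tube_comp_continuous (T := T) (tube_ball_in r_lt h) fc).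
exists C => // q; have [->|h] := eqVneq (cover_cutoff TB p q) 0.
  by rewrite mulr0 normr0 mulr_ge0 // sheet_cutoff_ge0.
have k0 : 0 < 2 :> R by [].
have [sq cq] := sheet_cutoff_neq0 k0 h.
have a0 := sqr_ge0 (radius8 T).
have {}cq : center_dist2 X p q < radius8 T ^+ 2 by rewrite divff // mul1r in cq.
have wn : `|X q - X p| <= 2 * radius8 T by apply: ltW; apply: wide_norm; rewrite -/T; lra.
rewrite (sheet_cutoff1 ltr01 sq); last by rewrite invr1 mul1r ltW.
rewrite mulr1 normrM -[leRHS]mulr1; apply: ler_pM => //.
  have := hC _ wn; have [-> _] := tube_sheetE sq (tube_ball_in r_lt wn).
  by [].
by rewrite ger0_norm ?sheet_cutoff_ge0 // sheet_cutoff_le1.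
Qed.

Lemma cutoff_continuous p (f : M -> R) : continuous f -> continuous (fun q => f q * cover_cutoff TB p q).
Proof.
move=> fc q; apply: (@continuousM _ _ f (cover_cutoff TB p)); first exact: fc.
by apply: (C1T_continuous Xc TB); apply: sheet_cutoff_C1T => //; rewrite ler1n.
Qed.

Lemma cutoff_wide p (f : M -> R) : wide (TB p) (fun q => f q * cover_cutoff TB p q).
Proof.
move=> q; rewrite mulf_eq0 negb_or => /andP[_]; apply: sheet_cutoff_wide.
by rewrite ler1n.
Qed.

Lemma cutoff_density p (f : M -> R) : continuous f -> measurable_density (fun q => f q * cover_cutoff TB p q).
Proof.
move=> fc; have [C C0 hC] := cutoff_local p fc.
by apply: (local_density (T := TB p) (C := C)) => //; [exact: cutoff_continuous|exact: cutoff_wide].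
Qed.

Lemma continuous_density (f : M -> R) (K : set M) : continuous f -> compact K ->
  (forall q, f q != 0 -> K q) -> measurable_density f.
Proof.
move=> fc cK fK; apply: (local_induction Xc (TB := TB) (F := fun f : M -> R => continuous f) _ _ _ _ cK fK fc).
- by have [] := density0.
- by move=> g k hg hk; have [] := densityD hg hk.
- move=> p g gc q; apply: (@continuousM _ _ g (fun q => 1 - cover_cutoff TB p q)); first exact: gc.
  apply: (@continuousB _ _ _ (fun=> 1 : R) (cover_cutoff TB p)); first exact: cst_continuous.
  by apply: (C1T_continuous Xc TB); apply: sheet_cutoff_C1T => //; rewrite ler1n.
- by move=> p g gc; exact: cutoff_density.
Qed.

(** f dominates f(p) / 2 times a cut-off equal to 1 at p, whose collar quotients stay away from 0 by
    [weight_lower]. *)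
Lemma area_gt0 (f : M -> R) (K : set M) p : continuous f -> compact K -> (forall q, f q != 0 -> K q) ->
  (forall q, 0 <= f q) -> 0 < f p -> 0 < area f.
Proof.
move=> fc cK fK f0 fp; set T := TB p.
have df := continuous_density fc cK fK.
have n1 : \forall q \near p, f p / 2 < f q.
  by apply: (cvgr_gt _ (fc p)); lra.
have n2 : \forall z \near X p, f p / 2 < f (tube_foot T z).
  have c := tube_comp_continuous (tube_center_in T) fc.
  by apply: (cvgr_gt _ c); have [-> _] := tube_center T; lra.
have [d d0 hd] : exists2 d : R, 0 < d & forall z, `|z - X p| < d -> f p / 2 < f (tube_foot T z).
  move: n2 => /nbhs_ballP[d /= d0 hd]; exists d => // z zd.
  by apply: hd; rewrite -ball_normE /= distrC.
have r0 := radius8_gt0 T.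
pose e := Num.min d (radius8 T); have e0 : 0 < e by rewrite lt_min d0.
(* Chosen so that 2 / k * radius8^2 = e^2: the support of the cut-off B lies within e of [X p],
   where f > f(p) / 2. *)
pose k := 2 * (radius8 T / e) ^+ 2.
have re : 1 <= radius8 T / e by rewrite ler_pdivlMr // mul1r ge_min lexx orbT.
have k1 : 1 <= k.
  have : 1 <= (radius8 T / e) ^+ 2 by exact: exprn_ege1.
  by rewrite /k; lra.
have k0 := lt_le_trans ltr01 k1.
pose B := sheet_cutoff T k.
have Bf q : f p / 2 * B q <= f q.
  have [->|h] := eqVneq (B q) 0; first by rewrite mulr0.
  have [sq cq] := sheet_cutoff_neq0 k0 h.
  have k2 : 2 / k * radius8 T ^+ 2 = e ^+ 2.
    by rewrite /k; field; rewrite !gt_eqF.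
  have ne : `|X q - X p| < e.
    rewrite -(@ltr_pXn2r _ 2) ?nnegrE ?(ltW e0) // -k2.
    by apply: le_lt_trans cq; exact: norm_sqr_le_dotp.
  have O : tube_ball T (X q).
    apply: (near_center_small (b := e)) => //.
    by apply: (@le_trans _ _ (radius8 T)); [rewrite ge_min lexx orbT|lra].
  have nd : `|X q - X p| < d by apply: (lt_le_trans ne); rewrite ge_min lexx.
  have := hd _ nd; have [-> _] := tube_sheetE sq O => fq.
  have := sheet_cutoff_le1 T k q; rewrite -/B => B1.
  by apply: (le_trans _ (ltW fq)); rewrite -[leRHS]mulr1; apply: ler_wpM2l => //; lra.
have BC : C1 (tube_ball T) (fun z => B (tube_foot T z)) by exact: (sheet_cutoff_C1T Xc T k1 (T := T)).
have Bw : wide T B by exact: sheet_cutoff_wide.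
have Bp : B p = 1.
  apply: (sheet_cutoff1 k0 (tube_sheet_center T)).
  by rewrite /center_dist2 subrr dotp0l mulr_ge0 ?invr_ge0 ?(ltW k0) // sqr_ge0.
have Bc : continuous B by apply: (C1T_continuous Xc TB); exact: sheet_cutoff_C1T.
have [c c0 [e1 e10 hc]] := weight_lower Bw BC (sheet_cutoff01 T k) Bp.
apply: (@lt_le_trans _ _ (f p / 2 * c)); first by rewrite mulr_gt0 // divr_gt0.
have [nf bf] := df; apply: Lge => //.
have ne1 := mesh_small e10; have ne2 := mesh_small (tube_height_gt0 T).
have ne3 := mesh_small r0.
have n23 : \forall m \near \oo, mesh m <= tube_height T /\ mesh m <= radius8 T by exact: filterI.
apply: filterS3 nf ne1 n23 => m [ff fi] m1 [m2 m3]; have m0 := @mesh_gt0 R m.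
have wi := weight_integrand Bw BC m0 m3.
have := hc _ m0 m1 => /(ler_wpM2l (_ : 0 <= f p / 2)) H.
apply: (le_trans (H _)); first by lra.
rewrite mulrCA /area_sum; apply: ler_wpM2l; first by rewrite invr_ge0 ltW.
rewrite -IZ //; apply: I_le => //; first exact: integrandZ.
move=> z; rewrite -(push_wide Bw m0 m3 m2) -pushZ.
have gf : finite_set [set q | (f q - f p / 2 * B q) * kernel (mesh m) q z != 0].
  apply: (sub_finite_set (B := [set q | f q * kernel (mesh m) q z != 0] `|` [set tube_foot T z])).
    move=> q /=; rewrite mulf_eq0 negb_or => /andP[h1 h2].
    have [E|E] := eqVneq (f q) 0; last by left; rewrite mulf_neq0.
    right; have [] := push_wide_support Bw m0 m3 m2 (q := q) (z := z) => //.
    rewrite mulf_neq0 //; apply/eqP => B0; move: h1.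
    by rewrite E B0 mulr0 subr0 eqxx.
  by rewrite finite_setU; split=> //; exact: finite_set1.
have bf' : finite_set [set q | f p / 2 * B q * kernel (mesh m) q z != 0].
  apply: (sub_finite_set (B := [set tube_foot T z])); last exact: finite_set1.
  move=> q /= h; have [] := push_wide_support Bw m0 m3 m2 (q := q) (z := z) => //.
  by move: h; rewrite -mulrA mulf_eq0 negb_or => /andP[].
have -> : push (mesh m) f z = push (mesh m) (fun q => (f q - f p / 2 * B q) + f p / 2 * B q) z.
  by congr (push _ _ z); apply/funext => q; rewrite subrK.
rewrite (pushD gf bf') lerDr; apply: push_ge0 => q.
by rewrite subr_ge0.
Qed.

End Functional.

(** * Divergence theorem on the hypersurface *)

Section AreaDivergence.
Context {R : realType} {n : nat} {M : smooth_manifold R n}.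
Variables (X gamma : M -> 'rV[R]_n.+1).
Hypothesis Xc : continuous X.
Hypothesis g1 : forall q, dotp (gamma q) (gamma q) = 1.
Variable I : ('rV[R]_n.+1 -> R) -> R.
Hypothesis ID : forall f g, integrand f -> integrand g ->
  I (fun z => f z + g z) = I f + I g.
Hypothesis IZ : forall k f, integrand f -> I (fun z => k * f z) = k * I f.
Hypothesis Ige0 : forall f, integrand f -> (forall z, 0 <= f z) -> 0 <= I f.
Hypothesis Ider : forall G (s : R) a, 0 <= s -> (forall z, differentiable G z) ->
      continuous (pd (delta_mx 0 a) G) -> (forall z, s < `|z| -> G z = 0) ->
      I (pd (delta_mx 0 a) G) = 0.
Variable L : (nat -> R) -> R.
Hypothesis LD : forall u v, evbounded u -> evbounded v -> L (fun n => u n + v n) = L u + L v.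
Hypothesis LZ : forall c u, evbounded u -> L (fun n => c * u n) = c * L u.
Hypothesis Lge0 : forall u, evbounded u -> (\forall n \near \oo, 0 <= u n) -> 0 <= L u.
Hypothesis Lcvg : forall u, u n @[n --> \oo] --> (0 : R) -> L u = 0.
Variable TB : forall p, tube X gamma p.

Variable Zf : forall p, tube X gamma p -> 'rV[R]_n.+1 -> 'rV[R]_n.+1.
Hypothesis ZC : forall p (T : tube X gamma p) a, C1 (tube_ball T) (fun z => Zf T z 0 a).
Hypothesis ZN : forall p (T : tube X gamma p) z, tube_ball T z ->
  dotp (tube_normal T z) (Zf T z) = 0.
Hypothesis Zagree : forall p p' (T : tube X gamma p) (T' : tube X gamma p') q,
  tube_sheet T q -> tube_ball T (X q) -> tube_sheet T' q -> tube_ball T' (X q) ->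
  \forall z \near X q, Zf T z = Zf T' z.

(** The flat divergence of psi Z, with psi extended constantly along normals. For Z tangent to all
    levels of the distance it restricts to the divergence on M. *)
Definition tube_divergence_of p (T : tube X gamma p) (psi : M -> R) z : R :=
  pd (Zf T z) (fun y => psi (tube_foot T y)) z + psi (tube_foot T z) * flat_div (Zf T) z.

Definition surface_divergence (psi : M -> R) q := tube_divergence_of (TB q) psi (X q).

(** Two tubes around q give the same foot and the same field near [X q], and derivatives only see
    germs. *)
Lemma surface_divergenceE p (T : tube X gamma p) psi q : tube_sheet T q ->
  tube_ball T (X q) -> surface_divergence psi q = tube_divergence_of T psi (X q).
Proof.
move=> sq Oq; have sq' := tube_sheet_center (TB q); have Oq' := tube_center_in (TB q).
have Z1 := Zagree sq' Oq' sq Oq; have A1 := tube_agree sq' Oq' sq Oq.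
rewrite /surface_divergence /tube_divergence_of.
have [f1 _] := nbhs_singleton A1; have z1 := nbhs_singleton Z1; rewrite /= in f1 z1.
congr (_ + psi _ * _); [|exact: f1|].
  rewrite z1; apply: pd_near; apply: filterS A1 => z [fz _].
  by congr psi; exact: fz.
rewrite /flat_div; apply: eq_bigr => a _; apply: pd_near; apply: filterS Z1 => z Zz.
by rewrite Zz.
Qed.

Lemma tube_divergence_zero p (T : tube X gamma p) psi z :
  (\forall y \near z, psi (tube_foot T y) = 0) -> tube_divergence_of T psi z = 0.
Proof.
move=> h; have h0 := nbhs_singleton h; rewrite /= in h0; rewrite /tube_divergence_of h0 mul0r addr0.
by rewrite (pd_near _ (g := cst 0)) ?pd_cst.
Qed.

Lemma surface_divergence_zero psi q : (\forall q' \near q, psi q' = 0) ->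
  surface_divergence psi q = 0.
Proof.
move=> h; apply: tube_divergence_zero.
have h' : \forall q' \near tube_foot (TB q) (X q), psi q' = 0 by have [-> _] := tube_center (TB q).
by have c := tube_foot_continuous (tube_center_in (TB q)); exact: (c _ h').
Qed.

Lemma tube_divergence_continuous p (T : tube X gamma p) psi z : C1T X gamma psi ->
  tube_ball T z -> {for z, continuous (tube_divergence_of T psi)}.
Proof.
move=> psiC Oz; have oT := @tube_ball_open _ _ _ _ _ p T.
apply: (@near_eq_continuous _ _ (fun z => \sum_a Zf T z 0 a *
   pd (delta_mx 0 a) (fun y => psi (tube_foot T y)) z +
   psi (tube_foot T z) * flat_div (Zf T) z)).
  apply: filterS (open_nbhs_nbhs (conj oT Oz)) => y Oy.
  by rewrite /tube_divergence_of (pd_basis (Zf T y)) //; have [] := psiC p T y Oy.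
apply: (@continuousD _ _ _ (fun z => \sum_a Zf T z 0 a *
   pd (delta_mx 0 a) (fun y => psi (tube_foot T y)) z)).
  apply: sum_continuous => a.
  apply: (@continuousM _ _ (fun z => Zf T z 0 a)); first exact: (C1_continuous (ZC (T := T) a) Oz).
  by have [_] := psiC p T z Oz; exact.
apply: (@continuousM _ _ (fun z => psi (tube_foot T z))).
  exact: (C1_continuous (psiC p T) Oz).
by apply: (flat_div_continuous Oz) => a; exact: ZC.
Qed.

Lemma surface_divergence_continuous psi : C1T X gamma psi -> continuous (surface_divergence psi).
Proof.
move=> psiC p; set T := TB p.
have sp := tube_sheet_center T; have Op := tube_center_in T.
have n1 : \forall q \near p, tube_sheet T q.
  by apply: open_nbhs_nbhs; split=> //; exact: tube_sheet_open.
have n2 : \forall q \near p, tube_ball T (X q).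
  by apply: Xc; apply: open_nbhs_nbhs; split=> //; exact: tube_ball_open.
apply: (@near_eq_continuous _ _ (fun q => tube_divergence_of T psi (X q))).
  by apply: filterS2 n1 n2 => q sq Oq; rewrite (surface_divergenceE psi sq Oq).
by move=> A /(tube_divergence_continuous psiC Op) h; exact: (@Xc p _ h).
Qed.

Lemma surface_divergenceD psi phi : C1T X gamma psi -> C1T X gamma phi ->
  surface_divergence (fun q => psi q + phi q) =
  (fun q => surface_divergence psi q + surface_divergence phi q).
Proof.
move=> psiC phiC; apply/funext => q; have Oq := tube_center_in (TB q).
have [d1 _] := psiC q (TB q) _ Oq; have [d2 _] := phiC q (TB q) _ Oq.
by rewrite /surface_divergence /tube_divergence_of (pdD _ d1 d2); ring.
Qed.

Lemma cutoff_near0 p q : ~ (tube_sheet (TB p) q /\ center_dist2 X p q <= radius8 (TB p) ^+ 2) ->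
  \forall q' \near q, cover_cutoff TB p q' = 0.
Proof.
set T := TB p => h; have k0 : 0 < 2 :> R by [].
have [far|cl] := ltP (radius8 T ^+ 2) (center_dist2 X p q).
  have : \forall q' \near q, radius8 T ^+ 2 < center_dist2 X p q'.
    exact: (cvgr_gt _ (@center_dist2_continuous _ _ _ X gamma Xc TB p q)).
  apply: filterS => q' fq'; apply/eqP; apply/negPn/negP => /(sheet_cutoff_neq0 k0)[_].
  by rewrite divff // mul1r ltNge (ltW fq').
have nsq : ~ tube_sheet T q by move=> sq; apply: h.
have Oq : tube_ball T (X q).
  have r0 := radius8_gt0 T.
  apply: (near_center_small (b := 2 * radius8 T)) => //; apply: wide_norm.
  by have := exprn_gt0 2 r0; rewrite -/T; lra.
apply: filterS (tube_sheet_closed Xc Oq nsq) => q' nsq'.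
by rewrite /cover_cutoff /sheet_cutoff; case: asboolP.
Qed.

Section LocalDivergence.
Variables (p : M) (psi : M -> R).
Hypothesis psiC : C1T X gamma psi.
Let T := TB p.
Let Om := tube_ball T.
Let foot := tube_foot T.
Let dist := tube_dist T.
Let oOm : open Om := tube_ball_open (T := T).
Let r := tube_radius T / 2.
Let r0 : 0 <= r. Proof. by rewrite divr_ge0 // ltW // tube_radius_gt0. Qed.
Let r_lt : r < tube_radius T.
Proof. by have := tube_radius_gt0 T; rewrite /r; lra. Qed.
Let R0 : 0 < radius8 T := radius8_gt0 T.

Definition localized q := psi q * cover_cutoff TB p q.
Let E := tube_divergence_of T localized.

Lemma localized_C1T : C1T X gamma localized.
Proof.
move=> p' T'; apply: C1M => //; first exact: tube_ball_open.
by apply: sheet_cutoff_C1T => //; rewrite ler1n.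
Qed.

Lemma localized_wide : wide T localized.
Proof.
move=> q; rewrite /localized mulf_eq0 negb_or => /andP[_]; apply: sheet_cutoff_wide.
by rewrite ler1n.
Qed.

Lemma localized_far z : Om z -> radius8 T ^+ 2 < center_dist2 X p (foot z) -> E z = 0.
Proof.
move=> Oz h; apply: tube_divergence_zero.
have H : \forall q' \near foot z, cover_cutoff TB p q' = 0.
  by apply: cutoff_near0 => -[_]; rewrite leNgt h.
have H' : \forall q' \near foot z, localized q' = 0.
  by apply: filterS H => q' Hq'; rewrite /localized Hq' mulr0.
by have c := tube_foot_continuous Oz; exact: (c _ H').
Qed.

Lemma surface_localized_support q : surface_divergence localized q != 0 ->
  tube_sheet T q /\ center_dist2 X p q <= radius8 T ^+ 2.
Proof.
move=> h; apply: contrapT => nq; move/eqP: h; apply; apply: surface_divergence_zero.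
by apply: filterS (cutoff_near0 nq) => q' Hq'; rewrite /localized Hq' mulr0.
Qed.

Lemma surface_localized_wide : wide T (surface_divergence localized).
Proof.
move=> q /surface_localized_support[sq h]; split=> //.
by apply: (le_lt_trans h); have := exprn_gt0 2 R0; lra.
Qed.

Let B := sheet_cutoff T 1.

Lemma cutoff1_in q : tube_sheet T q -> center_dist2 X p q <= radius8 T ^+ 2 -> B q = 1.
Proof. by move=> sq h; apply: sheet_cutoff1 => //; rewrite invr1 mul1r. Qed.

(** E does not decay in the normal direction. The plateau is 1 for |dist| <= radius8 / 2 and 0 for
    |dist| >= radius8, so F has compact support, hence is uniformly continuous, and equals E in thin
    collars. *)
Let F z := E z * plateau (2 * (dist z * dist z / radius8 T ^+ 2)).

Lemma profile_vanishes : vanishes_outside (X p) (tube_radius T) r F.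
Proof.
move=> z Oz rz; have [h|h] := ltP (radius8 T ^+ 2) (center_dist2 X p (foot z)).
  by rewrite /F localized_far // mul0r.
have sz := tube_foot_sheet Oz.
have Bn : B (foot z) != 0 by rewrite cutoff1_in // oner_eq0.
have := wide_far g1 (sheet_cutoff_wide (lexx 1)) Oz rz Bn => hd.
rewrite /F plateau0 ?mulr0 //; have a0 := exprn_gt0 2 R0.
have d2 : radius8 T ^+ 2 <= dist z * dist z.
  have -> : dist z * dist z = `|dist z| ^+ 2 by rewrite real_normK ?num_real // expr2.
  by apply: lerXn2r => //; rewrite nnegrE ltW.
by rewrite -[leLHS]mulr1; apply: ler_wpM2l => //; rewrite ler_pdivlMr // mul1r.
Qed.

Lemma profile_continuous : continuous (zero_ext Om F).
Proof.
apply: (zero_ext_continuous r_lt) => [z Oz|]; last exact: profile_vanishes.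
apply: (@continuousM _ _ E); first exact: (tube_divergence_continuous localized_C1T Oz).
apply: (C1_continuous (U := Om) _ Oz); apply: C1_plateau => //; apply: C1Z => //.
have dC := @C1_dist _ _ _ _ _ p T.
by apply: C1M => //; [exact: C1M|exact: C1_cst].
Qed.

Lemma slab_divergence eps : 0 < eps -> eps <= radius8 T ->
  integrand (zero_ext Om (fun z => bump (dist z / eps) * E z)) /\
  I (zero_ext Om (fun z => bump (dist z / eps) * E z)) = 0.
Proof.
move=> e0 er; pose f z := bump (dist z / eps) * localized (foot z).
have Cb : C1 Om (fun z => bump (dist z / eps)) by apply: C1_bump => //; exact: C1_scaled.
have lC := @localized_C1T p T.
have fC : C1 Om f by exact: C1M.
have f0 : vanishes_outside (X p) (tube_radius T) r f.
  move=> z Oz rz; rewrite /f mulrC.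
  apply: (wide_vanishes g1 (g := fun t => bump (t / eps)) localized_wide _ Oz rz) => t.
  exact: bump_far.
have [] := @flat_divergence R n.+1 (X p) (tube_radius T) r r0 r_lt I ID IZ Ider (fun z => f z *: Zf T z).
- move=> a; apply: (C1_ext oOm (f := fun z => f z * Zf T z 0 a)) => [z _|]; first by rewrite mxE.
  by apply: C1M => //; exact: ZC.
- by move=> a z Oz rz; rewrite mxE f0 // mul0r.
suff -> : zero_ext (ball (X p) (tube_radius T)) (flat_div (fun z => f z *: Zf T z)) =
   zero_ext Om (fun z => bump (dist z / eps) * E z) by [].
apply/funext => z; rewrite /zero_ext -/(tube_ball T) -/Om; case: asboolP => // Oz.
have [df _] := fC z Oz; have [db _] := Cb z Oz; have [dl _] := lC z Oz.
have [dse _] := C1_scaled eps Oz; have [dd _] := C1_dist Oz.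
rewrite flat_divM //; last by move=> a; have [] := ZC (T := T) a Oz.
have -> : pd (Zf T z) f z = bump (dist z / eps) * pd (Zf T z) (fun z => localized (foot z)) z.
  rewrite (pdM _ db dl).
  have bd : derivable (bump : R -> R) (dist z / eps) 1.
    apply: diff_derivable.
    have idC : C1 [set: R] (fun x : R => x).
      move=> x _; split=> [|v]; first exact: ex_diff.
      have -> : pd v (fun x : R => x) = cst v by apply/funext => y; rewrite pdxE derive_id.
      exact: cst_continuous.
    by have [] := C1_bump (@openT R) idC (x := dist z / eps) Logic.I.
  have bd' := derivableP bd.
  rewrite (pd_comp1 (f := fun z => tube_dist T z / eps) _ bd' dse) (pdM _ dd (differentiable_cst _ _)) pd_cst mulr0 addr0.
  by rewrite tube_dist_derivative // ZN // mul0r mulr0 mul0r add0r.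
by rewrite /f /E /tube_divergence_of; ring.
Qed.

Lemma foot_close z : Om z -> center_dist2 X p (foot z) <= radius8 T ^+ 2 ->
  surface_divergence localized (foot z) = E (X (foot z)) /\
  F (X (foot z)) = E (X (foot z)) /\ Om (X (foot z)).
Proof.
move=> Oz h; have sz := tube_foot_sheet Oz.
have O1 : Om (X (foot z)).
  apply: (near_center_small (b := 2 * radius8 T)) => //; apply: wide_norm.
  by apply: (le_lt_trans h); have := exprn_gt0 2 R0; lra.
split; first exact: surface_divergenceE.
split=> //; have [_ d0] := tube_sheetE sz O1.
by rewrite /F -[dist _]/(tube_dist T _) d0 mul0r mul0r mulr0 plateau1 ?mulr1 // ler01.
Qed.

(* The field [bump (t / eps) * psi * Zf] is tangent to the levels of [t], hence its divergence is
   [bump (t / eps)] times a function which restricts to the surface divergence for [t = 0]. *)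
Lemma area_localized : area X gamma I L (surface_divergence localized) = 0.
Proof.
have lC := localized_C1T; have sc := surface_divergence_continuous lC.
have Bw : wide T B := sheet_cutoff_wide (lexx 1).
have BC : C1 Om (fun z => B (foot z)) := sheet_cutoff_C1T Xc T (lexx 1) (T := T).
have [K hK] := weight_upper g1 ID IZ Ige0 Ider Bw BC (sheet_cutoff01 T 1).
have R20 : 0 < radius8 T / 2 by rewrite divr_gt0.
have K0 : 0 <= K by have /andP[h1 h2] := hK _ R20 (lexx _); exact: le_trans h2.
have K1 : 0 < K + 1 by lra.
apply: Lcvg; apply/cvgr0Pnorm_le => e e0.
have d0 : 0 < e / (K + 1) by rewrite divr_gt0.
set dl := e / (K + 1) in d0 *.
have supp z : `|X p| + r < `|z| -> zero_ext Om F z = 0.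
  by move=> h; exact: (zero_ext_support profile_vanishes h).
have [d dp hd] := compact_support_uniform profile_continuous supp d0.
have s1 := mesh_small R20; have s2 := mesh_small (tube_height_gt0 T); have s3 := mesh_small dp.
have s23 : \forall m \near \oo, mesh m <= tube_height T /\ mesh m <= d by exact: filterI.
apply: filterS3 s1 s23 (push_wide_near g1 sc surface_localized_wide) => m m1 [m2 m3] [pi pE].
have m0 := @mesh_gt0 R m; have m8 : mesh m <= radius8 T by lra.
have wi := weight_integrand g1 Bw BC m0 m8.
have [si sE] := slab_divergence m0 m8.
have /andP[_ hKm] := hK _ m0 m1.
(* Used with c = 1 and c = -1 to bound the absolute value. The integral of bump times E is 0 and may
   be subtracted; there remains E at the foot minus E at z, which is at most dl because z is within
   a mesh of its foot. *)
have H (c : R) : `|c| = 1 -> c * I (push X gamma (mesh m) (surface_divergence localized)) <=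
    dl * I (zero_ext Om (collar_weight T B (mesh m))).
  move=> c1; rewrite -[I (push _ _ _ _)]addr0 -[X in _ + X](mulr0 (-1)) -{1}sE -!IZ //.
  rewrite -ID //; last exact: integrandZ.
  rewrite -IZ; last by apply: integrandD => //; exact: integrandZ.
  apply: (I_le ID IZ Ige0).
  - by apply: integrandZ; apply: integrandD => //; exact: integrandZ.
  - exact: integrandZ.
  move=> z; rewrite pE /zero_ext -/(tube_ball T) -/Om; case: asboolP => [Oz|_]; last first.
    by rewrite !mulr0 addr0 mulr0.
  rewrite /collar_weight -/foot -/dist.
  have [->|bn] := eqVneq (bump (dist z / mesh m)) 0; first by rewrite !(mul0r, mulr0) addr0 mulr0.
  have b0 := bump_ge0 (dist z / mesh m).
  have t0 : 0 < dist z.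
    rewrite ltNge; apply/negP => t0; move/eqP: bn; apply.
    by rewrite bump_neg // pmulr_lle0 ?invr_gt0.
  have te : dist z < mesh m.
    rewrite ltNge; apply/negP => te; move/eqP: bn; apply.
    by rewrite bump_large // ler_pdivlMr // mul1r.
  suff key : c * (surface_divergence localized (foot z) - E z) <= dl * B (foot z).
    have := ler_wpM2r b0 key; set S := surface_divergence _ _.
    have -> : c * (S * bump (dist z / mesh m) + -1 * (bump (dist z / mesh m) * E z)) =
      c * (S - E z) * bump (dist z / mesh m) by ring.
    by rewrite (mulrA dl).
  have [far|cl] := ltP (radius8 T ^+ 2) (center_dist2 X p (foot z)).
    rewrite localized_far // subr0.
    have -> : surface_divergence localized (foot z) = 0.
      by apply/eqP; apply/negPn/negP => /surface_localized_support[_]; rewrite leNgt far.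
    by rewrite mulr0 mulr_ge0 ?(ltW d0) // sheet_cutoff_ge0.
  have [-> [FE O1]] := foot_close Oz cl.
  rewrite cutoff1_in ?mulr1 //; last exact: tube_foot_sheet.
  have EF : E z = F z.
    rewrite /F plateau1 ?mulr1 // mulrA ler_pdivrMr ?exprn_gt0 // mul1r.
    have : dist z * dist z <= (radius8 T / 2) * (radius8 T / 2).
      by apply: ler_pM; rewrite ?(ltW t0) // (le_trans (ltW te)).
    by have := sqr_ge0 (radius8 T); rewrite expr2; lra.
  have kn : `|- (dist z *: tube_normal T z)| < d.
    rewrite normrN normrZ (gtr0_norm t0).
    apply: (le_lt_trans _ (lt_le_trans te m3)); rewrite -[leRHS]mulr1.
    by apply: ler_wpM2l; [exact: ltW|exact: (gamma_norm g1)].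
  apply: (le_trans (ler_norm _)); rewrite normrM c1 mul1r -FE EF.
  have := hd z _ kn; rewrite -(tube_footE Oz) !zero_ext_in //.
rewrite /area_sum normrM (ger0_norm (_ : 0 <= (mesh m)^-1)) ?invr_ge0 ?(ltW m0) //.
apply: (@le_trans _ _ ((mesh m)^-1 * (dl * I (zero_ext Om (collar_weight T B (mesh m)))))).
  apply: ler_wpM2l; first by rewrite invr_ge0 ltW.
  rewrite ler_norml; apply/andP; split; last by have := H 1 (normr1 _); rewrite mul1r.
  by rewrite lerNl; have := H (-1) (normrN1 _); rewrite mulN1r.
rewrite mulrCA; apply: (@le_trans _ _ (dl * (K + 1))).
  by apply: ler_wpM2l; [exact: ltW|lra].
by rewrite /dl divfK // gt_eqF.
Qed.

End LocalDivergence.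

(** By [local_induction] for the class of C^1 functions vanishing off K: factors 1 - chi_p preserve
    it, and [area_localized] settles the local summands. *)
Theorem area_divergence psi (K : set M) : C1T X gamma psi -> compact K ->
  (forall q, psi q != 0 -> K q) ->
  measurable_density X gamma I (surface_divergence psi) /\
  area X gamma I L (surface_divergence psi) = 0.
Proof.
move=> psiC cK psiK.
have clK : closed K by apply: compact_closed => //; exact: manifold_hausdorff.
have md f : C1T X gamma f -> (forall q, f q != 0 -> K q) ->
    measurable_density X gamma I (surface_divergence f).
  move=> fC fK; apply: (continuous_density Xc g1 ID IZ Ige0 Ider LD LZ Lge0 TB (K := K)) => //.
    exact: surface_divergence_continuous.
  move=> q h; apply: contrapT => nKq; move/eqP: h; apply; apply: surface_divergence_zero.
  have nK : \forall q' \near q, (~` K) q'.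
    by apply: open_nbhs_nbhs; split=> //; exact: closed_openC.
  by apply: filterS nK => q' nq'; apply/eqP; apply/negPn/negP => /fK.
suff [_ h] : C1T X gamma psi /\ (measurable_density X gamma I (surface_divergence psi) /\
   area X gamma I L (surface_divergence psi) = 0) by [].
apply: (local_induction Xc (TB := TB)
  (Q := fun f => C1T X gamma f /\ (measurable_density X gamma I (surface_divergence f) /\
   area X gamma I L (surface_divergence f) = 0))
  (F := fun f => C1T X gamma f /\ forall q, f q != 0 -> K q) _ _ _ _ cK psiK).
- have C0 : C1T X gamma (fun=> 0) by move=> p T; exact: C1_cst.
  split=> //; have -> : surface_divergence (fun=> 0) = (fun=> 0).
    by apply/funext => q; apply: surface_divergence_zero; exact: nearW.
  exact: (density0 X gamma IZ LZ).
- move=> f g [fC [fd f0]] [gC [gd g0]]; split.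
    by move=> p T; apply: C1D; [exact: tube_ball_open|exact: fC|exact: gC].
  rewrite surface_divergenceD //.
  have [h1 h2] := densityD ID LD LZ Lge0 fd gd; split; first exact: h1.
  by rewrite h2 f0 g0 addr0.
- move=> p f [fC fK]; split=> [p' T'|q].
    apply: C1M; [exact: tube_ball_open|exact: fC|].
    apply: C1B; [exact: tube_ball_open|exact: C1_cst|].
    by apply: sheet_cutoff_C1T => //; rewrite ler1n.
  by rewrite mulf_eq0 negb_or => /andP[/fK].
- move=> p f [fC fK]; have lC := localized_C1T p fC; split; first exact: lC.
  split; last exact: area_localized.
  apply: md => // q; rewrite /localized mulf_eq0 negb_or.
  by move=> /andP[/fK].
by split.
Qed.

End AreaDivergence.

(** * Weighted estimates *)

Lemma pd_div {R : realType} {V : normedModType R} v (c : R) (f : V -> R) x :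
  differentiable f x -> pd v (fun y => f y / c) x = pd v f x / c.
Proof.
move=> df; rewrite (_ : (fun y => f y / c) = (fun y => c^-1 * f y)).
  by rewrite pdZ // mulrC.
by apply/funext => y; rewrite mulrC.
Qed.

Section CompactSupport.
Context {R : realType} {M : topologicalType}.
Implicit Types f g : M -> R.

Definition Cc f := continuous f /\ exists2 K : set M, compact K & forall q, f q != 0 -> K q.

Lemma CcM f g : Cc f -> continuous g -> Cc (fun q => f q * g q).
Proof.
move=> [fc [K cK fK]] gc; split; first by move=> q; apply: (@continuousM _ _ f g); [exact: fc|exact: gc].
by exists K => // q; rewrite mulf_eq0 negb_or => /andP[/fK].
Qed.

Lemma CcZ (c : R) f : Cc f -> Cc (fun q => c * f q).
Proof.
move=> /CcM/(_ (@cst_continuous _ _ c)) h.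
by rewrite (_ : (fun q => _) = (fun q => f q * c)) //; apply/funext => q; rewrite mulrC.
Qed.

Lemma CcD f g : Cc f -> Cc g -> Cc (fun q => f q + g q).
Proof.
move=> [fc [K cK fK]] [gc [K' cK' gK]]; split.
  by move=> q; apply: (@continuousD _ _ _ f g); [exact: fc|exact: gc].
exists (K `|` K'); first exact: compactU.
move=> q h; have [E|/fK] := eqVneq (f q) 0; last by left.
by right; apply: gK; move: h; rewrite E add0r.
Qed.

End CompactSupport.

Section AreaFunctional.
Context {R : realType} {n : nat} {M : smooth_manifold R n}.
Variables (X gamma : M -> 'rV[R]_n.+1).
Hypothesis Xc : continuous X.
Hypothesis g1 : forall q, dotp (gamma q) (gamma q) = 1.
Variable TB : forall p, tube X gamma p.

Definition tangent_family (Zf : forall p, tube X gamma p -> 'rV[R]_n.+1 -> 'rV[R]_n.+1) :=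
  [/\ forall p (T : tube X gamma p) a, C1 (tube_ball T) (fun z => Zf p T z 0 a),
    forall p (T : tube X gamma p) z, tube_ball T z -> dotp (tube_normal T z) (Zf p T z) = 0 &
    forall p p' (T : tube X gamma p) (T' : tube X gamma p') q,
      tube_sheet T q -> tube_ball T (X q) -> tube_sheet T' q -> tube_ball T' (X q) ->
      \forall z \near X q, Zf p T z = Zf p' T' z].

(** All that the estimates use of integration over M. No normalization is required, so the
    functional need not be identified with the area measure. *)
Definition area_functional (J : (M -> R) -> R) :=
  [/\ forall f g, Cc f -> Cc g -> J (fun q => f q + g q) = J f + J g,
    forall c f, Cc f -> J (fun q => c * f q) = c * J f,
    forall f, Cc f -> (forall q, 0 <= f q) -> 0 <= J f,
    forall f p, Cc f -> (forall q, 0 <= f q) -> 0 < f p -> 0 < J f &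
    forall Zf psi, tangent_family Zf -> C1T X gamma psi -> Cc psi ->
      Cc (surface_divergence TB Zf psi) /\ J (surface_divergence TB Zf psi) = 0].

Theorem area_functional_exists : exists J, area_functional J.
Proof.
have [I [ID IZ I0 Ip Id]] := @euclidean_integral R n.+1.
have [L [LD LZ L0 Lc Lcvg]] := @generalized_limit R.
have dens f : Cc f -> measurable_density X gamma I f.
  by move=> [fc [K cK fK]]; exact: (continuous_density Xc g1 ID IZ I0 Id LD LZ L0 TB fc cK fK).
exists (area X gamma I L); split.
- by move=> f g /dens df /dens dg; have [] := densityD ID LD LZ L0 df dg.
- by move=> c f /dens df; have [] := densityZ IZ LD LZ L0 c df.
- by move=> f /dens df f0; exact: (area_ge0 I0 L0).
- move=> f p [fc [K cK fK]] f0 fp.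
  exact: (area_gt0 Xc g1 ID IZ I0 Ip Id LD LZ L0 Lc TB fc cK fK f0 fp).
move=> Zf psi [ZC ZN ZA] psiC [_ [K cK psiK]].
have [_ J0] := area_divergence Xc g1 ID IZ I0 Id LD LZ L0 Lcvg TB ZC ZN ZA psiC cK psiK.
split=> //; split; first exact: (surface_divergence_continuous Xc ZC ZA psiC).
exists K => // q h; apply: contrapT => nKq; move/eqP: h; apply; apply: surface_divergence_zero.
have nK : \forall q' \near q, (~` K) q'.
  apply: open_nbhs_nbhs; split=> //; apply: closed_openC.
  by apply: compact_closed => //; exact: manifold_hausdorff.
by apply: filterS nK => q' nq'; apply/eqP; apply/negPn/negP => /psiK.
Qed.

End AreaFunctional.

Section WeightedEstimates.
Context {R : realType} {n : nat} {M : smooth_manifold R n}.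
Variables (X gamma : M -> 'rV[R]_n.+1).
Hypothesis Xc : continuous X.
Hypothesis Xp : proper_map X.
Hypothesis g1 : forall q, dotp (gamma q) (gamma q) = 1.
Variable TB : forall p, tube X gamma p.
Variable J : (M -> R) -> R.
Hypothesis areaJ : area_functional TB J.
Hypothesis n0 : (0 < n)%N.

Let JD f g : Cc f -> Cc g -> J (fun q => f q + g q) = J f + J g.
Proof. by move: f g; have [] := areaJ. Qed.
Let JZ c f : Cc f -> J (fun q => c * f q) = c * J f.
Proof. by move: c f; have [] := areaJ. Qed.
Let J0 f : Cc f -> (forall q, 0 <= f q) -> 0 <= J f.
Proof. by move: f; have [] := areaJ. Qed.

Lemma area_le f g : Cc f -> Cc g -> (forall q, f q <= g q) -> J f <= J g.
Proof.
move=> fc gc fg; have nc := CcZ (-1) fc.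
have : 0 <= J (fun q => g q + -1 * f q).
  by apply: J0 => [|q]; [exact: CcD|rewrite mulN1r subr_ge0].
by rewrite JD // JZ // mulN1r subr_ge0.
Qed.

Definition sqdist q := dotp (X q) (X q).
Definition gauss q := expR (- (sqdist q / 4)).
(** This is (1 - x^2)_+^2 with x = |X|^2 / t, and [cutoff'] is its derivative in x. Its gradient is
    2 / t times [cutoff'] times the tangential part of X. *)
Definition cutoff (t : R) q := pospow 2 (1 - sqdist q / t * (sqdist q / t)).
Definition cutoff' (t : R) q := - (4 * (sqdist q / t)) * pospow 1 (1 - sqdist q / t * (sqdist q / t)).

Lemma sqdist_ge0 q : 0 <= sqdist q. Proof. exact: dotp_ge0. Qed.
Lemma gauss_gt0 q : 0 < gauss q. Proof. exact: expR_gt0. Qed.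
Lemma gauss_ge0 q : 0 <= gauss q. Proof. exact/ltW/gauss_gt0. Qed.
Lemma cutoff_ge0 t q : 0 <= cutoff t q. Proof. exact: pospow_ge0. Qed.

Lemma cutoff_le1 t q : cutoff t q <= 1.
Proof.
rewrite /cutoff; set x := sqdist q / t; have x0 : 0 <= x * x by rewrite -expr2 sqr_ge0.
have [h|h] := leP (1 - x * x) 0; first by rewrite pospow_neg ?ler01.
by rewrite (pospow_pos _ (ltW h)) exprn_ile1 ?(ltW h) //; lra.
Qed.

Lemma cutoff_large t q : 0 < t -> t <= sqdist q -> cutoff t q = 0 /\ cutoff' t q = 0.
Proof.
move=> t0 h; rewrite /cutoff /cutoff'; have x1 : 1 <= sqdist q / t by rewrite ler_pdivlMr // mul1r.
have le : 1 - sqdist q / t * (sqdist q / t) <= 0.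
  by rewrite subr_le0 -[leLHS]mulr1; apply: ler_pM.
by rewrite (@pospow_neg R 1) // (@pospow_neg R 0) // mulr0.
Qed.

Lemma cutoff'_le0 t q : 0 < t -> cutoff' t q <= 0.
Proof.
move=> t0; rewrite /cutoff' mulNr oppr_le0 mulr_ge0 ?pospow_ge0 // mulr_ge0 //.
by rewrite divr_ge0 ?sqdist_ge0 // ltW.
Qed.

(** The bound |grad chi|^2 <= 64 chi / t in disguise: with test function chi^2, the error in
    [caccioppoli] is controlled by the first power of chi, hence by [volume_bound]. *)
Lemma cutoff'_sqr t q : 0 < t -> cutoff' t q ^+ 2 * (sqdist q / t) <= 16 * cutoff t q.
Proof.
move=> t0; have [h|h] := leP t (sqdist q).
  by have [-> ->] := cutoff_large t0 h; rewrite expr0n mul0r mulr0.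
rewrite /cutoff' /cutoff; set x := sqdist q / t.
have x0 : 0 <= x by rewrite divr_ge0 ?sqdist_ge0 // ltW.
have x1 : x <= 1 by rewrite ler_pdivrMr // mul1r ltW.
have -> : (- (4 * x) * pospow 1 (1 - x * x)) ^+ 2 * x =
  (x ^+ 3) * (16 * pospow 2 (1 - x * x)) :> R.
  by rewrite /pospow expr1; ring.
rewrite -[leRHS]mul1r; apply: ler_wpM2r; first by rewrite mulr_ge0 // pospow_ge0.
by apply: exprn_ile1.
Qed.

Lemma cutoff_mono t t' q : 0 < t -> t <= t' -> cutoff t q <= cutoff t' q.
Proof.
move=> t0 tt'; have t'0 := lt_le_trans t0 tt'.
have s0 := sqdist_ge0 q.
have le : sqdist q / t' <= sqdist q / t.
  by apply: ler_wpM2l => //; rewrite lef_pV2 ?posrE.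
have a0 : 0 <= sqdist q / t' by rewrite divr_ge0 // ltW.
have le2 : sqdist q / t' * (sqdist q / t') <= sqdist q / t * (sqdist q / t) by apply: ler_pM.
have h : 1 - sqdist q / t * (sqdist q / t) <= 1 - sqdist q / t' * (sqdist q / t') by lra.
rewrite /cutoff /pospow; apply: lerXn2r; [by rewrite nnegrE le_max lexx|by rewrite nnegrE le_max lexx|].
by rewrite ge_max !le_max lexx h orbT.
Qed.

Lemma cutoff_gt0 t q : sqdist q < t -> 0 < cutoff t q.
Proof.
move=> h; have s0 := sqdist_ge0 q; have t0 : 0 < t := le_lt_trans s0 h.
have x1 : sqdist q / t < 1 by rewrite ltr_pdivrMr // mul1r.
have x0 : 0 <= sqdist q / t by rewrite divr_ge0 // ltW.
have lt : 0 < 1 - sqdist q / t * (sqdist q / t).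
  rewrite subr_gt0; apply: (le_lt_trans _ x1); rewrite -[leRHS]mulr1.
  by apply: ler_wpM2l => //; exact: ltW.
by rewrite /cutoff pospow_pos ?(ltW lt) // exprn_gt0.
Qed.

Lemma C1T_normal a : C1T X gamma (fun q => gamma q 0 a).
Proof. by move=> p T; exact: C1_normal. Qed.

Lemma C1T_sqdist : C1T X gamma sqdist.
Proof.
move=> p T; have oT := @tube_ball_open _ _ _ _ _ p T.
have H : C1 (tube_ball T) (fun z => \sum_(a < n.+1) X (tube_foot T z) 0 a * X (tube_foot T z) 0 a).
  by apply: C1_sum => // a; apply: C1M => //; exact: C1_foot.
by apply: (C1_ext oT _ H) => z _; rewrite /sqdist dotpE.
Qed.

Lemma C1T_exponent : C1T X gamma (fun q => - (sqdist q / 4)).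
Proof.
move=> p T; have oT := @tube_ball_open _ _ _ _ _ p T.
by apply: C1N => //; apply: C1M => //; [exact: C1T_sqdist|exact: C1_cst].
Qed.

Lemma C1T_gauss : C1T X gamma gauss.
Proof.
move=> p T; have oT := @tube_ball_open _ _ _ _ _ p T.
apply: (C1_comp (g := @expR R) (dg := @expR R) oT); first exact: C1T_exponent.
by move=> z _; split; [exact: is_derive_expR|exact: continuous_expR].
Qed.

Lemma C1T_cutoff_arg t : C1T X gamma (fun q => 1 - sqdist q / t * (sqdist q / t)).
Proof.
move=> p T; have oT := @tube_ball_open _ _ _ _ _ p T.
have H : C1 (tube_ball T) (fun z => sqdist (tube_foot T z) / t).
  by apply: C1M => //; [exact: C1T_sqdist|exact: C1_cst].
by apply: C1B => //; [exact: C1_cst|exact: C1M].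
Qed.

Lemma C1T_cutoff t : C1T X gamma (cutoff t).
Proof. by move=> p T; apply: C1_pospow; [exact: tube_ball_open|exact: C1T_cutoff_arg]. Qed.

Lemma Cc_cutoff t : 0 < t -> Cc (cutoff t).
Proof.
move=> t0; split; first exact: (C1T_continuous Xc TB (@C1T_cutoff t)).
exists (X @^-1` [set z | `|z| <= t + 1]); first by apply: Xp; exact: compact_ball_row.
move=> q h /=; rewrite leNgt; apply/negP => h'.
move/eqP: h; apply; apply: (cutoff_large t0 _).1.
have s := norm_sqr_le_dotp (X q); rewrite -/(sqdist q) in s.
apply: (le_trans _ s); apply: (@le_trans _ _ ((t + 1) ^+ 2)).
  by rewrite expr2; nra.
by apply: lerXn2r; rewrite ?nnegrE ?normr_ge0 ?(ltW h') // addr_ge0 // ltW.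
Qed.

Lemma gauss_continuous : continuous gauss.
Proof. exact: (C1T_continuous Xc TB C1T_gauss). Qed.

Section ZeroLevel.
Variables (p : M) (T : tube X gamma p) (z v : 'rV[R]_n.+1).
Hypotheses (Oz : tube_ball T z) (dz : tube_dist T z = 0).
Hypothesis zv : dotp (tube_normal T z) v = 0.

Lemma foot_zero_level : X (tube_foot T z) = z.
Proof. by rewrite tube_footE // dz scale0r subr0. Qed.

(** On the zero level the derivative of X o foot is the tangential projection, and v is
    tangential. *)
Lemma pd_foot a : pd v (fun y => X (tube_foot T y) 0 a) z = v 0 a.
Proof.
have oT := @tube_ball_open _ _ _ _ _ p T.
have [d1 _] := C1_dist Oz; have [d2 _] := C1_normal a Oz.
rewrite (pd_ext v oT (g := fun y : 'rV[R]_n.+1 => y 0 a - tube_dist T y * tube_normal T y 0 a) _ Oz).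
  rewrite pdB; [|exact: differentiable_coord|exact: differentiableM].
  by rewrite pd_coord (pdM _ d1 d2) tube_dist_derivative // zv dz !mul0r addr0 subr0.
by move=> y Oy; rewrite tube_footE // !mxE.
Qed.

Lemma pd_sqdist : pd v (fun y => sqdist (tube_foot T y)) z = 2 * dotp z v.
Proof.
have dX a : differentiable (fun y => X (tube_foot T y) 0 a) z by have [] := C1_foot a Oz.
have -> : (fun y => sqdist (tube_foot T y)) =
    (fun y => \sum_a X (tube_foot T y) 0 a * X (tube_foot T y) 0 a).
  by apply/funext => y; rewrite /sqdist dotpE.
rewrite pd_sum; last by move=> a; exact: differentiableM.
rewrite dotpE mulr_sumr; apply: eq_bigr => a _.
by rewrite (pdM _ (dX a) (dX a)) pd_foot foot_zero_level; ring.
Qed.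

Lemma pd_gauss : pd v (fun y => gauss (tube_foot T y)) z =
  - (2^-1 * dotp z v * gauss (tube_foot T z)).
Proof.
have [ds _] := C1T_sqdist Oz; have [de _] := C1T_exponent Oz.
rewrite (pd_comp1 (f := fun y => - (sqdist (tube_foot T y) / 4)) _ (is_derive_expR _) de).
have dq : differentiable (fun y => sqdist (tube_foot T y) / 4) z.
  by apply: differentiableM => //; exact: differentiable_cst.
rewrite (pdN _ dq) (pd_div _ _ ds) pd_sqdist /gauss.
by field.
Qed.

Lemma pd_cutoff t : 0 < t -> pd v (fun y => cutoff t (tube_foot T y)) z =
  2 * cutoff' t (tube_foot T z) / t * dotp z v.
Proof.
move=> t0; have [ds _] := C1T_sqdist Oz; have [de _] := C1T_cutoff_arg t Oz.
rewrite (pd_comp1 (f := fun y => 1 - sqdist (tube_foot T y) / t * (sqdist (tube_foot T y) / t)) _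
  (is_derive_pospow 0 _) de).
have dq : differentiable (fun y => sqdist (tube_foot T y) / t) z.
  by apply: differentiableM => //; exact: differentiable_cst.
rewrite (pdB _ (differentiable_cst _ _) (differentiableM dq dq)) pd_cst (pdM _ dq dq).
rewrite (pd_div _ _ ds) pd_sqdist /cutoff'.
by field; rewrite gt_eqF.
Qed.

End ZeroLevel.

Definition position_field p (T : tube X gamma p) (z : 'rV[R]_n.+1) : 'rV[R]_n.+1 :=
  z - dotp z (tube_normal T z) *: tube_normal T z.

Lemma C1_support p (T : tube X gamma p) : C1 (tube_ball T) (fun z => dotp z (tube_normal T z)).
Proof.
have oT := @tube_ball_open _ _ _ _ _ p T.
have H : C1 (tube_ball T) (fun z => \sum_(a < n.+1) z 0 a * tube_normal T z 0 a).
  apply: C1_sum => // a; apply: C1M => //; last exact: C1_normal.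
  exact/Ck_C1/Ck_coord.
by apply: (C1_ext oT _ H) => z _; rewrite dotpE.
Qed.

Lemma near_normal p p' (T : tube X gamma p) (T' : tube X gamma p') q :
  tube_sheet T q -> tube_ball T (X q) -> tube_sheet T' q -> tube_ball T' (X q) ->
  \forall z \near X q, tube_normal T z = tube_normal T' z.
Proof.
move=> sq Oq sq' Oq'; apply: filterS (tube_agree sq Oq sq' Oq') => z [fz _].
by rewrite /tube_normal fz.
Qed.

Lemma position_family : tangent_family position_field.
Proof.
split.
- move=> p T a; have oT := @tube_ball_open _ _ _ _ _ p T.
  apply: (C1_ext oT (f := fun z : 'rV[R]_n.+1 => z 0 a - dotp z (tube_normal T z) * tube_normal T z 0 a)).
    by move=> z _; rewrite !mxE.
  apply: C1B => //; first exact/Ck_C1/Ck_coord.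
  by apply: C1M => //; [exact: C1_support|exact: C1_normal].
- move=> p T z Oz; rewrite /position_field dotpBr dotpZr tube_normal1 //.
  by rewrite mulr1 dotpC subrr.
move=> p p' T T' q sq Oq sq' Oq'; apply: filterS (near_normal sq Oq sq' Oq') => z Nz.
by rewrite /position_field Nz.
Qed.

(** div z = n + 1, and div (k N) = d_N k + k div N with k = <z, N>: here d_N k = 1 because N is
    constant along normals, and div N = k / 2. *)
Lemma position_divergence p (T : tube X gamma p) z : tube_ball T z -> tube_dist T z = 0 ->
  flat_div (position_field T) z = n%:R - 2^-1 * dotp z (tube_normal T z) ^+ 2.
Proof.
move=> Oz dz; have [dk _] := C1_support Oz.
have dN a : differentiable (fun y => tube_normal T y 0 a) z by have [] := C1_normal a Oz.
have dI a : differentiable (fun y : 'rV[R]_n.+1 => y 0 a) z by exact: differentiable_coord.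
have -> : flat_div (position_field T) z = flat_div id z -
    flat_div (fun y => dotp y (tube_normal T y) *: tube_normal T y) z.
  rewrite /flat_div -sumrB; apply: eq_bigr => a _; rewrite -pdB //.
    by congr (pd _ _ z); apply/funext => y; rewrite !mxE.
  rewrite (_ : (fun y : 'rV[R]_n.+1 => _) = (fun y => dotp y (tube_normal T y) * tube_normal T y 0 a)).
    exact: differentiableM.
  by apply/funext => y; rewrite mxE.
rewrite flat_divM //.
have -> : flat_div id z = n.+1%:R.
  rewrite /flat_div (eq_bigr (fun=> 1)); first by rewrite sumr_const card_ord.
  by move=> a _; rewrite pd_coord mxE !eqxx.
have -> : pd (tube_normal T z) (fun y => dotp y (tube_normal T y)) z = 1.
  have -> : (fun y => dotp y (tube_normal T y)) = (fun y : 'rV[R]_n.+1 => \sum_a y 0 a * tube_normal T y 0 a).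
    by apply/funext => y; rewrite dotpE.
  rewrite pd_sum; last by move=> a; exact: differentiableM.
  rewrite -(tube_normal1 g1 Oz) dotpE; apply: eq_bigr => a _.
  rewrite (pdM _ (dI a) (dN a)) pd_coord.
  rewrite (pd_normal_coord (tube_ball_open (T := T)) (tube_dist_smooth T)
    (fun z v => @tube_dist_derivative _ _ _ _ _ p T z v) (tube_normal1 g1 (T := T)) a Oz).
  by rewrite mulr0 addr0.
have -> : flat_div (tube_normal T) z = 2^-1 * dotp z (tube_normal T z) by exact: tube_divergence.
by rewrite -natr1; ring.
Qed.

(** The term - <X, Z> / 2 is the logarithmic derivative of [gauss] along Z; it cancels the drift
    terms in the flat divergences of the fields below. *)
Lemma weighted_divergence Zf psi q : tangent_family Zf -> C1T X gamma psi ->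
  let Z := Zf q (TB q) (X q) in
  surface_divergence TB Zf (fun q => gauss q * psi q) q =
  gauss q * (pd Z (fun y => psi (tube_foot (TB q) y)) (X q) +
     psi q * (flat_div (Zf q (TB q)) (X q) - 2^-1 * dotp (X q) Z)).
Proof.
move=> [ZC ZN ZA] psiC Z; have Oq := tube_center_in (TB q).
have [fq dq] := tube_center (TB q).
have [dg _] := C1T_gauss Oq; have [dp _] := psiC q (TB q) _ Oq.
have ZNq : dotp (tube_normal (TB q) (X q)) Z = 0 by exact: ZN.
rewrite /surface_divergence /tube_divergence_of (pdM _ dg dp) -/Z (pd_gauss Oq dq ZNq) fq.
by ring.
Qed.

(** A fixed function supported in |X|^2 <= 3 n. The constants come from 1 = 3 (1 - s / (3 n)) - (2 /
    n) (n - s / 2) with s = |X|^2, where n - s / 2 is the weighted divergence of the tangential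
    position field. *)
Definition volume_density q := gauss q * (3 * pospow 1 (1 - sqdist q / (3 * n%:R))).

(* Testing with the tangential part of the position field, whose weighted divergence is
   [gauss * (n - sqdist / 2)]. *)
Lemma volume_bound t : 0 < t -> J (fun q => cutoff t q * gauss q) <= J volume_density.
Proof.
move=> t0; have nR : 0 < n%:R :> R by rewrite ltr0n.
have cC := Cc_cutoff t0; have gC := gauss_continuous.
have wC : Cc (fun q => cutoff t q * gauss q) by exact: CcM.
have sC : continuous sqdist by exact: (C1T_continuous Xc TB C1T_sqdist).
have argC : continuous (fun q => 1 - sqdist q / (3 * n%:R)).
  move=> q; apply: (@continuousB _ _ _ (fun=> 1 : R) (fun q => sqdist q / (3 * n%:R))).
    exact: cst_continuous.
  by apply: (@continuousM _ _ sqdist (fun=> (3 * n%:R)^-1)); [exact: sC|exact: cst_continuous].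
have zC : continuous (fun q => 3 * pospow 1 (1 - sqdist q / (3 * n%:R))).
  move=> q; apply: (@continuousM _ _ (fun=> 3 : R) (fun q => pospow 1 (1 - sqdist q / (3 * n%:R)))); first exact: cst_continuous.
  apply: (@continuous_comp _ _ _ (fun q => 1 - sqdist q / (3 * n%:R)) (pospow 1)); first exact: argC.
  exact: pospow_continuous.
have vC : Cc volume_density.
  split; first by move=> q; apply: (@continuousM _ _ gauss (fun q => 3 * pospow 1 (1 - sqdist q / (3 * n%:R)))); [exact: gC|exact: zC].
  pose t1 := 3 * n%:R : R; have t10 : 0 < t1 by rewrite mulr_gt0.
  have [_ [K cK hK]] := Cc_cutoff t10; exists K => // q h; apply: hK.
  rewrite gt_eqF //; apply: cutoff_gt0; rewrite ltNge; apply/negP => le; move/eqP: h; apply.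
  rewrite /volume_density (@pospow_neg R 0) ?mulr0 // subr_le0 ler_pdivlMr ?mul1r //.
have posF := position_family.
have psiC : C1T X gamma (fun q => gauss q * cutoff t q).
  by move=> p T; apply: C1M; [exact: tube_ball_open|exact: C1T_gauss|exact: C1T_cutoff].
have wE : (fun q => cutoff t q * gauss q) = (fun q => gauss q * cutoff t q).
  by apply/funext => q; rewrite mulrC.
have psiCc : Cc (fun q => gauss q * cutoff t q) by rewrite -wE.
have [_ _ _ _ Jdiv] := areaJ.
have [eC e0] := Jdiv _ _ posF psiC psiCc.
set e := surface_divergence _ _ _ in eC e0.
have -> : J volume_density = J (fun q => volume_density q + - (2 / n%:R) * e q).
  by rewrite JD ?JZ ?e0 ?mulr0 ?addr0 //; exact: CcZ.
apply: area_le => //; [by apply: CcD => //; exact: CcZ|move=> q].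
rewrite /e (weighted_divergence q posF (@C1T_cutoff t)) /=.
have Oq := tube_center_in (TB q); have [fq dq] := tube_center (TB q).
have [_ ZN _] := posF.
rewrite (pd_cutoff Oq dq (ZN _ _ _ Oq) t0) fq position_divergence //.
have ZE : dotp (X q) (position_field (TB q) (X q)) =
    sqdist q - dotp (X q) (tube_normal (TB q) (X q)) ^+ 2.
  by rewrite /position_field dotpBr dotpZr expr2.
have CS : dotp (X q) (tube_normal (TB q) (X q)) ^+ 2 <= sqdist q.
  by have := dotp_CauchySchwarz (X q) (tube_normal (TB q) (X q)); rewrite (tube_normal1 g1 Oq) mulr1.
rewrite ZE; set k2 := dotp _ _ ^+ 2 in CS *.
rewrite mulrC /volume_density [X in _ + X]mulrCA -mulrDr.
apply: ler_wpM2l; first exact: gauss_ge0.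
have c'0 := cutoff'_le0 q t0; have c0 := cutoff_ge0 t q; have c1 := cutoff_le1 t q.
set c := cutoff t q in c0 c1 *; set c' := cutoff' t q in c'0 *; set s := sqdist q in CS *.
(* The gradient of the cut-off contributes with the good sign, since [cutoff'] <= 0 and [s - k2] is
   the squared length of the tangential part of X. *)
have B0 : 0 <= 2 / n%:R * (- (2 * c' / t * (s - k2))).
  rewrite mulr_ge0 ?divr_ge0 // -mulNr mulr_ge0 ?subr_ge0 // -mulNr mulr_ge0 ?invr_ge0 ?(ltW t0) //.
  by rewrite -mulrN mulr_ge0 // oppr_ge0.
set x := 1 - s / (3 * n%:R); have P0 : 0 <= pospow 1 x := pospow_ge0 1 x.
have xP : x <= pospow 1 x by rewrite /pospow expr1 le_max lexx orbT.
have cx : c * x <= pospow 1 x.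
  apply: (@le_trans _ _ (c * pospow 1 x)); first exact: ler_wpM2l.
  by rewrite -[leRHS]mul1r; exact: ler_wpM2r.
have E : c = 3 * (c * x) - 2 / n%:R * (c * (n%:R - 2^-1 * s)).
  by rewrite /x; field; rewrite gt_eqF.
have -> : 3 * pospow 1 x + - (2 / n%:R) *
   (2 * c' / t * (s - k2) + c * (n%:R - 2^-1 * k2 - 2^-1 * (s - k2))) =
   3 * pospow 1 x - 2 / n%:R * (c * (n%:R - 2^-1 * s)) + 2 / n%:R * (- (2 * c' / t * (s - k2))) by ring.
rewrite {1}E -addrA; apply: lerD; first by apply: ler_wpM2l.
by rewrite lerDl.
Qed.

(** Multiplication by D completes the square, so D = 0 is separate. It is applied with a the
    cut-off, b its derivative over t, D = A - E, G = g <X, Z> and P = C |X|^2. *)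
Lemma quadratic_form_ge0 (a b D G P : R) : 0 <= D -> 0 <= P -> G ^+ 2 <= P * D ->
  0 <= a ^+ 2 * D + 4 * a * b * G + 4 * b ^+ 2 * P.
Proof.
move=> D0 P0 h; have [D00|Dn] := eqVneq D 0.
  have -> : G = 0.
    by apply/eqP; rewrite -sqrf_eq0 eq_le sqr_ge0 andbT; move: h; rewrite D00 mulr0.
  by rewrite D00 !mulr0 !add0r mulr_ge0 // mulr_ge0 // sqr_ge0.
have Dp : 0 < D by rewrite lt_neqAle eq_sym Dn.
rewrite -(pmulr_rge0 _ Dp).
have -> : D * (a ^+ 2 * D + 4 * a * b * G + 4 * b ^+ 2 * P) =
  (a * D + 2 * b * G) ^+ 2 + 4 * b ^+ 2 * (P * D - G ^+ 2) by ring.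
by rewrite addr_ge0 ?sqr_ge0 // mulr_ge0 ?subr_ge0 // mulr_ge0 // sqr_ge0.
Qed.

(* Test function [gauss * cutoff^2 * g] along the field [Zf]; the error terms are absorbed by
   completing a square, and the weighted volume is finite, so letting [t] go to infinity kills
   the energy [E]. *)
Lemma caccioppoli Zf (g E : M -> R) (C : R) : tangent_family Zf -> C1T X gamma g -> continuous E ->
  (forall q, 0 <= E q) -> 0 <= C ->
  (forall q, let Z := Zf q (TB q) (X q) in
     let A := pd Z (fun y => g (tube_foot (TB q) y)) (X q) +
        g q * (flat_div (Zf q (TB q)) (X q) - 2^-1 * dotp (X q) Z) in
     E q <= A /\ (g q * dotp (X q) Z) ^+ 2 <= C * sqdist q * (A - E q)) ->
  forall q, E q = 0.
Proof.
move=> ZF gC Ec E0 C0 hA.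
have [_ _ _ Jp Jdiv] := areaJ.
have gc := gauss_continuous.
pose F t q := cutoff t q * (cutoff t q * (gauss q * E q)).
have FC t : 0 < t -> Cc (F t).
  move=> t0; have [cc _] := Cc_cutoff t0; apply: (CcM (Cc_cutoff t0)) => q.
  apply: (@continuousM _ _ (cutoff t) (fun q => gauss q * E q)); first exact: cc.
  by apply: (@continuousM _ _ gauss E); [exact: gc|exact: Ec].
have bound t : 0 < t -> J (F t) <= 64 * C / t * J volume_density.
  move=> t0; pose psi q := cutoff t q * cutoff t q * g q.
  have psiC : C1T X gamma psi.
    move=> p T; have oT := @tube_ball_open _ _ _ _ _ p T; have cT := @C1T_cutoff t p T.
    by apply: C1M => //; exact: C1M.
  have psiC' : C1T X gamma (fun q => gauss q * psi q).
    by move=> p T; apply: C1M; [exact: tube_ball_open|exact: C1T_gauss|exact: psiC].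
  have [cc _] := Cc_cutoff t0.
  have gcont : continuous g by exact: (C1T_continuous Xc TB gC).
  have psiCc : Cc (fun q => gauss q * psi q).
    rewrite (_ : (fun q => _) = (fun q => cutoff t q * (cutoff t q * (g q * gauss q)))).
      apply: (CcM (Cc_cutoff t0)) => q.
      apply: (@continuousM _ _ (cutoff t) (fun q => g q * gauss q)); first exact: cc.
      by apply: (@continuousM _ _ g gauss); [exact: gcont|exact: gc].
    by apply/funext => q; rewrite /psi; ring.
  have [eC e0] := Jdiv _ _ ZF psiC' psiCc.
  set e := surface_divergence _ _ _ in eC e0.
  have wC : Cc (fun q => cutoff t q * gauss q) by exact: (CcM (Cc_cutoff t0)).
  have K0 : 0 <= 64 * C / t by rewrite divr_ge0 ?(ltW t0) // mulr_ge0.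
  apply: (@le_trans _ _ (J (fun q => e q + 64 * C / t * (cutoff t q * gauss q)))); last first.
    rewrite JD //; last exact: CcZ.
    by rewrite e0 add0r JZ //; apply: ler_wpM2l => //; exact: volume_bound.
  apply: area_le; [exact: FC|by apply: CcD => //; exact: CcZ|move=> q].
  have Oq := tube_center_in (TB q); have [fq dq] := tube_center (TB q).
  have [hE hG] := hA q; have [_ ZN _] := ZF.
  rewrite /e (weighted_divergence q ZF psiC) /=.
  have [dc _] := C1T_cutoff t Oq; have [dg _] := gC q (TB q) _ Oq.
  have dcc : differentiable (fun y => cutoff t (tube_foot (TB q) y) * cutoff t (tube_foot (TB q) y)) (X q).
    exact: differentiableM.
  rewrite (pdM _ dcc dg) (pdM _ dc dc) (pd_cutoff Oq dq (ZN _ _ _ Oq) t0) fq.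
  move: hE hG; set Z := Zf q (TB q) (X q).
  set dpg := pd Z _ _; set k := flat_div _ _ - _ => hE hG.
  rewrite /F /psi; have c0 := cutoff_ge0 t q; have cs := cutoff'_sqr q t0.
  have s0 := sqdist_ge0 q.
  set c := cutoff t q in c0 cs *; set c' := cutoff' t q in cs *; set s := sqdist q in hG cs s0 *.
  set G := dotp (X q) Z in hG *; set A := dpg + g q * k in hE hG.
  have -> : c * (c * (gauss q * E q)) = gauss q * (c ^+ 2 * E q) by ring.
  (* The squared cut-off produces the cross term. Together with c^2 (A - E) and 4 (c' / t)^2 C s it
     forms a nonnegative quadratic form, whose last term is at most 64 C / t times c by
     [cutoff'_sqr]. *)
  rewrite [leRHS](_ : _ = gauss q * (c ^+ 2 * A + 4 * c * (c' / t) * (g q * G) + 64 * C / t * c)); last first.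
    by rewrite /A; ring.
  apply: ler_wpM2l; first exact: gauss_ge0.
  have AE : 0 <= A - E q by rewrite subr_ge0.
  have Q := quadratic_form_ge0 c (c' / t) AE (mulr_ge0 C0 s0) hG.
  have T : 4 * (c' / t) ^+ 2 * (C * s) <= 64 * C / t * c.
    have -> : 4 * (c' / t) ^+ 2 * (C * s) = 4 * C / t * (c' ^+ 2 * (s / t)) by field; rewrite gt_eqF.
    have -> : 64 * C / t * c = 4 * C / t * (16 * c) by ring.
    by apply: ler_wpM2l => //; rewrite divr_ge0 ?(ltW t0) // mulr_ge0.
  rewrite -subr_ge0; apply: (le_trans Q).
  have -> : c ^+ 2 * A + 4 * c * (c' / t) * (g q * G) + 64 * C / t * c - c ^+ 2 * E q =
     c ^+ 2 * (A - E q) + 4 * c * (c' / t) * (g q * G) + 64 * C / t * c by ring.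
  by rewrite lerD2l.
move=> q; apply/eqP; rewrite eq_le E0 andbT leNgt; apply/negP => Eq.
have s0 := sqdist_ge0 q; pose t0 := sqdist q + 1; have t00 : 0 < t0 by rewrite /t0; lra.
have F0 t q' : 0 <= F t q'.
  rewrite /F; apply: mulr_ge0; first exact: cutoff_ge0.
  apply: mulr_ge0; first exact: cutoff_ge0.
  by apply: mulr_ge0; [exact: gauss_ge0|exact: E0].
have JF : 0 < J (F t0).
  apply: (Jp _ q (FC _ t00)) => //.
  have cq : 0 < cutoff t0 q by apply: cutoff_gt0; rewrite /t0; lra.
  by rewrite /F; apply: mulr_gt0 => //; apply: mulr_gt0 => //; apply: mulr_gt0 => //; exact: gauss_gt0.
have V0 : 0 <= J volume_density.
  apply: le_trans (volume_bound t00); apply: J0 => [|q']; first exact: (CcM (Cc_cutoff t00)).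
  by rewrite mulr_ge0 ?cutoff_ge0 ?gauss_ge0.
pose K := 64 * C * J volume_density; have K0 : 0 <= K by rewrite !mulr_ge0.
(* F increases with t, so J (F t0) <= K / t, that is t J (F t0) <= K; for this t the left side is K
   + t0 J (F t0) > K. *)
pose t := t0 + K / J (F t0).
have tt0 : t0 <= t by rewrite lerDl divr_ge0 // ltW.
have tp := lt_le_trans t00 tt0.
have le : J (F t0) <= J (F t).
  apply: area_le; [exact: FC|exact: FC|move=> q'; rewrite /F].
  have cm := cutoff_mono q' t00 tt0; have c0 := cutoff_ge0 t0 q'.
  have w0 : 0 <= gauss q' * E q' by apply: mulr_ge0; [exact: gauss_ge0|exact: E0].
  by apply: ler_pM => //; [rewrite mulr_ge0|apply: ler_pM].
have := le_trans le (bound t tp).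
rewrite [leRHS](_ : _ = K / t); last by rewrite /K; ring.
rewrite ler_pdivlMr // /t mulrDr mulrCA divff ?gt_eqF // mulr1.
by rewrite gerDr leNgt mulr_gt0.
Qed.

End WeightedEstimates.

(** * The Gauss map is constant *)

Lemma locally_constant {S : topologicalType} {T : Type} (f : S -> T) : connected [set: S] ->
  (forall x, \forall y \near x, f y = f x) -> forall x y, f y = f x.
Proof.
move=> Sconn loc x y; suff H : [set y | f y = f x] = [set: S].
  by have : [set y | f y = f x] y by rewrite H.
apply: Sconn; first by exists x.
- exists [set y | f y = f x]; last by rewrite setTI.
  rewrite openE => y' /= E; apply: filterS (loc y') => y'' Eq'' /=; rewrite Eq''; exact: E.
- exists [set y | f y = f x]; last by rewrite setTI.
  rewrite -[X in closed X]setCK; apply: open_closedC; rewrite openE => y' /= E.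
  by apply: filterS (loc y') => y'' Eq'' /=; rewrite Eq''.
Qed.

Section ZeroGradient.
Context {R : realType} {n : nat} {M : smooth_manifold R n}.
Variables (X gamma : M -> 'rV[R]_n.+1).
Hypothesis Xc : continuous X.
Hypothesis g1 : forall q, dotp (gamma q) (gamma q) = 1.
Variable TB : forall p, tube X gamma p.
Hypothesis Mconn : connected [set: M].

(* [f \o tube_foot] factors through the retraction [z - tube_dist z *: N z] onto the zero level,
   where all its derivatives vanish. *)
Lemma zero_gradient_constant (f : M -> R) : C1T X gamma f ->
  (forall q w, pd w (fun y => f (tube_foot (TB q) y)) (X q) = 0) -> forall p q, f q = f p.
Proof.
move=> fC f0; apply: (locally_constant Mconn) => p; set T := TB p.
have Op := tube_center_in T; have [fp dp] := tube_center T.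
have oT := @tube_ball_open _ _ _ _ _ p T.
pose pr (y : 'rV[R]_n.+1) := y - tube_dist T y *: tube_normal T y.
have /nbhs_ballP[d /= d0 hd] := tube_retract Xc Op dp.
pose G y := f (tube_foot T y).
have zero z w : ball (X p) d z -> pd w G z = 0.
  move=> bz; have [Oz [Opz dpz]] := hd _ bz; rewrite -/(pr z) in Opz dpz.
  have prE y : tube_ball T y -> pr y = X (tube_foot T y) by move=> Oy; rewrite tube_footE.
  have nz : {near z, G =1 (fun y => G (pr y))}.
    have ob : open (ball (X p) d) by exact: ball_open.
    apply: filterS (open_nbhs_nbhs (conj ob bz)) => y /hd[Oy [Opy _]].
    rewrite -/(pr y) in Opy; rewrite /G prE // in Opy *.
    by have [-> _] := tube_sheetE (tube_foot_sheet Oy) Opy.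
  rewrite (pd_near w nz).
  have dpr : differentiable pr z.
    apply: differentiable_row => a.
    have [d1 _] := C1_dist Oz; have [d2 _] := C1_normal a Oz.
    rewrite (_ : (fun y => _) = (fun y : 'rV[R]_n.+1 => y 0 a - tube_dist T y * tube_normal T y 0 a)).
      by apply: differentiableB; [exact: differentiable_coord|exact: differentiableM].
    by apply/funext => y; rewrite !mxE.
  have [dG _] := fC p T _ Opz.
  rewrite (pd_diff_comp _ dpr dG) prE //.
  set q := tube_foot T z; have sq : tube_sheet T q by exact: tube_foot_sheet.
  have Oq : tube_ball T (X q) by rewrite -prE.
  rewrite (pd_near _ (g := fun y => f (tube_foot (TB q) y))) ?f0 //.
  apply: filterS (tube_agree sq Oq (tube_sheet_center (TB q)) (tube_center_in (TB q))) => y [fy _].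
  by rewrite /G fy.
have n1 : \forall q \near p, tube_sheet T q.
  by apply: open_nbhs_nbhs; split; [exact: tube_sheet_open|exact: tube_sheet_center].
have n2 : \forall q \near p, ball (X p) d (X q).
  by apply: Xc; apply: open_nbhs_nbhs; split; [exact: ball_open|exact: ballxx].
apply: filterS2 n1 n2 => q sq bq.
have Oq : tube_ball T (X q) by have [] := hd _ bq.
have [fq _] := tube_sheetE sq Oq.
have seg (s : R) : 0 <= s <= 1 -> ball (X p) d (X p + s *: (X q - X p)).
  move=> /andP[s0 s1]; rewrite -ball_normE /= opprD addrA subrr sub0r normrN normrZ ger0_norm //.
  move: bq; rewrite -ball_normE /= distrC; apply: le_lt_trans.
  by rewrite -[leRHS]mul1r; apply: ler_wpM2r.
have [|s s01 E] := @mvt_line R _ G (X p) (X q - X p).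
  by move=> s /seg h; have [Os _] := hd _ h; have [] := fC p T _ Os.
move: E; rewrite -pdxE zero; last exact: seg.
rewrite [X p + _]addrC subrK /G fp fq => /eqP; rewrite subr_eq0 => /eqP.
exact.
Qed.

End ZeroGradient.

(** * Coordinates of the Gauss map as test functions *)

Section GaussImage.
Context {R : realType} {n : nat} {M : smooth_manifold R n}.
Variables (X gamma : M -> 'rV[R]_n.+1).
Hypothesis Xc : continuous X.
Hypothesis Xp : proper_map X.
Hypothesis g1 : forall q, dotp (gamma q) (gamma q) = 1.
Variable TB : forall p, tube X gamma p.
Hypothesis n0 : (0 < n)%N.
Hypothesis Mconn : connected [set: M].

(** The tube [TB q] changes with q without any continuity; agreement of overlapping tubes lets one
    fixed tube be used near p. *)
Lemma family_continuous (F : forall p, tube X gamma p -> 'rV[R]_n.+1 -> R) :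
  (forall p (T : tube X gamma p) z, tube_ball T z -> {for z, continuous (F p T)}) ->
  (forall p p' (T : tube X gamma p) (T' : tube X gamma p') q,
    tube_sheet T q -> tube_ball T (X q) -> tube_sheet T' q -> tube_ball T' (X q) ->
    F p T (X q) = F p' T' (X q)) ->
  continuous (fun q => F q (TB q) (X q)).
Proof.
move=> Fc FA p; set T := TB p; have Op := tube_center_in T.
have n1 : \forall q \near p, tube_sheet T q.
  by apply: open_nbhs_nbhs; split; [exact: tube_sheet_open|exact: tube_sheet_center].
have n2 : \forall q \near p, tube_ball T (X q).
  by apply: Xc; apply: open_nbhs_nbhs; split; [exact: tube_ball_open|exact: tube_center_in].
apply: (@near_eq_continuous _ _ (fun q => F p T (X q))).
  apply: filterS2 n1 n2 => q sq Oq; apply: FA => //; first exact: tube_sheet_center.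
  exact: tube_center_in.
by move=> A /(Fc _ _ _ Op) h; exact: (@Xc p _ h).
Qed.

Definition tilt p (T : tube X gamma p) (w z : 'rV[R]_n.+1) : R := dotp (tube_normal T z) w.
(** Since <N, w> is constant along normals, its flat gradient is already tangent to the levels, and
    no projection is required. *)
Definition tilt_gradient (w : 'rV[R]_n.+1) p (T : tube X gamma p) (z : 'rV[R]_n.+1) : 'rV[R]_n.+1 :=
  \row_a pd (delta_mx 0 a) (tilt T w) z.

Lemma near_near_normal p p' (T : tube X gamma p) (T' : tube X gamma p') q :
  tube_sheet T q -> tube_ball T (X q) -> tube_sheet T' q -> tube_ball T' (X q) ->
  \forall z \near X q, \forall y \near z, tube_normal T y = tube_normal T' y.
Proof. by move=> sq Oq sq' Oq'; exact: (nbhs_interior (near_normal sq Oq sq' Oq')). Qed.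

Section OneTube.
Variables (p : M) (T : tube X gamma p).
Let Om := tube_ball T.
Let N := tube_normal T.
Let oT : open Om := tube_ball_open (T := T).
Let tC : forall k, Ck k Om (tube_dist T) := tube_dist_smooth T.
Let tN z v : Om z -> pd v (tube_dist T) z = dotp (N z) v.
Proof. exact: tube_dist_derivative. Qed.
Let N1 z : Om z -> dotp (N z) (N z) = 1 := tube_normal1 g1 (T := T) (z := z).

Lemma tilt_smooth w k : Ck k Om (tilt T w).
Proof. exact: (normal_dotp_smooth oT tC tN w k). Qed.

Lemma tilt_differentiable w z : Om z -> differentiable (tilt T w) z.
Proof. by move=> Oz; exact: (Ck_diff (tilt_smooth w 0) Oz). Qed.

Lemma tilt_gradient_C1 w a : C1 Om (fun z => tilt_gradient w T z 0 a).
Proof.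
apply: (C1_ext oT (f := pd (delta_mx 0 a) (tilt T w))) => [z _|]; first by rewrite mxE.
exact: (Ck_C1 (pd_smooth _ (tilt_smooth w 2))).
Qed.

Lemma dotp_tilt_gradient w v z : Om z -> dotp v (tilt_gradient w T z) = pd v (tilt T w) z.
Proof.
move=> Oz; rewrite (pd_basis v (tilt_differentiable w Oz)) dotpE.
by apply: eq_bigr => a _; rewrite mxE.
Qed.

Lemma tilt_gradient_normal w z : Om z -> dotp (N z) (tilt_gradient w T z) = 0.
Proof. by move=> Oz; rewrite dotp_tilt_gradient //; exact: (pd_normal_normal oT tC tN N1 w Oz). Qed.

Lemma tilt_laplacian w z : Om z -> tube_dist T z = 0 ->
  flat_div (tilt_gradient w T) z =
  2^-1 * dotp z (tilt_gradient w T z) - shape_norm N z * tilt T w z.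
Proof.
move=> Oz dz; rewrite dotp_tilt_gradient //.
have ret y : Om y -> tube_dist T y = 0 -> \forall y' \near y,
    Om y' /\ Om (y' - tube_dist T y' *: N y') /\ tube_dist T (y' - tube_dist T y' *: N y') = 0.
  by move=> Oy dy; exact: (tube_retract Xc Oy dy).
have shr y : Om y -> tube_dist T y = 0 -> flat_div N y = 2^-1 * dotp y (N y).
  by move=> Oy dy; exact: (tube_divergence Oy dy).
have <- := pd_div_zero_level oT tC tN N1 ret shr w Oz dz.
have <- := laplacian_normal oT tC tN w Oz.
rewrite /flat_div; apply: eq_bigr => a _; congr (pd _ _ z).
by apply/funext => y; rewrite mxE.
Qed.

Lemma shape_norm_ge0 z : 0 <= shape_norm N z.
Proof. by apply: sumr_ge0 => a _; apply: sumr_ge0 => b _; exact: sqr_ge0. Qed.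

Lemma shape_norm_continuous z : Om z -> {for z, continuous (shape_norm N)}.
Proof.
move=> Oz; apply: sum_continuous => a; apply: sum_continuous => b.
have [_ c] := C1_normal b Oz (T := T).
apply: (@continuous_comp _ _ _ (pd (delta_mx 0 a) (fun y => N y 0 b)) (fun x : R => x ^+ 2)).
  exact: c.
exact: exprn_continuous.
Qed.

End OneTube.

Lemma tilt_gradient_agree w p p' (T : tube X gamma p) (T' : tube X gamma p') q :
  tube_sheet T q -> tube_ball T (X q) -> tube_sheet T' q -> tube_ball T' (X q) ->
  \forall z \near X q, tilt_gradient w T z = tilt_gradient w T' z.
Proof.
move=> sq Oq sq' Oq'; apply: filterS (near_near_normal sq Oq sq' Oq') => z Nz.
apply/rowP => a; rewrite !mxE; apply: pd_near; apply: filterS Nz => y Ny.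
by rewrite /tilt Ny.
Qed.

Lemma tilt_family w : tangent_family (tilt_gradient w).
Proof.
split; first by move=> p T a; exact: tilt_gradient_C1.
  by move=> p T z Oz; exact: tilt_gradient_normal.
by move=> p p' T T' q; exact: tilt_gradient_agree.
Qed.

Lemma C1T_tilt w : C1T X gamma (fun q => dotp (gamma q) w).
Proof. by move=> p T; exact: (Ck_C1 (tilt_smooth T w 1)). Qed.

(** In [caccioppoli] take g = - 1 / f and Z = grad f with f = <gamma, b>. The weighted divergence is
    |Z|^2 / f^2 + [shape_norm]; the energy is [shape_norm], and Cauchy-Schwarz bounds (<X, Z> / f)^2
    by |X|^2 times the rest, so C = 1. *)
Lemma totally_geodesic b : (forall q, 0 < dotp (gamma q) b) ->
  forall q, shape_norm (tube_normal (TB q)) (X q) = 0.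
Proof.
move=> fpos; have [J areaJ] := area_functional_exists Xc g1 TB.
apply: (caccioppoli Xc Xp g1 areaJ n0 (Zf := tilt_gradient b)
  (g := fun q => - (dotp (gamma q) b)^-1) (C := 1)) => //.
- exact: tilt_family.
- move=> p T; have oT := @tube_ball_open _ _ _ _ _ p T; apply: C1N => //.
  by apply: C1V => //; [move=> z _; rewrite gt_eqF|exact: C1T_tilt].
- apply: (family_continuous (F := fun p T => shape_norm (tube_normal T))).
    by move=> p T z Oz; exact: shape_norm_continuous.
  move=> p p' T T' q sq Oq sq' Oq'; rewrite /shape_norm.
  have nN := near_normal sq Oq sq' Oq'.
  apply: eq_bigr => a _; apply: eq_bigr => c _; congr (_ ^+ 2).
  by apply: pd_near; apply: filterS nN => z ->.
- by move=> q; exact: shape_norm_ge0.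
move=> q Z A.
have Oq := tube_center_in (TB q); have [fq dq] := tube_center (TB q).
have fE : tilt (TB q) b (X q) = dotp (gamma q) b by rewrite /tilt /tube_normal fq.
have f0 : dotp (gamma q) b != 0 by rewrite gt_eqF.
have df := tilt_differentiable b Oq.
have AE : A = dotp Z Z / dotp (gamma q) b ^+ 2 + shape_norm (tube_normal (TB q)) (X q).
  rewrite /A; have -> : pd Z (fun y => - (dotp (gamma (tube_foot (TB q) y)) b)^-1) (X q) =
      dotp Z Z / dotp (gamma q) b ^+ 2.
    have f0' : tilt (TB q) b (X q) != 0 by rewrite fE.
    rewrite (pdN _ (f := fun y => (tilt (TB q) b y)^-1)); last by apply: differentiableV.
    by rewrite (pdV _ df f0') fE -dotp_tilt_gradient // mulNr opprK.
  rewrite (tilt_laplacian _ Oq dq) fE -/Z; field; exact: f0.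
have CS := dotp_CauchySchwarz (X q) Z.
split; first by rewrite AE lerDr divr_ge0 ?sqr_ge0 // dotp_ge0.
have -> : A - shape_norm (tube_normal (TB q)) (X q) = dotp Z Z / dotp (gamma q) b ^+ 2.
  by rewrite AE addrK.
have -> : (- (dotp (gamma q) b)^-1 * dotp (X q) Z) ^+ 2 = dotp (X q) Z ^+ 2 / dotp (gamma q) b ^+ 2.
  by field; exact: f0.
rewrite mul1r mulrA; apply: ler_wpM2r; first by rewrite invr_ge0 sqr_ge0.
exact: CS.
Qed.

End GaussImage.

(* The derivative of half the polar angle of [(u, v)]; it is written through [v / (r + u)] so as
   to be smooth off the slit [v = 0], [u <= 0]. *)
Lemma half_angle_derivative {R : realType} (u v r pu pv : R) : 0 < r -> 0 < r + u ->
  r * r = u * u + v * v ->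
  (1 + (v / (r + u)) ^+ 2)^-1 * (pv * (r + u)^-1 +
     v * (- ((2 * r)^-1 * (pu * u + u * pu + (pv * v + v * pv)) + pu) / (r + u) ^+ 2)) =
  (u * pv - v * pu) / (2 * (u * u + v * v)).
Proof.
move=> r0 m0 rr; have mn : r + u != 0 by rewrite gt_eqF.
(* Rational parametrization by tau, the tangent of half the angle, and m = r + u: the relation
   between r, u and v is built in, and [field] decides the identity. *)
have [tau [m [mp vE rE uE]]] : exists tau m, [/\ 0 < m, v = tau * m,
    r = m * (1 + tau ^+ 2) / 2 & u = m * (1 - tau ^+ 2) / 2].
  exists (v / (r + u)), (r + u).
  have E : r - u = (v / (r + u)) ^+ 2 * (r + u).
    have -> : (v / (r + u)) ^+ 2 * (r + u) = (v * v) / (r + u) by field.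
    have -> : v * v = (r - u) * (r + u) by rewrite mulrDr !mulrBl rr; ring.
    by rewrite mulfK.
  split=> //; first by rewrite divfK.
    by rewrite [RHS](_ : _ = ((r + u) + (v / (r + u)) ^+ 2 * (r + u)) / 2); [rewrite -E; field|ring].
  by rewrite [RHS](_ : _ = ((r + u) - (v / (r + u)) ^+ 2 * (r + u)) / 2); [rewrite -E; field|ring].
have t0 : 1 + tau ^+ 2 != 0 by rewrite gt_eqF // ltr_pwDl // sqr_ge0.
have mE : r + u = m by rewrite rE uE; field.
have S : u * u + v * v = (m * (1 + tau ^+ 2) / 2) ^+ 2 by rewrite uE vE; field.
have mn0 : m != 0 by rewrite gt_eqF.
rewrite mE S rE uE vE.
field; rewrite ?mn0 ?t0 //.
Qed.

(** * The polar angle of two coordinates of the Gauss map *)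

Section GaussCircle.
Context {R : realType} {n : nat} {M : smooth_manifold R n}.
Variables (X gamma : M -> 'rV[R]_n.+1).
Hypothesis Xc : continuous X.
Hypothesis Xp : proper_map X.
Hypothesis g1 : forall q, dotp (gamma q) (gamma q) = 1.
Variable TB : forall p, tube X gamma p.
Hypothesis n0 : (0 < n)%N.
Hypothesis Mconn : connected [set: M].
Variables (a1 a2 : 'rV[R]_n.+1).
Hypotheses (a11 : dotp a1 a1 = 1) (a22 : dotp a2 a2 = 1).
Let u q := dotp (gamma q) a1.
Let v q := dotp (gamma q) a2.
Hypothesis slit : forall q, v q = 0 -> u q <= 0 -> False.

Let modulus q := Num.sqrt (u q * u q + v q * v q).
Definition half_angle q := atan (v q / (modulus q + u q)).

Lemma modulus_sqr_gt0 q : 0 < u q * u q + v q * v q.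
Proof.
have [v0|v0] := eqVneq (v q) 0.
  rewrite v0 mulr0 addr0; have [h|h] := leP (u q) 0; first by case: (slit v0 h).
  exact: mulr_gt0.
by rewrite ltr_wpDl -?expr2 ?sqr_ge0 // lt_neqAle eq_sym sqrf_eq0 v0 sqr_ge0.
Qed.

Lemma modulus_gt0 q : 0 < modulus q.
Proof. by rewrite sqrtr_gt0 modulus_sqr_gt0. Qed.

Lemma modulusE q : modulus q * modulus q = u q * u q + v q * v q.
Proof. by rewrite -expr2 sqr_sqrtr // ltW // modulus_sqr_gt0. Qed.

(** r + u <= 0 would force v = 0 and u <= 0, the excluded slit; hence the half angle is smooth
    everywhere. *)
Lemma modulus_u_gt0 q : 0 < modulus q + u q.
Proof.
have r0 := modulus_gt0 q; have [h|h] := leP 0 (u q); first by rewrite ltr_wpDr.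
rewrite -[u q]opprK subr_gt0 -(@ltr_pXn2r _ 2) ?nnegrE ?oppr_ge0 ?(ltW h) ?(ltW r0) //.
rewrite !expr2 modulusE mulrNN ltrDl -expr2 lt_neqAle sqr_ge0 andbT eq_sym sqrf_eq0.
by apply/eqP => v0; exact: (slit v0 (ltW h)).
Qed.

Let C1T_u : C1T X gamma u := C1T_tilt a1.
Let C1T_v : C1T X gamma v := C1T_tilt a2.

Section OneTube.
Variables (p : M) (T : tube X gamma p).
Let Om := tube_ball T.
Let oT : open Om := tube_ball_open (T := T).

Lemma C1_modulus_sqr : C1 Om (fun z => u (tube_foot T z) * u (tube_foot T z) + v (tube_foot T z) * v (tube_foot T z)).
Proof.
have c1 := @C1T_u p T; have c2 := @C1T_v p T.
by apply: C1D => //; exact: C1M.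
Qed.

Lemma C1_modulus : C1 Om (fun z => modulus (tube_foot T z)).
Proof.
apply: (C1_comp (g := Num.sqrt) (dg := fun x => (2 * Num.sqrt x)^-1) oT C1_modulus_sqr) => z Oz.
have p0 := modulus_sqr_gt0 (tube_foot T z).
split; first exact: is_derive1_sqrt.
apply: continuousV; first by rewrite mulf_neq0 // gt_eqF // sqrtr_gt0.
apply: continuousM; first exact: cst_continuous.
exact: sqrt_continuous.
Qed.

Lemma C1_modulus_u : C1 Om (fun z => modulus (tube_foot T z) + u (tube_foot T z)).
Proof. by apply: C1D => //; [exact: C1_modulus|exact: C1T_u]. Qed.

Lemma C1_modulus_u_inv : C1 Om (fun z => (modulus (tube_foot T z) + u (tube_foot T z))^-1).
Proof.
apply: C1V => //; last exact: C1_modulus_u.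
by move=> z _; rewrite gt_eqF // modulus_u_gt0.
Qed.

Lemma C1_tan_half : C1 Om (fun z => v (tube_foot T z) / (modulus (tube_foot T z) + u (tube_foot T z))).
Proof. by apply: C1M => //; [exact: C1T_v|exact: C1_modulus_u_inv]. Qed.

Lemma C1_half_angle : C1 Om (fun z => half_angle (tube_foot T z)).
Proof.
apply: (C1_comp (g := @atan R) (dg := fun x => (1 + x ^+ 2)^-1) oT C1_tan_half) => z Oz.
split; first exact: is_derive1_atan.
apply: continuousV; first by rewrite gt_eqF // ltr_pwDl // sqr_ge0.
by apply: continuousD; [exact: cst_continuous|exact: exprn_continuous].
Qed.

Lemma pd_half_angle w z : Om z -> pd w (fun y => half_angle (tube_foot T y)) z =
  (u (tube_foot T z) * pd w (tilt T a2) z - v (tube_foot T z) * pd w (tilt T a1) z) /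
  (2 * (u (tube_foot T z) * u (tube_foot T z) + v (tube_foot T z) * v (tube_foot T z))).
Proof.
move=> Oz; set q := tube_foot T z.
have [du _] := C1T_u Oz; have [dv _] := C1T_v Oz; have [dm _] := C1_modulus Oz.
have [dmu _] := C1_modulus_u Oz; have [dmi _] := C1_modulus_u_inv Oz.
have [dt _] := C1_tan_half Oz; have [ds _] := C1_modulus_sqr Oz.
have duu : differentiable (fun y => u (tube_foot T y) * u (tube_foot T y)) z by exact: differentiableM.
have dvv : differentiable (fun y => v (tube_foot T y) * v (tube_foot T y)) z by exact: differentiableM.
rewrite (pd_comp1 (f := fun y => v (tube_foot T y) / (modulus (tube_foot T y) + u (tube_foot T y))) _
  (is_derive1_atan _) dt).
have mn : modulus q + u q != 0 by rewrite gt_eqF // modulus_u_gt0.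
rewrite (pdM _ dv dmi) (pdV _ dmu mn) (pdD _ dm du).
rewrite (pd_comp1 (f := fun y => u (tube_foot T y) * u (tube_foot T y) + v (tube_foot T y) * v (tube_foot T y))
  _ (is_derive1_sqrt (modulus_sqr_gt0 q)) ds).
rewrite (pdD _ duu dvv) (pdM _ du du) (pdM _ dv dv) -/q -/(modulus q).
exact: (half_angle_derivative _ _ (modulus_gt0 q) (modulus_u_gt0 q) (modulusE q)).
Qed.

End OneTube.

Definition rotation_field p (T : tube X gamma p) (z : 'rV[R]_n.+1) : 'rV[R]_n.+1 :=
  tilt T a1 z *: tilt_gradient a2 T z - tilt T a2 z *: tilt_gradient a1 T z.

Lemma rotation_family : tangent_family rotation_field.
Proof.
split.
- move=> p T a; have oT := @tube_ball_open _ _ _ _ _ p T.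
  apply: (C1_ext oT (f := fun z : 'rV[R]_n.+1 => tilt T a1 z * tilt_gradient a2 T z 0 a -
     tilt T a2 z * tilt_gradient a1 T z 0 a)); first by move=> z _; rewrite !mxE.
  have c1 := @C1T_u p T; have c2 := @C1T_v p T.
  apply: C1B => //; apply: C1M => //; exact: tilt_gradient_C1.
- move=> p T z Oz; rewrite dotpBr !dotpZr !(tilt_gradient_normal g1) //.
  by rewrite !mulr0 subrr.
move=> p p' T T' q sq Oq sq' Oq'.
have h1 := tilt_gradient_agree a1 sq Oq sq' Oq'; have h2 := tilt_gradient_agree a2 sq Oq sq' Oq'.
apply: filterS3 (near_normal sq Oq sq' Oq') h1 h2 => z h3 e1 e2.
by rewrite /rotation_field e1 e2 /tilt h3.
Qed.

(** In u grad v - v grad u the products <grad u, grad v> cancel, and so do the zero-order terms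
    |A|^2 u v; only the drift remains, which the weight absorbs. *)
Lemma rotation_divergence p (T : tube X gamma p) z : tube_ball T z -> tube_dist T z = 0 ->
  flat_div (rotation_field T) z = 2^-1 * dotp z (rotation_field T z).
Proof.
move=> Oz dz; have d1 := tilt_differentiable a1 Oz; have d2 := tilt_differentiable a2 Oz.
have dg w a : differentiable (fun y => tilt_gradient w T y 0 a) z by have [] := tilt_gradient_C1 (T := T) w a Oz.
have -> : flat_div (rotation_field T) z = flat_div (fun y => tilt T a1 y *: tilt_gradient a2 T y) z -
    flat_div (fun y => tilt T a2 y *: tilt_gradient a1 T y) z.
  rewrite /flat_div -sumrB; apply: eq_bigr => a _.
  have E w w' : (fun y : 'rV[R]_n.+1 => (tilt T w y *: tilt_gradient w' T y) 0 a) =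
      (fun y => tilt T w y * tilt_gradient w' T y 0 a) by apply/funext => y; rewrite mxE.
  rewrite !E -pdB; [|exact: differentiableM|exact: differentiableM].
  by congr (pd _ _ z); apply/funext => y; rewrite !mxE.
rewrite !flat_divM // !(tilt_laplacian Xc g1) //.
rewrite -!dotp_tilt_gradient // /rotation_field dotpBr !dotpZr.
by rewrite (dotpC (tilt_gradient a2 T z)); ring.
Qed.

(** In [caccioppoli] take g half the angle and Z the rotation field: the weighted divergence of g Z
    reduces to Z g = |Z|^2 / (2 (u^2 + v^2)). *)
Lemma half_angle_constant : forall p q, half_angle q = half_angle p.
Proof.
have hC : C1T X gamma half_angle by move=> p T; exact: C1_half_angle.
suff h0 : forall q w, pd w (fun y => half_angle (tube_foot (TB q) y)) (X q) = 0.
  by move=> p q; exact: (zero_gradient_constant Xc Mconn hC h0).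
have [J areaJ] := area_functional_exists Xc g1 TB.
(* Half of that divergence, so that A - E = E remains to absorb the cut-off error. *)
pose F p (T : tube X gamma p) z := dotp (rotation_field T z) (rotation_field T z) /
  (4 * (tilt T a1 z * tilt T a1 z + tilt T a2 z * tilt T a2 z)).
have [ZC ZN ZA] := rotation_family.
have r20 p (T : tube X gamma p) z : 0 < tilt T a1 z * tilt T a1 z + tilt T a2 z * tilt T a2 z.
  exact: (modulus_sqr_gt0 (tube_foot T z)).
have pdE q w : pd w (fun y => half_angle (tube_foot (TB q) y)) (X q) =
    dotp w (rotation_field (TB q) (X q)) / (2 * (u q * u q + v q * v q)).
  have Oq := tube_center_in (TB q); have [fq _] := tube_center (TB q).
  rewrite pd_half_angle // fq dotpBr !dotpZr !dotp_tilt_gradient //.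
  by rewrite /tilt /tube_normal fq.
suff E0 : forall q, F q (TB q) (X q) = 0.
  move=> q w; rewrite pdE; move: (E0 q) => /eqP.
  rewrite mulf_eq0 invr_eq0 mulf_eq0 pnatr_eq0 /= (gt_eqF (r20 _ _ _)) orbF => /eqP/dotp_eq0 ->.
  by rewrite dotp0r mul0r.
apply: (caccioppoli Xc Xp g1 areaJ n0 (Zf := rotation_field) (g := half_angle)
  (E := fun q => F q (TB q) (X q)) (C := 8 * (pi / 2) ^+ 2)).
- exact: rotation_family.
- by move=> p T; exact: C1_half_angle.
- apply: (family_continuous Xc (F := F)).
    move=> p T z Oz; have oT := @tube_ball_open _ _ _ _ _ p T.
    apply: (C1_continuous (U := tube_ball T) _ Oz); apply: C1M => //.
      apply: (C1_ext oT (f := fun z => \sum_a rotation_field T z 0 a * rotation_field T z 0 a)).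
        by move=> y _; rewrite dotpE.
      by apply: C1_sum => // a; apply: C1M => //; exact: ZC.
    apply: C1V => //; first by move=> y _; rewrite gt_eqF // mulr_gt0.
    by apply: C1Z => //; exact: C1_modulus_sqr.
  move=> p p' T T' q sq Oq sq' Oq'.
  have z1 := nbhs_singleton (ZA _ _ _ _ _ sq Oq sq' Oq').
  have n1 := nbhs_singleton (near_normal sq Oq sq' Oq').
  by rewrite /= in z1 n1; rewrite /F z1 /tilt n1.
- by move=> q; rewrite divr_ge0 ?dotp_ge0 // mulr_ge0 // ltW.
- by rewrite mulr_ge0 // sqr_ge0.
move=> q Z A.
have Oq := tube_center_in (TB q); have [fq dq] := tube_center (TB q).
have EA : A - F q (TB q) (X q) = F q (TB q) (X q).
  rewrite /A (rotation_divergence Oq dq) subrr mulr0 addr0 pdE -/Z /F /tilt /tube_normal fq -/Z -/(u q) -/(v q).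
  by field; rewrite gt_eqF // modulus_sqr_gt0.
have F0 : 0 <= F q (TB q) (X q) by rewrite divr_ge0 ?dotp_ge0 // mulr_ge0 // ltW.
split; first by rewrite -subr_ge0 EA.
rewrite EA.
(* u^2 + v^2 <= 2 because gamma, [a1] and [a2] are unit vectors; with |g| <= pi / 2 this explains C
   = 8 (pi / 2)^2. *)
have ZF : dotp Z Z <= 8 * F q (TB q) (X q).
  have -> : dotp Z Z = (4 * (u q * u q + v q * v q)) * F q (TB q) (X q).
    rewrite /F -/Z /tilt /tube_normal fq -/(u q) -/(v q); field.
    by rewrite gt_eqF // modulus_sqr_gt0.
  apply: ler_wpM2r => //.
  have hu := dotp_CauchySchwarz (gamma q) a1; have hv := dotp_CauchySchwarz (gamma q) a2.
  rewrite g1 a11 mulr1 -/(u q) in hu; rewrite g1 a22 mulr1 -/(v q) in hv.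
  by rewrite -!expr2; lra.
have CS := dotp_CauchySchwarz (X q) Z.
have h2 : half_angle q ^+ 2 <= (pi / 2) ^+ 2.
  rewrite -real_normK ?num_real //; apply: lerXn2r; rewrite ?nnegrE ?normr_ge0 //.
    by rewrite divr_ge0 // ltW // pi_gt0.
  by rewrite ler_norml (ltW (atan_ltpi2 _)) (ltW (atan_gtNpi2 _)).
rewrite exprMn; apply: (@le_trans _ _ ((pi / 2) ^+ 2 * (sqdist X q * dotp Z Z))).
  by apply: ler_pM => //; rewrite sqr_ge0.
have -> : 8 * (pi / 2) ^+ 2 * sqdist X q * F q (TB q) (X q) =
  (pi / 2) ^+ 2 * (sqdist X q * (8 * F q (TB q) (X q))) by ring.
apply: ler_wpM2l; first exact: sqr_ge0.
by apply: ler_wpM2l => //; exact: sqdist_ge0.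
Qed.

(** With c = tan (theta / 2) constant, (1 - c^2, 2 c) is (1 + c^2) (cos theta, sin theta), and its
    scalar product with (u, v) = r (cos theta, sin theta) is r (1 + c^2) > 0. *)
Lemma gauss_image_halfspace : exists b, forall q, 0 < dotp (gamma q) b.
Proof.
have [[p]|nM] := pselect (exists p : M, True); last by exists 0 => q; case: nM; exists q.
move=> _; pose c := v p / (modulus p + u p).
exists ((1 - c ^+ 2) *: a1 + (2 * c) *: a2) => q.
have cE : v q = c * (modulus q + u q).
  have : v q / (modulus q + u q) = c.
    by rewrite -[LHS]atanK -[RHS]atanK -/(half_angle q) (half_angle_constant p q).
  by move=> <-; rewrite divfK // gt_eqF // modulus_u_gt0.
rewrite dotpDr !dotpZr -/(u q) -/(v q).
have m0 := modulus_u_gt0 q; have r0 := modulus_gt0 q; have rr := modulusE q.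
suff -> : (1 - c ^+ 2) * u q + 2 * c * v q = modulus q * (1 + c ^+ 2).
  by rewrite mulr_gt0 // ltr_pwDl // sqr_ge0.
have E : modulus q - u q = c ^+ 2 * (modulus q + u q).
  have mn : modulus q + u q != 0 by rewrite gt_eqF.
  apply: (mulIf mn); rewrite -mulrA.
  have -> : c ^+ 2 * ((modulus q + u q) * (modulus q + u q)) = v q * v q by rewrite cE; ring.
  have -> : (modulus q - u q) * (modulus q + u q) = modulus q * modulus q - u q * u q by ring.
  by rewrite rr; ring.
have -> : (1 - c ^+ 2) * u q + 2 * c * v q = u q * (1 - c ^+ 2) + 2 * (c ^+ 2 * (modulus q + u q)).
  by rewrite cE; ring.
rewrite -E; have -> : modulus q * (1 + c ^+ 2) = modulus q + (c ^+ 2 * (modulus q + u q) - c ^+ 2 * u q) by ring.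
by rewrite -E; ring.
Qed.

Lemma gauss_map_constant p q : gamma q = gamma p.
Proof.
have [b hb] := gauss_image_halfspace.
have S0 := totally_geodesic Xc Xp g1 TB n0 hb.
apply/rowP => a.
suff h0 : forall q w, pd w (fun y => gamma (tube_foot (TB q) y) 0 a) (X q) = 0.
  have hC : C1T X gamma (fun q => gamma q 0 a) by exact: C1T_normal.
  exact: (zero_gradient_constant Xc Mconn hC h0 p q).
move=> q' w.
have Oq := tube_center_in (TB q'); have [d _] := C1_normal a Oq.
rewrite (pd_basis w d) big1 // => c _.
suff -> : pd (delta_mx 0 c) (fun y => gamma (tube_foot (TB q') y) 0 a) (X q') = 0 by rewrite mulr0.
move: (S0 q') => /eqP; rewrite psumr_eq0; last by move=> i _; apply: sumr_ge0 => j _; exact: sqr_ge0.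
move=> /allP/(_ c (mem_index_enum c)) /=.
rewrite psumr_eq0; last by move=> j _; exact: sqr_ge0.
by move=> /allP/(_ a (mem_index_enum a)) /=; rewrite sqrf_eq0 => /eqP.
Qed.

(** The normal field of a tube is constant, so its divergence <X, gamma> / 2 is 0. *)
Lemma position_normal q : dotp (X q) (gamma q) = 0.
Proof.
have Oq := tube_center_in (TB q); have [fq dq] := tube_center (TB q).
have := tube_divergence Oq dq; rewrite fq big1 => [/esym/eqP|a _].
  by rewrite mulf_eq0 invr_eq0 pnatr_eq0 /= => /eqP.
rewrite (_ : (fun z => _) = cst (gamma q 0 a)) ?pd_cst //.
by apply/funext => z; rewrite (gauss_map_constant q).
Qed.

End GaussCircle.

(** * Lifting segments of the hyperplane *)

Section Covering.
Context {R : realType} {n : nat} {M : smooth_manifold R n}.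
Variables (X gamma : M -> 'rV[R]_n.+1).
Hypothesis Xc : continuous X.
Hypothesis Xp : proper_map X.
Variable TB : forall p, tube X gamma p.
Hypothesis Mconn : connected [set: M].
Variable N0 : 'rV[R]_n.+1.
Hypothesis gN : forall q, gamma q = N0.
Hypothesis N01 : dotp N0 N0 = 1.
Hypothesis XN : forall q, dotp (X q) N0 = 0.
Variable p0 : M.

Lemma continuous_neq {S : topologicalType} (f g : S -> M) x : {for x, continuous f} ->
  {for x, continuous g} -> f x != g x -> \forall y \near x, f y != g y.
Proof.
move=> fc gc fg; have := @manifold_hausdorff _ _ M; rewrite open_hausdorff => /(_ _ _ fg).
move=> [[A B] /= [/set_mem Ax /set_mem Bx] [oA oB AB]].
have n1 : \forall y \near x, A (f y).
  by have h := open_nbhs_nbhs (conj oA Ax); exact: (fc _ h).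
have n2 : \forall y \near x, B (g y).
  by have h := open_nbhs_nbhs (conj oB Bx); exact: (gc _ h).
apply: filterS2 n1 n2 => y Ay By; apply/eqP => E; rewrite E in Ay.
by have : (A `&` B) (g y) by []; move/eqP: AB => ->.
Qed.

Lemma local_injectivity (q : M) : exists V : set M, nbhs q V /\
  forall q1 q2, V q1 -> V q2 -> X q1 = X q2 -> q1 = q2.
Proof.
exists (fun q' => tube_sheet (TB q) q' /\ tube_ball (TB q) (X q')); split.
  apply: filterI.
    by apply: open_nbhs_nbhs; split; [exact: tube_sheet_open|exact: tube_sheet_center].
  by apply: Xc; apply: open_nbhs_nbhs; split; [exact: tube_ball_open|exact: tube_center_in].
move=> q1 q2 [s1 O1] [s2 O2] E; have [<- _] := tube_sheetE s1 O1.
by have [{2}<- _] := tube_sheetE s2 O2; rewrite E.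
Qed.

Lemma lifts_agree {S : topologicalType} (f g : S -> M) x : {for x, continuous f} ->
  {for x, continuous g} -> (forall y, X (f y) = X (g y)) ->
  \forall y \near x, `[< f y = g y >] = `[< f x = g x >].
Proof.
move=> fc gc XE; have [E|nE] := eqVneq (f x) (g x); last first.
  apply: filterS (continuous_neq fc gc nE) => y /eqP ny.
  by rewrite !asboolF //; exact/eqP.
have [V [Vq inj]] := local_injectivity (f x).
have n1 : \forall y \near x, V (f y) by exact: (fc _ Vq).
have n2 : \forall y \near x, V (g y) by rewrite E in Vq; exact: (gc _ Vq).
apply: filterS2 n1 n2 => y Vf Vg.
by rewrite !asboolT //; exact: inj.
Qed.

Lemma unique_lift (f g : R -> M) : continuous f -> continuous g ->
  (forall t, X (f t) = X (g t)) -> f 0 = g 0 -> forall t, f t = g t.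
Proof.
move=> fc gc XE E0 t; have Rconn : connected [set: R].
  by apply/connected_intervalP => x y _ _ z _.
have := locally_constant (f := fun t => `[< f t = g t >]) Rconn _ 0 t.
rewrite (asboolT E0) => h; apply/asboolP; apply: h => x.
by apply: lifts_agree; [exact: fc|exact: gc|exact: XE].
Qed.

(** Makes a segment a path on all of R, so that [unique_lift] applies on the whole line. *)
Definition clamp (t : R) : R := Num.max 0 (Num.min 1 t).

Lemma clamp01 t : 0 <= clamp t <= 1.
Proof. by rewrite /clamp le_max lexx ge_max ler01 ge_min lexx. Qed.

Lemma clamp_continuous : continuous clamp.
Proof.
move=> t; have c0 (c : R) : {for t, continuous (fun=> c : R)} by exact: cst_continuous.
have c1 : {for t, continuous (fun s : R => s)} by move=> A; apply.
have c2 := continuous_min (c0 1) c1; exact: (continuous_max (c0 0) c2).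
Qed.

Lemma clamp0 : clamp 0 = 0.
Proof. by rewrite /clamp (min_idPr ler01) maxxx. Qed.

Lemma clamp1 : clamp 1 = 1.
Proof. by rewrite /clamp minxx (max_idPr ler01). Qed.

Definition segment (x y : 'rV[R]_n.+1) (t : R) := x + clamp t *: (y - x).

Lemma segment_continuous x y : continuous (segment x y).
Proof.
move=> t; apply: (@continuousD _ _ _ (fun=> x) (fun t => clamp t *: (y - x))); first exact: cst_continuous.
apply: (@continuous_comp _ _ _ clamp (fun s : R => s *: (y - x))); first exact: clamp_continuous.
exact: scalel_continuous.
Qed.

Lemma segment_dist x y t : `|segment x y t - x| <= `|y - x|.
Proof.
rewrite /segment addrAC subrr add0r normrZ; have /andP[h0 h1] := clamp01 t.
by rewrite ger0_norm // -[leRHS]mul1r; apply: ler_wpM2r.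
Qed.

Lemma segment_plane x y t : dotp x N0 = 0 -> dotp y N0 = 0 -> dotp (segment x y t) N0 = 0.
Proof. by move=> hx hy; rewrite /segment dotpDl dotpZl dotpBl hx hy subr0 mulr0 addr0. Qed.

Lemma segment0 x y : segment x y 0 = x.
Proof. by rewrite /segment clamp0 scale0r addr0. Qed.

Lemma segment1 x y : segment x y 1 = y.
Proof. by rewrite /segment clamp1 scale1r addrC subrK. Qed.

(** Lifts will be functions on the whole space that cover this projection, rather than functions on
    the hyperplane with its subspace topology. *)
Definition proj (z : 'rV[R]_n.+1) := z - dotp z N0 *: N0.

Lemma proj_plane z : dotp (proj z) N0 = 0.
Proof. by rewrite /proj dotpBl dotpZl N01 mulr1 subrr. Qed.

Lemma proj_id z : dotp z N0 = 0 -> proj z = z.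
Proof. by move=> h; rewrite /proj h scale0r subr0. Qed.

Lemma proj_continuous : continuous proj.
Proof.
have dp : continuous (fun z : 'rV[R]_n.+1 => dotp z N0).
  move=> z; rewrite (_ : (fun _ => _) = (fun z : 'rV[R]_n.+1 => \sum_a z 0 a * N0 0 a)); last first.
    by apply/funext => y; rewrite dotpE.
  apply: sum_continuous => a; apply: (@continuousM _ _ (fun z : 'rV[R]_n.+1 => z 0 a)).
    by apply: differentiable_continuous; exact: differentiable_coord.
  exact: cst_continuous.
move=> z; apply: (@continuousB _ _ _ id (fun z => dotp z N0 *: N0)); first by move=> A; apply.
apply: (@continuous_comp _ _ _ (fun z => dotp z N0) (fun s : R => s *: N0)); first exact: dp.
exact: scalel_continuous.
Qed.

(** All normals are N0 and X stays in the plane, so the height of z is <z, N0> = 0. *)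
Lemma plane_foot p (T : tube X gamma p) z : tube_ball T z -> dotp z N0 = 0 ->
  X (tube_foot T z) = z.
Proof.
move=> Oz zN; rewrite tube_footE //; have := tube_footE Oz.
rewrite /tube_normal gN => /(congr1 (fun y => dotp y N0)).
rewrite XN dotpBl zN dotpZl N01 mulr1 sub0r => /esym/eqP.
by rewrite oppr_eq0 => /eqP ->; rewrite scale0r subr0.
Qed.

Let x0 := X p0.

(** A Lebesgue number, from compactness of the preimage of a ball. The margin 2 e leaves room for a
    step shorter than e from a point itself displaced by less than e. *)
Lemma uniform_tube (r : R) : exists2 e : R, 0 < e & forall q, `|X q - x0| <= r ->
  exists p, tube_sheet (TB p) q /\ `|X q - X p| + 2 * e <= tube_radius (TB p).
Proof.
pose K := X @^-1` [set z | `|z - x0| <= r].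
have cK : compact K by apply: Xp; exact: compact_tube_ball.
have /compact_near_coveringP cK' := cK.
pose P (m : nat) q := exists p, tube_sheet (TB p) q /\ `|X q - X p| + 2 * mesh m <= tube_radius (TB p).
have : \forall m \near \oo, K `<=` P m.
  apply: (cK' _ \oo P) => q Kq; have r0 := tube_radius_gt0 (TB q).
  have r4 : 0 < tube_radius (TB q) / 4 by rewrite divr_gt0.
  exists ((fun q' => tube_sheet (TB q) q' /\ `|X q' - X q| < tube_radius (TB q) / 2),
     (fun m => is_true (mesh m <= tube_radius (TB q) / 4))).
    split; last exact: mesh_small.
    apply: filterI.
      by apply: open_nbhs_nbhs; split; [exact: tube_sheet_open|exact: tube_sheet_center].
    have r2 : 0 < tube_radius (TB q) / 2 by rewrite divr_gt0.
    have /cvgrPdist_lt/(_ _ r2) := @Xc q.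
    by apply: filterS => q' /=; rewrite distrC.
  move=> [q' m] /= [[sq' hq'] hm]; exists q; split=> //.
  by have := hq'; have := hm; set a := `|_|; lra.
move=> /filter_ex[m hm]; exists (mesh m); first exact: mesh_gt0.
by move=> q hq; exact: (hm q hq).
Qed.

Definition lift_on (r : R) (h : 'rV[R]_n.+1 -> M) := h x0 = p0 /\
  forall z, `|proj z - x0| < r -> {for z, continuous h} /\ X (h z) = proj z.

Lemma proj_x0 : proj x0 = x0. Proof. by apply: proj_id; exact: XN. Qed.

Lemma near_proj (r : R) z : `|proj z - x0| < r -> \forall y \near z, `|proj y - x0| < r.
Proof.
move=> zr; have c : {for z, continuous (fun y => `|proj y - x0|)}.
  apply: (@continuous_comp _ _ _ (fun y => proj y - x0) (fun y => `|y|)); last exact: norm_continuous.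
  apply: (@continuousB _ _ _ proj (fun=> x0)); first exact: proj_continuous.
  exact: cst_continuous.
exact: (cvgr_lt _ c).
Qed.

(* Lift the segments issued from [x0] in [N] steps shorter than the radius of uniform tubes. *)
Lemma lift_exists (r : R) : exists h, lift_on r h.
Proof.
have [r0|r0] := leP r 0.
  exists (fun=> p0); split=> // z h.
  by have := le_lt_trans (normr_ge0 _) h; rewrite ltNge r0.
have [e e0 he] := uniform_tube r.
have {}he q : exists p, `|X q - x0| <= r -> tube_sheet (TB p) q /\ `|X q - X p| + 2 * e <= tube_radius (TB p).
  have [h|h] := leP (`|X q - x0|) r; first by have [p hp] := he q h; exists p.
  by exists p0.
have [P hP] := choice he.
pose N := (Num.truncn (r / e)).+1.
have Ne : r / N%:R < e.
  rewrite ltr_pdivrMr ?ltr0n // mulrC -ltr_pdivrMr //.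
  have re : 0 <= r / e by rewrite divr_ge0 // ltW.
  by have /andP[_] := truncn_itv re.
have N0' : 0 < N%:R :> R by rewrite ltr0n.
pose y k z := x0 + (k%:R / N%:R) *: (proj z - x0).
have yc k : continuous (y k).
  move=> z; apply: (@continuousD _ _ _ (fun=> x0) (fun z => (k%:R / N%:R) *: (proj z - x0))); first exact: cst_continuous.
  apply: (@continuous_comp _ _ _ (fun z => proj z - x0) (fun w => (k%:R / N%:R) *: w)).
    by apply: (@continuousB _ _ _ proj (fun=> x0)); [exact: proj_continuous|exact: cst_continuous].
  exact: scaler_continuous.
have yP k z : dotp (y k z) N0 = 0.
  by rewrite /y dotpDl dotpZl dotpBl proj_plane XN subr0 mulr0 addr0.
have yx0 k : y k x0 = x0 by rewrite /y proj_x0 subrr scaler0 addr0.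
have y_small k z : (k <= N)%N -> `|proj z - x0| < r -> `|y k z - x0| <= r.
  move=> kN zr; rewrite /y addrAC subrr add0r normrZ ger0_norm ?divr_ge0 //.
  rewrite -[leRHS]mul1r; apply: ler_pM => //; last exact: ltW.
  by rewrite ler_pdivrMr // mul1r ler_nat.
have y_step k z : `|proj z - x0| < r -> `|y k.+1 z - y k z| < e.
  move=> zr; have -> : y k.+1 z - y k z = N%:R^-1 *: (proj z - x0).
    rewrite /y opprD addrACA subrr add0r -scalerBl -mulrBl -natr1 addrAC subrr add0r mul1r.
    by [].
  rewrite normrZ ger0_norm ?invr_ge0 // mulrC; apply: le_lt_trans Ne.
  by apply: ler_wpM2r; [rewrite invr_ge0|exact: ltW].
suff [h [h1 h2]] : exists h : 'rV[R]_n.+1 -> M, h x0 = p0 /\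
    forall z, `|proj z - x0| < r -> {for z, continuous h} /\ X (h z) = y N z.
  exists h; split=> // z zr; have [c ->] := h2 z zr; split=> //.
  by rewrite /y divff ?gt_eqF // scale1r addrC subrK.
have : (N <= N)%N by []. 
elim: {-2}N => [|k IH] kN.
  exists (fun=> p0); split=> // z zr; split; first exact: cst_continuous.
  by rewrite /y mul0r scale0r addr0.
have [h [h1 h2]] := IH (ltnW kN).
have inball z s : `|proj z - x0| < r -> `|s - y k z| < e -> tube_ball (TB (P (h z))) s.
  move=> zr ws; have [_ XE] := h2 z zr.
  have [_ hr] := hP (h z) ltac:(by rewrite XE; apply: y_small => //; exact: ltnW).
  rewrite /tube_ball -ball_normE /= distrC.
  have -> : s - X (P (h z)) = (s - y k z) + (X (h z) - X (P (h z))) by rewrite XE addrA subrK.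
  apply: (le_lt_trans (ler_normD _ _)); move: ws hr.
  by move: `|_| `|_| => A B; lra.
exists (fun z => tube_foot (TB (P (h z))) (y k.+1 z)); split.
  rewrite h1 yx0; have [sp _] := hP p0 ltac:(by rewrite subrr normr0 ltW).
  have zx : `|proj x0 - x0| < r by rewrite proj_x0 subrr normr0.
  have := inball x0 x0 zx; rewrite yx0 subrr normr0 h1 => /(_ e0) O0.
  by have [] := tube_sheetE sp O0.
move=> z zr; split; last first.
  by apply: plane_foot; [apply: inball => //; exact: y_step|exact: yP].
have [hc XE] := h2 z zr; set p1 := P (h z).
have [s1 r1] := hP (h z) ltac:(by rewrite XE; apply: y_small => //; exact: ltnW).
have n1 : \forall z' \near z, tube_sheet (TB p1) (h z').
  by have o := open_nbhs_nbhs (conj (tube_sheet_open (TB p1)) s1); exact: (hc _ o).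
have n2 : \forall z' \near z, `|y k z' - y k z| < e.
  have /cvgrPdist_lt/(_ _ e0) := yc k z.
  by apply: filterS => z' /=; rewrite distrC.
(* The centre [P (h z')] may jump with z', having been picked by choice. Near z the fixed tube at p1
   gives the same foot: both feet lift the small segment from [y k z'] to [y k.+1 z'] and start at
   [h z'], so [unique_lift] identifies them. *)
have E : {near z, (fun z' => tube_foot (TB p1) (y k.+1 z')) =1
    (fun z' => tube_foot (TB (P (h z'))) (y k.+1 z'))}.
  apply: filterS3 (near_proj zr) n1 n2 => z' zr' s1' d'.
  have [_ XE'] := h2 z' zr'.
  have [s2 _] := hP (h z') ltac:(by rewrite XE'; apply: y_small => //; exact: ltnW).
  pose w := segment (y k z') (y k.+1 z').
  have wd t : `|w t - y k z'| < e by apply: (le_lt_trans (segment_dist _ _ _)); exact: y_step.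
  have O2 t : tube_ball (TB (P (h z'))) (w t) := inball z' (w t) zr' (wd t).
  have O1 t : tube_ball (TB p1) (w t).
    rewrite /tube_ball -ball_normE /= distrC.
    have -> : w t - X p1 = (w t - y k z') + (y k z' - y k z) + (X (h z) - X p1).
      rewrite XE; move: (w t) (y k z') (y k z) (X p1) => A B C D.
      by rewrite [A - B + _]addrA subrK addrA subrK.
    apply: (le_lt_trans (ler_normD _ _)).
    have := ler_normD (w t - y k z') (y k z' - y k z); move: (wd t) d' r1; rewrite -/p1.
    by move: `|_| `|_| `|_| `|_| => A B C D; lra.
  have wP t : dotp (w t) N0 = 0 by apply: segment_plane; exact: yP.
  have cf p (T : tube X gamma p) : (forall t, tube_ball T (w t)) -> continuous (fun t => tube_foot T (w t)).
    move=> O t A hA; have c := tube_foot_continuous (O t); have hA' := c _ hA.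
    exact: (@segment_continuous _ _ t _ hA').
  have := unique_lift (cf _ _ O1) (cf _ _ O2) _ _ 1; rewrite /w segment1; apply.
    by move=> t; rewrite !plane_foot.
  have w0 : w 0 = X (h z') by rewrite /w segment0 XE'.
  have := O1 0; have := O2 0; rewrite -/w w0 => o2 o1.
  by have [-> _] := tube_sheetE s1' o1; have [-> _] := tube_sheetE s2 o2.
apply: (near_eq_continuous E) => A hA.
have O : tube_ball (TB p1) (y k.+1 z) by apply: inball => //; exact: y_step.
by have c := tube_foot_continuous O; have hA' := c _ hA; exact: (yc k.+1 z _ hA').
Qed.

Lemma lift_unique (r r' : R) h h' z : lift_on r h -> lift_on r' h' ->
  `|proj z - x0| < r -> `|proj z - x0| < r' -> h (proj z) = h' (proj z).
Proof.
move=> [h0 hh] [h0' hh'] zr zr'; pose w := segment x0 (proj z).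
have wP t : proj (w t) = w t by apply: proj_id; apply: segment_plane; [exact: XN|exact: proj_plane].
have wd t : `|proj (w t) - x0| <= `|proj z - x0| by rewrite wP; exact: segment_dist.
have cf (s : R) (f : 'rV[R]_n.+1 -> M) : lift_on s f -> `|proj z - x0| < s -> continuous (fun t => f (w t)).
  move=> [_ fs] zs t A hA; have [c _] := fs (w t) (le_lt_trans (wd t) zs).
  by have hA' := c _ hA; exact: (@segment_continuous _ _ t _ hA').
have := unique_lift (cf r h (conj h0 hh) zr) (cf r' h' (conj h0' hh') zr') _ _ 1.
rewrite /w segment1; apply; last by rewrite segment0 h0 h0'.
move=> t; have [_ ->] := hh (w t) (le_lt_trans (wd t) zr).
by have [_ ->] := hh' (w t) (le_lt_trans (wd t) zr').
Qed.

(** Lifting yields a continuous section s of X over the plane. The map s o X and the identity both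
    lift X and agree at p0, so connectedness of M makes s a two-sided inverse. *)
Theorem proper_plane_immersion : injective X /\ range X = [set x | dotp x N0 = 0].
Proof.
have [S hS] := choice lift_exists.
(* Each finite radius has its own lift; the radius chosen here varies with z, and [lift_unique]
   makes the choices coherent, hence s continuous. *)
pose s z := S (`|proj z - x0| + 1) (proj z).
have sX z : X (s z) = proj z.
  have pp : proj (proj z) = proj z by apply: proj_id; exact: proj_plane.
  have [_ h] := hS (`|proj z - x0| + 1).
  by have [|_ ->] := h (proj z); rewrite pp // ltrDl.
have sc z : {for z, continuous s}.
  set r := `|proj z - x0| + 2.
  have pp y : proj (proj y) = proj y by apply: proj_id; exact: proj_plane.
  have n1 : \forall y \near z, `|proj y - x0| < r by apply: near_proj; rewrite ltrDl.
  apply: (@near_eq_continuous _ _ (fun y => S r (proj y))).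
    apply: filterS n1 => y yr; apply: (lift_unique (hS r) (hS _)) => //.
    by rewrite ltrDl.
  move=> A hA; have [_ h] := hS r.
  have [|c _] := h (proj z); first by rewrite pp ltrDl.
  by have hA' := c _ hA; exact: (@proj_continuous z _ hA').
have sXc q : {for q, continuous (fun q => s (X q))}.
  by move=> A hA; have hA' := sc _ _ hA; exact: (@Xc q _ hA').
have loc q : \forall q' \near q, `[< s (X q') = q' >] = `[< s (X q) = q >].
  apply: (lifts_agree (f := fun q => s (X q)) (g := id)); first exact: sXc.
    by move=> A; apply.
  by move=> q'; rewrite sX proj_id.
have s0 : s (X p0) = p0 by rewrite /s proj_x0; have [-> _] := hS (`|x0 - x0| + 1).
have sK q : s (X q) = q.
  by apply/asboolP; rewrite (locally_constant Mconn loc p0 q) asboolT.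
split; first by move=> p q E; rewrite -[p]sK -[q]sK E.
apply/seteqP; split=> [x [q _ <-]|x /= xN]; first exact: XN.
by exists (s x) => //; rewrite sX proj_id.
Qed.

End Covering.

Lemma immersion_continuous {R : realType} {n : nat} {M : smooth_manifold R n}
  (X : M -> 'rV[R]_n.+1) : immersion X -> continuous X.
Proof.
move=> Xi p; have [k Ak kp] := atlas_cover p; have [smX _] := Xi k Ak.
have ck : {for cmap k p, continuous (X \o cinv k)}.
  by apply: differentiable_continuous; exact: (smX [::] _ (cmap_img kp)).
apply: (@near_eq_continuous _ _ (fun q => (X \o cinv k) (cmap k q))).
  apply: filterS (open_nbhs_nbhs (conj (open_cdom k) kp)) => q kq.
  by rewrite /= cmapK.
by move=> A hA; have hA' := ck _ hA; exact: (cmap_continuous kp hA').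
Qed.

Unset Implicit Arguments.
Theorem theorem3p2 (R : realType) (n : nat) (n_gt0 : (0 < n)%N)
    (M : smooth_manifold R n) (X : M -> 'rV[R]_n.+1)
    (gamma : M -> 'rV[R]_n.+1) (S : set 'rV[R]_n.+1)
    (M_nonempty : [set: M] !=set0)
    (M_connected : connected [set: M])
    (M_oriented : oriented M)
    (X_immersion : immersion X)
    (X_proper : proper_map X)
    (X_complete : complete_metric X)
    (X_shrinker : self_shrinker X)
    (gamma_gauss : gauss_map X gamma)
    (S_hemisphere : closed_hemisphere_codim1 S)
    (gamma_avoids : range gamma `<=` @unit_sphere R n `\` S) :
  immersed_as_hyperplane X.
Proof.
have [p0 _] := M_nonempty; have Xc := immersion_continuous X_immersion.
have g1 q : dotp (gamma q) (gamma q) = 1 by apply: enorm1; have [] := gamma_gauss q.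
pose TB p := inhabited_witness (tube_exists X_immersion gamma_gauss X_shrinker p).
have [Q [QQ SE]] := S_hemisphere.
(* The columns of Q as row vectors: scalar products with them are the coordinates [x *m Q]. *)
pose a j : 'rV[R]_n.+1 := row j Q^T.
have aE x j : (x *m Q) 0 j = dotp x (a j) by rewrite -[Q in LHS]trmxK dotp_mulmx.
have a1 j : dotp (a j) (a j) = 1.
  by rewrite -aE /a -row_mul QQ !mxE eqxx.
(* Avoiding the hemisphere means that (u, v) never meets the half line v = 0, u <= 0 along which the
   polar angle is cut. *)
have slit q : dotp (gamma q) (a (inord 1)) = 0 -> dotp (gamma q) (a ord0) <= 0 -> False.
  move=> v0 u0; have [] := gamma_avoids (gamma q) ltac:(by exists q) => gS; apply.
  by rewrite SE /= !aE.
have gN q : gamma q = gamma p0.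
  exact: (gauss_map_constant Xc X_proper g1 TB n_gt0 M_connected (a1 _) (a1 _) slit).
have XN q : dotp (X q) (gamma p0) = 0.
  rewrite -(gN q).
  exact: (position_normal Xc X_proper g1 TB n_gt0 M_connected (a1 _) (a1 _) slit).
have [Xinj XE] := proper_plane_immersion Xc X_proper TB M_connected gN (g1 p0) XN p0.
split=> //; exists (gamma p0), 0; split=> //.
by apply/eqP => g0; have := g1 p0; rewrite g0 dotp0l => /esym/eqP; rewrite oner_eq0.
Qed.
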